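(* Let $\Omega\subset\mathbb{C}$ be a domain, $F=F_1+\mathrm{i}F_2$ holomorphic on $\Omega$, $F\not\equiv 0$, and let $a\in\Omega$ be an equilibrium of $\dot{x}=F(x)$ of order $m\in\mathbb{N}\setminus\{1\}$. Then $a$ is not a center, node or focus. Furthermore, the system $\dot{x}=F(x)$ has a finite elliptic decomposition (FED) of order $d:=2m-2$ in $a$. Additionally, the characteristic orbits of each elliptic sector tend to $a$ in adjacent definite directions given by $\mathcal{E}(F,m)$, i.e. the sectors have pairwise empty intersection up to the characteristic orbits and $a$.
   Context: We consider the holomorphic dynamical system $\dot{x}=\frac{\mathrm{d}x}{\mathrm{d}t}=F(x)$, $x\in\Omega$, with real time $t\in\mathbb{R}$, where $\Omega\subset\mathbb{C}\cong\mathbb{R}^2$ is open and connected and $F$ is holomorphic on $\Omega$. The order of an equilibrium $a$ (a zero of $F$) is its order as a zero of $F$. The set of definite directions is $\mathcal{E}(F,m):=\left\{\frac{\ell\pi-\arg(F^{(m)}(a))}{m-1}\bmod 2\pi:\ell\in\mathbb{Z}\right\}\subset[0,2\pi)$, which has exactly $2m-2$ elements; every orbit tending to $a$ does so in a definite direction $\theta_0\in\mathcal{E}(F,m)$ (i.e. $\arg(\Phi(t,y)-a)\to\theta_0$), and for each $\theta_0\in\mathcal{E}(F,m)$ all orbits starting in a small sector around the ray of angle $\theta_0$ at $a$ tend to $a$ in direction $\theta_0$. An equilibrium $a$ is a center if all orbits in a punctured neighborhood of $a$ are closed curves surrounding $a$; a stable (unstable) focus if all orbits in a punctured neighborhood tend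 to $a$ as $t\to\infty$ ($t\to-\infty$) with $|\arg(\Phi(t,y)-a)|\to\infty$; a stable (unstable) node if all orbits in a punctured neighborhood tend to $a$ as $t\to\infty$ ($t\to-\infty$) with $\arg(\Phi(t,y)-a)$ converging to some $\theta_0$. Given a closed piecewise $C^1$ Jordan curve $\Gamma$ with $\overline{\mathrm{Int}(\Gamma)}\subset\Omega$ containing $a$ as its only zero of $F$, a sector at $a$ is a compact set bounded by $a$, the portions inside $\Gamma$ of two distinct characteristic orbits $\Gamma_1,\Gamma_2$ meeting $\Gamma$ non-tangentially in single points $p_1\neq p_2$, and the arc of $\Gamma$ from $p_1$ to $p_2$ (counterclockwise). It is an elliptic sector if it contains a homoclinic orbit (positive and negative limit set both $\{a\}$) touching $\Gamma$ along an arc between $p_1$ and $p_2$, the orbits through the remaining boundary arc points enter/leave the interior of $\Gamma$ and tend to $a$ in one time direction, and every orbit in the interior region bounded by the homoclinic orbit and $a$ is homoclinic to $a$. The system has a finite elliptic decomposition of order $d\ge2$ at $a$ if $a$ is not a center, node or focus and there are $d$ characteristic orbits $\Gamma_1,\dots,\Gamma_d$ with points $p_1,\dots,p_d\in\Gamma$, ordered cyclically counterclockwise around $a$ (with $\Gamma_{d+1}:=\Gamma_1$, $p_{d+1}:=p_1$), such that for each $i$ the region bounded by $(\Gamma_i\cup\Gamma_{i+1})\cap\mathrm{Int}(\Gamma)$, the arc of $\Gamma$ from $p_i$ to $p_{i+1}$ and $a$ is an elliptic sector with characteristic orbits $\Gamma_i,\Gamma_{i+1}$. *)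

(* Defs.v *)
From Stdlib Require Import Reals Lra ZArith.
From Coquelicot Require Import Coquelicot.
Open Scope R_scope.

Definition connected_set (O : C -> Prop) : Prop :=
  forall U V : C -> Prop, open U -> open V ->
    (forall z, O z -> U z \/ V z) ->
    (exists z, O z /\ U z) -> (exists z, O z /\ V z) ->
    exists z, O z /\ U z /\ V z.

Definition is_domain (O : C -> Prop) : Prop :=
  open O /\ connected_set O /\ exists z, O z.

Definition holomorphic_on (O : C -> Prop) (F : C -> C) : Prop :=
  forall z, O z -> ex_derive (K := C_AbsRing) (V := C_NormedModule) F z.

Definition cderivs (O : C -> Prop) (F : C -> C) (D : nat -> C -> C) : Prop :=
  (forall z, O z -> D 0%nat z = F z) /\
  (forall n z, O z -> is_derive (K := C_AbsRing) (V := C_NormedModule) (D n) z (D (S n) z)).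

Definition nth_cderiv (O : C -> Prop) (F : C -> C) (n : nat) (a c : C) : Prop :=
  exists D, cderivs O F D /\ D n a = c.

Definition zero_order (O : C -> Prop) (F : C -> C) (a : C) (m : nat) : Prop :=
  exists D, cderivs O F D /\ (forall k, (k < m)%nat -> D k a = 0) /\ D m a <> 0.

Definition unit_dir (th : R) : C := (cos th, sin th).

Definition is_arg (c : C) (phi : R) : Prop := c = (RtoC (Cmod c) * unit_dir phi)%C.

(* th is in E(F,m) where c = F^(m)(a):
   th in [0,2pi) and th = (l pi - arg c)/(m-1) mod 2pi *)
Definition definite_dir (c : C) (m : nat) (th : R) : Prop :=
  0 <= th < 2 * PI /\
  exists (l k : Z) (phi : R), is_arg c phi /\
    th = (IZR l * PI - phi) / (INR m - 1) + 2 * IZR k * PI.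

Definition time_interval (I : R -> Prop) : Prop :=
  exists lo hi : Rbar, Rbar_lt lo 0 /\ Rbar_lt 0 hi /\
    forall t, I t <-> (Rbar_lt lo t /\ Rbar_lt t hi).

Definition is_solution (O : C -> Prop) (F : C -> C) (I : R -> Prop) (x : R -> C) : Prop :=
  forall t, I t -> O (x t) /\ is_derive x t (F (x t)).

Definition max_solution (O : C -> Prop) (F : C -> C) (I : R -> Prop) (x : R -> C) : Prop :=
  time_interval I /\ is_solution O F I x /\
  forall (J : R -> Prop) (y : R -> C), time_interval J -> is_solution O F J y ->
    (forall t, I t -> J t) -> (forall t, I t -> y t = x t) -> forall t, J t -> I t.

Definition orbit (I : R -> Prop) (x : R -> C) : C -> Prop :=
  fun z => exists t, I t /\ x t = z.

Definition tends_fwd (I : R -> Prop) (x : R -> C) (a : C) : Prop :=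
  (forall t, 0 <= t -> I t) /\ filterlim x (Rbar_locally p_infty) (locally a).
Definition tends_bwd (I : R -> Prop) (x : R -> C) (a : C) : Prop :=
  (forall t, t <= 0 -> I t) /\ filterlim x (Rbar_locally m_infty) (locally a).

Definition dirvec (x : R -> C) (a : C) : R -> C :=
  fun t => (RtoC (/ Cmod (x t - a)%C) * (x t - a))%C.

(* x(t) -> a and arg(x(t) - a) -> th (mod 2 pi) as t -> +oo (resp. -oo) *)
Definition tends_fwd_dir (I : R -> Prop) (x : R -> C) (a : C) (th : R) : Prop :=
  tends_fwd I x a /\ filterlim (dirvec x a) (Rbar_locally p_infty) (locally (unit_dir th)).
Definition tends_bwd_dir (I : R -> Prop) (x : R -> C) (a : C) (th : R) : Prop :=
  tends_bwd I x a /\ filterlim (dirvec x a) (Rbar_locally m_infty) (locally (unit_dir th)).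

Definition spirals_fwd (I : R -> Prop) (x : R -> C) (a : C) : Prop :=
  tends_fwd I x a /\
  exists th : R -> R, (forall t, 0 <= t -> continuous th t /\ is_arg (x t - a)%C (th t)) /\
    filterlim (fun t => Rabs (th t)) (Rbar_locally p_infty) (Rbar_locally p_infty).
Definition spirals_bwd (I : R -> Prop) (x : R -> C) (a : C) : Prop :=
  tends_bwd I x a /\
  exists th : R -> R, (forall t, t <= 0 -> continuous th t /\ is_arg (x t - a)%C (th t)) /\
    filterlim (fun t => Rabs (th t)) (Rbar_locally m_infty) (Rbar_locally p_infty).

Definition near_punctured (O : C -> Prop) (F : C -> C) (a : C)
  (P : (R -> Prop) -> (R -> C) -> Prop) : Prop :=
  exists r, 0 < r /\ forall y, 0 < Cmod (y - a)%C < r ->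
    forall I x, max_solution O F I x -> x 0 = y -> P I x.

(* p is in the interior of S : p not in S and the path component of p in the
   complement of S is bounded (i.e. p lies in a bounded component of C \ S). *)
Definition Int_set (S : C -> Prop) (p : C) : Prop :=
  ~ S p /\
  exists Rb, 0 < Rb /\ forall c : R -> C,
    (forall s, 0 <= s <= 1 -> continuous c s) -> c 0 = p ->
    (forall s, 0 <= s <= 1 -> ~ S (c s)) -> Cmod (c 1) <= Rb.

Definition is_center (O : C -> Prop) (F : C -> C) (a : C) : Prop :=
  near_punctured O F a (fun I x =>
    (forall t, I t) /\ (exists T, 0 < T /\ forall t, x (t + T) = x t) /\ Int_set (orbit I x) a).

Definition is_stable_focus O F a := near_punctured O F a (fun I x => spirals_fwd I x a).
Definition is_unstable_focus O F a := near_punctured O F a (fun I x => spirals_bwd I x a).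
Definition is_focus O F a := is_stable_focus O F a \/ is_unstable_focus O F a.

Definition is_stable_node O F a :=
  near_punctured O F a (fun I x => exists th, tends_fwd_dir I x a th).
Definition is_unstable_node O F a :=
  near_punctured O F a (fun I x => exists th, tends_bwd_dir I x a th).
Definition is_node O F a := is_stable_node O F a \/ is_unstable_node O F a.

Definition gx (g : R -> C) : R -> R := fun s => fst (g s).
Definition gy (g : R -> C) : R -> R := fun s => snd (g s).
Definition dg (g : R -> C) (s : R) : C := (Derive (gx g) s, Derive (gy g) s).
Definition smooth_at (g : R -> C) (s : R) : Prop :=
  ex_derive (gx g) s /\ ex_derive (gy g) s.

Definition curve (g : R -> C) : C -> Prop := fun z => exists s, 0 <= s <= 1 /\ g s = z.

Definition arc (g : R -> C) (u v : R) : C -> Prop := fun z => exists s, u <= s <= v /\ g s = z.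

Definition frac_part01 (s : R) : R := s - IZR (Int_part s).

Definition jordan_pc1 (g : R -> C) : Prop :=
  (forall s, continuous g s) /\
  (forall s, g (s + 1) = g s) /\
  (forall s1 s2, 0 <= s1 < 1 -> 0 <= s2 < 1 -> g s1 = g s2 -> s1 = s2) /\
  exists P : list R,
    (forall s, ~ List.In (frac_part01 s) P ->
       smooth_at g s /\ continuous (Derive (gx g)) s /\ continuous (Derive (gy g)) s) /\
    (forall p, List.In p P -> exists l r : C,
       filterlim (dg g) (at_left p) (locally l) /\ filterlim (dg g) (at_right p) (locally r)).

Definition ccw (g : R -> C) : Prop :=
  forall s, smooth_at g s -> dg g s <> 0 ->
    exists e0, 0 < e0 /\ forall e, 0 < e < e0 -> Int_set (curve g) (g s + RtoC e * (Ci * dg g s))%C.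

Definition cross (u v : C) : R := fst u * snd v - snd u * fst v.

Definition meets_once_transversally (F : C -> C) (g : R -> C) (I : R -> Prop) (x : R -> C) (s : R) : Prop :=
  (forall z, orbit I x z /\ curve g z <-> z = g s) /\
  smooth_at g s /\ cross (dg g s) (F (g s)) <> 0.

Definition characteristic (I : R -> Prop) (x : R -> C) (a : C) : Prop :=
  exists th, tends_fwd_dir I x a th \/ tends_bwd_dir I x a th.

(* homoclinic orbit : positive and negative limit sets both {a} *)
Definition homoclinic (I : R -> Prop) (x : R -> C) (a : C) : Prop :=
  tends_fwd I x a /\ tends_bwd I x a.

Definition sector_boundary (g : R -> C) (a : C) I1 x1 I2 x2 (s1 s2 : R) : C -> Prop :=
  fun z => z = a \/ (orbit I1 x1 z /\ Int_set (curve g) z) \/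
           (orbit I2 x2 z /\ Int_set (curve g) z) \/ arc g s1 s2 z.

Definition sector_set g a I1 x1 I2 x2 s1 s2 : C -> Prop :=
  fun z => sector_boundary g a I1 x1 I2 x2 s1 s2 z \/ Int_set (sector_boundary g a I1 x1 I2 x2 s1 s2) z.

Definition enters_or_leaves (g : R -> C) (x : R -> C) : Prop :=
  exists e, 0 < e /\
   ((forall t, 0 < t < e -> Int_set (curve g) (x t)) /\
    (forall t, - e < t < 0 -> ~ Int_set (curve g) (x t) /\ ~ curve g (x t))
    \/
    (forall t, - e < t < 0 -> Int_set (curve g) (x t)) /\
    (forall t, 0 < t < e -> ~ Int_set (curve g) (x t) /\ ~ curve g (x t))).

(* elliptic sector with characteristic orbits (I1,x1), (I2,x2) meeting the curve
   at g s1, g s2, with s1 < s2 < s1 + 1 (the arc from g s1 to g s2 counterclockwise) *)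
Definition elliptic_sector (O : C -> Prop) (F : C -> C) (a : C) (g : R -> C)
  I1 x1 I2 x2 (s1 s2 : R) : Prop :=
  s1 < s2 < s1 + 1 /\
  max_solution O F I1 x1 /\ max_solution O F I2 x2 /\
  characteristic I1 x1 a /\ characteristic I2 x2 a /\
  ~ (forall z, orbit I1 x1 z <-> orbit I2 x2 z) /\
  meets_once_transversally F g I1 x1 s1 /\ meets_once_transversally F g I2 x2 s2 /\
  exists Ih xh u v,
    max_solution O F Ih xh /\ homoclinic Ih xh a /\
    (forall z, orbit Ih xh z -> sector_set g a I1 x1 I2 x2 s1 s2 z) /\
    s1 < u /\ u <= v /\ v < s2 /\
    (forall z, orbit Ih xh z /\ curve g z <-> arc g u v z) /\
    (forall s, (s1 <= s < u \/ v < s <= s2) -> forall J y,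
       max_solution O F J y -> y 0 = g s ->
       enters_or_leaves g y /\ (tends_fwd J y a \/ tends_bwd J y a)) /\
    (forall z, Int_set (fun w => w = a \/ orbit Ih xh w) z -> forall J y,
       max_solution O F J y -> y 0 = z -> homoclinic J y a).

Definition admissible_curve (O : C -> Prop) (F : C -> C) (a : C) (g : R -> C) : Prop :=
  jordan_pc1 g /\ ccw g /\
  (forall z, Int_set (curve g) z \/ curve g z -> O z) /\
  Int_set (curve g) a /\
  (forall z, Int_set (curve g) z \/ curve g z -> F z = 0 -> z = a).

(* the data of a finite elliptic decomposition of order d at a: curve g,
   parameters s 0 < s 1 < ... < s (d-1) < s 0 + 1 of the points p_i = g (s i),
   characteristic orbits (I i, x i), i < d, with indices taken mod d *)
Definition next_param (d : nat) (s : nat -> R) (i : nat) : R :=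
  if Nat.eqb (S i) d then s 0%nat + 1 else s (S i).

Definition FED_data (O : C -> Prop) (F : C -> C) (a : C) (d : nat) (g : R -> C)
  (s : nat -> R) (I : nat -> R -> Prop) (x : nat -> R -> C) : Prop :=
  admissible_curve O F a g /\
  (forall i, (i < d)%nat -> s i < next_param d s i) /\
  forall i, (i < d)%nat ->
    elliptic_sector O F a g (I i) (x i) (I ((S i) mod d)) (x ((S i) mod d))
      (s i) (next_param d s i).

Definition FED (O : C -> Prop) (F : C -> C) (a : C) (d : nat) : Prop :=
  (2 <= d)%nat /\ ~ is_center O F a /\ ~ is_node O F a /\ ~ is_focus O F a /\
  exists g s I x, FED_data O F a d g s I x.

(* Main.v *)
(* Write w = z - a, m = n + 1 and F = c0 w^m G, so that G tends to 1 at a. Along an orbit P = -1/(n c0 w^n)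
   satisfies P' = G, and G' P is small, so |P|^2 is strictly convex in time: inside a small disc the distance to a
   has no local minimum along an orbit, and an orbit point moving inwards (outwards, along the circle) tends to a
   in forward (backward, both) time. In the angle Y = n arg w + arg c0 the circles |w| = rho are crossed outwards
   near Y = 0 mod 2 pi, inwards near Y = pi mod 2 pi, and touched at exactly one point in between. As P/t tends
   to 1, orbits tending to a have limit directions Y = k pi, and inside the disc they are graphs of angle over
   radius.

   The curve is a small circle. Between two consecutive rays Y = k pi and Y = (k + 1) pi the orbit through the
   tangency point is homoclinic, touches the circle once, and encloses only homoclinic orbits, because orbits do
   not cross. For the characteristic orbits one needs orbits that never come back to the circle. If all orbits
   leaving the circle near a ray came back to a, the maximal distance reached by such an orbit would be a
   continuous function on a compact arc and attain its maximum; but a point slightly farther away flows back to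
   the same arc. Reversing time exchanges outgoing and incoming rays. *)
Require Import Defs.
From Stdlib Require Import Reals ZArith Lra Lia Psatz Classical ClassicalEpsilon FunctionalExtensionality.
From Coquelicot Require Import Coquelicot.
Open Scope R_scope.

(** * Calculus of complex-valued functions of a real variable *)

(** [Int_set] is defined through paths, so interiors are computed by hand and not through the Jordan
    curve theorem. Apart from the circle itself, every closed curve that occurs consists of [a], two
    polar graphs over the radius and an arc. A point outside escapes along an interpolated graph,
    and a path avoiding the curve cannot leave the inside because inside and outside are both open.

    The tolerance 1/20 of the local form is used three times. It keeps the derivative of [N] above
    1/2. It is far below 7/10 < cos(pi/4), so the sign of the radial velocity is known away from the
    tangencies. It keeps the angular derivative negative for pi/4 <= Y <= 3 pi/4, so the tangency
    there is unique.

    Lines along the rays are constructed only for Y near 0. The symmetry F -> -F, c0 -> -c0, alpha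
    -> alpha - pi moves the ray Y = pi to Y = 0, and k reversals move the k-th ray there. After 2n
    reversals the field is restored and the angle has made one full turn, which closes the cycle of
    sectors. *)

Lemma real_induction (P : R -> Prop) (a b : R) :
  (forall t, a <= t <= b -> (forall s, a <= s < t -> P s) ->
     exists e, 0 < e /\ forall s, t <= s < t + e -> s <= b -> P s) ->
  forall t, a <= t <= b -> P t.
Proof.
intros step t Ht.
(* [E] collects the ends of half-open intervals on which [P] is known. [P] holds below its supremum
   [S], and the step at [S] overshoots [S] unless [S = b]. *)
set (E := fun u => a <= u <= b /\ forall s, a <= s < u -> P s).
destruct (completeness E) as [S [Sub Slub]].
- exists b. intros u [Hu _]. lra.
- exists a. split; [lra|]. intros; lra.
- assert (HaS : a <= S) by (apply Sub; split; [lra|intros; lra]).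
  assert (HSb : S <= b) by (apply Slub; intros u [Hu _]; lra).
  assert (HS : forall s, a <= s < S -> P s).
  { intros s Hs. apply NNPP. intros Hn.
    assert (S <= s); [|lra]. apply Slub. intros u [Hu Pu].
    destruct (Rle_dec u s); [lra|]. exfalso; apply Hn, Pu; lra. }
  destruct (step S) as [e [He HP]]; [lra|exact HS|].
  assert (E (Rmin (S + e) b)).
  { split.
    - split; [apply Rmin_glb; lra|apply Rmin_r].
    - intros s Hs. destruct (Rlt_dec s S); [apply HS; lra|].
      pose proof (Rmin_l (S+e) b). pose proof (Rmin_r (S+e) b).
      apply HP; lra. }
  assert (Rmin (S + e) b <= S) by (apply Sub; assumption).
  assert (S = b). { revert H0. apply Rmin_case; intros; lra. }
  destruct (Rlt_dec t S); [apply HS; lra|apply HP; lra].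
Qed.

Lemma mvt_ge (f f' : R -> R) (a b c : R) :
  a <= b -> (forall t, a <= t <= b -> is_derive f t (f' t)) ->
  (forall t, a <= t <= b -> c <= f' t) -> c * (b - a) <= f b - f a.
Proof.
intros Hab Hd Hc.
destruct (MVT_gen f a b f') as [t [Ht ->]].
- rewrite Rmin_left, Rmax_right by lra. intros; apply Hd; lra.
- rewrite Rmin_left, Rmax_right by lra. intros.
  apply continuity_pt_filterlim, (ex_derive_continuous (V := R_NormedModule)).
  eexists; apply Hd; lra.
- rewrite Rmin_left, Rmax_right in Ht by lra.
  apply Rmult_le_compat_r; [lra|apply Hc; lra].
Qed.

Lemma mvt_le (f f' : R -> R) (a b c : R) :
  a <= b -> (forall t, a <= t <= b -> is_derive f t (f' t)) ->
  (forall t, a <= t <= b -> f' t <= c) -> f b - f a <= c * (b - a).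
Proof.
intros Hab Hd Hc.
assert (H := mvt_ge (fun t => - f t) (fun t => - f' t) a b (- c) Hab).
enough (- c * (b - a) <= - f b - - f a) by lra. apply H.
- intros t Ht. apply (is_derive_opp f), Hd, Ht.
- intros t Ht. specialize (Hc t Ht). lra.
Qed.

Lemma ivt_zero (f : R -> R) (a b : R) : a <= b ->
  (forall t, a <= t <= b -> continuous f t) -> f a <= 0 -> 0 <= f b ->
  exists t, a <= t <= b /\ f t = 0.
Proof.
intros Hab Hc Ha Hb.
destruct (Req_dec (f a) 0); [exists a; lra|].
destruct (Req_dec (f b) 0); [exists b; lra|].
destruct (Ranalysis5.IVT_interv f a b) as [t [Ht Hf]]; try lra.
- intros t Ht. apply continuity_pt_filterlim, Hc, Ht.
- destruct (Req_dec a b); [subst; lra|lra].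
- exists t; split; assumption.
Qed.

Lemma Cmod_sqr (z : C) : Cmod z ^ 2 = fst z ^ 2 + snd z ^ 2.
Proof. apply Cmod2_alt. Qed.

Lemma Cmod_fst (z : C) : Rabs (fst z) <= Cmod z.
Proof. eapply Rle_trans; [|apply Rmax_Cmod]. apply Rmax_l. Qed.

Lemma Cmod_snd (z : C) : Rabs (snd z) <= Cmod z.
Proof. eapply Rle_trans; [|apply Rmax_Cmod]. apply Rmax_r. Qed.

Lemma Cmod_le_sum (z : C) : Cmod z <= Rabs (fst z) + Rabs (snd z).
Proof.
assert (H := Cmod_sqr z). assert (0 <= Cmod z) by apply Cmod_ge_0.
assert (Hx := Rabs_pos (fst z)). assert (Hy := Rabs_pos (snd z)).
rewrite <- (pow2_abs (fst z)), <- (pow2_abs (snd z)) in H. nra.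
Qed.

Lemma Cmod_minus_sym (z w : C) : Cmod (z - w) = Cmod (w - z).
Proof. rewrite <- Cmod_opp. f_equal. ring. Qed.

Lemma Cmod_sub_diag (z : C) : Cmod (z - z) = 0.
Proof. replace (z - z)%C with (RtoC 0) by ring. apply Cmod_0. Qed.

Lemma Csub_eq_0 (z w : C) : (z - w)%C = 0 -> z = w.
Proof. intros H. replace z with (z - w + w)%C by ring. rewrite H. ring. Qed.

Lemma Cmod_minus_triangle (u v w : C) : Cmod (u - w) <= Cmod (u - v) + Cmod (v - w).
Proof. replace (u - w)%C with ((u - v) + (v - w))%C by ring. apply Cmod_triangle. Qed.

Lemma Cmod_rev_triangle (u v : C) : Cmod u - Cmod v <= Cmod (u - v).
Proof.
assert (H := Cmod_triangle (u - v) v). replace (u - v + v)%C with u in H by ring. lra.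
Qed.

Lemma Cmod_sub_0 (z w : C) : Cmod (z - w) = 0 -> z = w.
Proof. intros H. apply Csub_eq_0, Cmod_eq_0, H. Qed.

Lemma Cmod_sub_pos (z w : C) : z <> w -> 0 < Cmod (z - w).
Proof. intros H. destruct (Rle_lt_or_eq_dec 0 (Cmod (z - w)) (Cmod_ge_0 _)); [assumption|].
 exfalso; apply H, Cmod_sub_0; auto. Qed.

(** Balls of [C] come from the product structure and are squares; the resulting factor [sqrt 2] is
    rounded up to 2. *)
Lemma ball_C_Cmod (z w : C) (e : posreal) : ball z e w -> Cmod (w - z) < 2 * e.
Proof.
intros H. apply C_NormedModule_mixin_compat2 in H.
assert (sqrt 2 < 2). { apply Rsqr_incrst_0; [|apply sqrt_pos|lra]. rewrite Rsqr_sqrt; unfold Rsqr; lra. }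
assert (He := cond_pos e). change (Cmod (w - z) < sqrt 2 * e) in H. nra.
Qed.

Lemma Cmod_ball_C (z w : C) (e : R) : Cmod (w - z) < e -> ball z e w.
Proof. apply C_NormedModule_mixin_compat1. Qed.

Lemma locally_Cmod (z : C) (P : C -> Prop) :
  locally z P <-> exists e, 0 < e /\ forall w, Cmod (w - z) < e -> P w.
Proof.
split.
- intros [e He]. exists e. split; [apply cond_pos|]. intros w Hw. apply He, Cmod_ball_C, Hw.
- intros [e [He H]]. assert (He2 : 0 < e / 2) by lra. exists (mkposreal _ He2).
  intros w Hw. apply H. apply ball_C_Cmod in Hw. simpl in Hw. lra.
Qed.

Lemma locally_Rabs (t : R) (P : R -> Prop) :
  locally t P <-> exists e, 0 < e /\ forall s, Rabs (s - t) < e -> P s.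
Proof.
split.
- intros [e He]. exists e. split; [apply cond_pos|]. intros w Hw. apply He, Hw.
- intros [e [He H]]. exists (mkposreal _ He). intros w Hw. apply H, Hw.
Qed.

Lemma filterlim_C {T} (G : (T -> Prop) -> Prop) (FG : Filter G) (f : T -> C) (l : C) :
  filterlim f G (locally l) <-> forall e, 0 < e -> G (fun t => Cmod (f t - l) < e).
Proof.
split.
- intros H e He. apply (H (fun z => Cmod (z - l) < e)). apply locally_Cmod. exists e; auto.
- intros H P HP. apply locally_Cmod in HP. destruct HP as [e [He HP]].
  unfold filtermap. apply filter_imp with (2 := H e He). intros t; apply HP.
Qed.

Lemma continuous_C (f : R -> C) (t : R) :
  continuous f t <-> forall e, 0 < e -> exists d, 0 < d /\ forall s, Rabs (s - t) < d -> Cmod (f s - f t) < e.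
Proof.
unfold continuous. rewrite (filterlim_C (locally t) _ f (f t)).
split; intros H e He; [apply locally_Rabs|apply locally_Rabs]; auto.
Qed.

Lemma continuous_R (f : R -> R) (t : R) :
  continuous f t <-> forall e, 0 < e -> exists d, 0 < d /\ forall s, Rabs (s - t) < d -> Rabs (f s - f t) < e.
Proof.
split.
- intros H e He. apply locally_Rabs. apply (H (fun y => Rabs (y - f t) < e)).
  apply locally_Rabs. exists e; auto.
- intros H P HP. apply locally_Rabs in HP. destruct HP as [e [He HP]].
  destruct (H e He) as [d [Hd Hs]]. apply locally_Rabs. exists d; split; auto.
Qed.

Lemma continuous_C_fst (f : R -> C) (t : R) : continuous f t -> continuous (fun s => fst (f s)) t.
Proof. intros H. apply (continuous_comp f fst t H), continuous_fst. Qed.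
Lemma continuous_C_snd (f : R -> C) (t : R) : continuous f t -> continuous (fun s => snd (f s)) t.
Proof. intros H. apply (continuous_comp f snd t H), continuous_snd. Qed.

Lemma continuous_C_pair (f g : R -> R) (t : R) :
  continuous f t -> continuous g t -> continuous (fun s => (f s, g s) : C) t.
Proof.
rewrite !continuous_R, continuous_C. intros Hf Hg e He.
destruct (Hf (e/2)) as [d1 [Hd1 H1]]; [lra|]. destruct (Hg (e/2)) as [d2 [Hd2 H2]]; [lra|].
exists (Rmin d1 d2). split; [apply Rmin_pos; auto|]. intros s Hs.
assert (H3 := Cmod_le_sum ((f s, g s) - (f t, g t))%C). simpl in H3.
specialize (H1 s (Rlt_le_trans _ _ _ Hs (Rmin_l _ _))).
specialize (H2 s (Rlt_le_trans _ _ _ Hs (Rmin_r _ _))).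
unfold Rminus in H1, H2. lra.
Qed.

Lemma continuous_Cmod_sub (f : R -> C) (a : C) (t : R) :
  continuous f t -> continuous (fun s => Cmod (f s - a)%C) t.
Proof.
rewrite continuous_C, continuous_R. intros H e He. destruct (H e He) as [d [Hd Hs]].
exists d; split; auto. intros s Hst. specialize (Hs s Hst).
assert (H1 := Cmod_minus_triangle (f s) (f t) a). assert (H2 := Cmod_minus_triangle (f t) (f s) a).
rewrite (Cmod_minus_sym (f t) (f s)) in H2. apply Rabs_def1; lra.
Qed.

Lemma is_derive_C_pair (x : R -> C) (t : R) (v : C) :
  is_derive x t v <-> is_derive (fun s => fst (x s)) t (fst v) /\ is_derive (fun s => snd (x s)) t (snd v).
Proof.
split.
- intros H. split.
  + refine (filterdiff_ext_lin _ _ _ (filterdiff_comp' x fst t (fun y => scal y v) fst H _) _).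
    * apply filterdiff_linear, is_linear_fst.
    * intros y; reflexivity.
  + refine (filterdiff_ext_lin _ _ _ (filterdiff_comp' x snd t (fun y => scal y v) snd H _) _).
    * apply filterdiff_linear, is_linear_snd.
    * intros y; reflexivity.
- intros [H1 H2].
  apply (filterdiff_ext (fun s => (fst (x s), snd (x s)))).
  { intros s; destruct (x s); reflexivity. }
  assert (Hid : filterdiff (fun p : R * R => (fst p, snd p)) (locally (fst (x t), snd (x t))) (fun p => (fst p, snd p))).
  { apply (filterdiff_ext (fun p => p)); [intros [? ?]; reflexivity|].
    apply (filterdiff_ext_lin _ (fun p => p)); [|intros [? ?]; reflexivity].
    apply filterdiff_id. }
  refine (filterdiff_ext_lin _ _ _ (filterdiff_comp'_2 (fun s => fst (x s)) (fun s => snd (x s)) (fun a b => (a, b)) t _ _ (fun a b => (a, b)) H1 H2 Hid) _).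
  intros y; destruct v; reflexivity.
Qed.

Lemma is_derive_C_continuous (x : R -> C) (t : R) (v : C) : is_derive x t v -> continuous x t.
Proof.
intros H. apply (ex_derive_continuous (V := C_R_NormedModule)). exists v. exact H.
Qed.

Lemma is_derive_mulC (x y : R -> C) (t : R) (v w : C) :
  is_derive x t v -> is_derive y t w -> is_derive (fun s => (x s * y s)%C) t (v * y t + x t * w)%C.
Proof.
rewrite !is_derive_C_pair. intros [Hx1 Hx2] [Hy1 Hy2]. simpl. split.
- evar_last. 
  + apply (is_derive_minus (V := R_NormedModule)).
    * apply (Derive.is_derive_mult _ _ _ _ _ Hx1 Hy1).
    * apply (Derive.is_derive_mult _ _ _ _ _ Hx2 Hy2).
  + unfold minus, plus, opp; simpl. ring.
- evar_last. 
  + apply (is_derive_plus (V := R_NormedModule)).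
    * apply (Derive.is_derive_mult _ _ _ _ _ Hx1 Hy2).
    * apply (Derive.is_derive_mult _ _ _ _ _ Hx2 Hy1).
  + unfold minus, plus, opp; simpl. ring.
Qed.


Lemma is_derive_C_eps (f : C -> C) (z l : C) :
  is_derive (K := C_AbsRing) (V := C_NormedModule) f z l <->
  forall e, 0 < e -> exists d, 0 < d /\ forall w, Cmod (w - z) < d ->
    Cmod (f w - f z - l * (w - z)) <= e * Cmod (w - z).
Proof.
split.
- intros [_ H] e He.
  assert (Hz : is_filter_lim (locally (z : AbsRing_UniformSpace C_AbsRing)) z) by (intros P HP; exact HP).
  destruct (H z Hz (mkposreal e He)) as [d Hd].
  exists d. split; [apply cond_pos|]. intros w Hw.
  replace (l * (w - z))%C with ((w - z) * l)%C by ring.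
  exact (Hd w Hw).
- intros H. split; [apply (is_linear_scal_l (K := C_AbsRing))|].
  intros z' Hz'. apply (is_filter_lim_locally_unique (V := AbsRing_NormedModule C_AbsRing)) in Hz'. subst z'.
  intros e. destruct (H e (cond_pos e)) as [d [Hd Hw]].
  exists (mkposreal d Hd). intros w Hb. specialize (Hw w Hb).
  replace (l * (w - z))%C with ((w - z) * l)%C in Hw by ring.
  exact Hw.
Qed.

Lemma scal_RtoC (r : R) (u : C) : scal r (u : C_R_NormedModule) = (RtoC r * u)%C.
Proof. destruct u. unfold scal; simpl; unfold prod_scal, scal, RtoC; simpl; unfold mult, Cmult; simpl. f_equal; ring. Qed.

(** The outer derivative is over the complex scalars and the inner one over the real scalars. Once
    the linear part [l * x s] is subtracted, complex differentiability makes the rest small against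
    [x s - x t], which is of order [s - t]; so the rest has derivative 0. *)
Lemma is_derive_compC (f : C -> C) (x : R -> C) (t : R) (l v : C) :
  is_derive (K := C_AbsRing) (V := C_NormedModule) f (x t) l -> is_derive x t v ->
  is_derive (fun s => f (x s)) t (l * v)%C.
Proof.
intros Hf Hx.
assert (Hd : is_derive (fun s => (l * x s)%C) t (l * v)%C).
{ evar_last. apply (is_derive_mulC (fun _ => l) x t 0 v).
  - apply (is_derive_const (V := C_R_NormedModule)).
  - exact Hx.
  - ring. }
assert (Hz : is_derive (fun s => (f (x s) - l * x s)%C) t (RtoC 0)).
{ split; [apply (is_linear_scal_l (K := R_AbsRing))|].
  intros t' Ht'. apply (is_filter_lim_locally_unique (V := AbsRing_NormedModule R_AbsRing)) in Ht'. subst t'.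
  intros e. assert (Hx0 := Hx). destruct Hx as [_ Hx].
  assert (Ht : is_filter_lim (locally t) t) by (intros P HP; exact HP).
  specialize (Hx t Ht (mkposreal 1 Rlt_0_1)).
  (* Near [t] the curve is Lipschitz with constant [K]: the definition of its derivative is used
     with tolerance 1. *)
  set (K := 1 + Cmod v).
  assert (HK : 0 < K) by (unfold K; pose proof (Cmod_ge_0 v); lra).
  assert (He : 0 < e / K) by (apply Rdiv_lt_0_compat; [apply cond_pos|exact HK]).
  destruct (proj1 (is_derive_C_eps _ _ _) Hf _ He) as [d [Hd0 H]].
  assert (Hc : locally t (fun s => Cmod (x s - x t) < d)).
  { assert (Hcx := is_derive_C_continuous x t v Hx0).
    apply (proj1 (filterlim_C (locally t) _ x (x t)) Hcx d Hd0). }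
  generalize (filter_and _ _ Hx Hc). apply filter_imp. intros s [H1 H2].
  specialize (H _ H2).
  change (norm (((x s - x t) - scal (s - t)%R (v : C_R_NormedModule))%C : C_R_NormedModule) <= 1 * Rabs (s - t)) in H1.
  rewrite <- Cmod_norm in H1.
  change (norm (((f (x s) - l * x s - (f (x t) - l * x t)) - scal (s - t)%R (RtoC 0 : C_R_NormedModule))%C : C_R_NormedModule) <= e * Rabs (s - t)).
  rewrite <- Cmod_norm.
  rewrite scal_RtoC in H1 |- *.
  replace (f (x s) - l * x s - (f (x t) - l * x t) - RtoC (s - t) * 0)%C with (f (x s) - f (x t) - l * (x s - x t))%C by ring.
  eapply Rle_trans; [exact H|].
  assert (Cmod (x s - x t) <= K * Rabs (s - t)).
  { replace (x s - x t)%C with ((x s - x t - RtoC (s - t) * v) + RtoC (s - t) * v)%C by ring.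
    eapply Rle_trans; [apply Cmod_triangle|].
    rewrite (Cmod_mult (RtoC (s - t))), Cmod_R. unfold K. lra. }
  apply Rle_trans with (e / K * (K * Rabs (s - t))); [apply Rmult_le_compat_l; lra|].
  right. field. lra. }
evar_last.
- apply (is_derive_ext (V := C_R_NormedModule) (fun s => plus (f (x s) - l * x s)%C (l * x s)%C)).
  + intros s. change ((f (x s) - l * x s + l * x s)%C = f (x s)). ring.
  + apply (is_derive_plus (V := C_R_NormedModule)); [exact Hz|exact Hd].
- change (0 + l * v = l * v)%C. ring.
Qed.

Lemma is_derive_constC (c : C) (t : R) : is_derive (fun _ : R => c) t (RtoC 0).
Proof. apply (is_derive_const (V := C_R_NormedModule)). Qed.

Lemma is_derive_addC (x y : R -> C) (t : R) (v w : C) :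
  is_derive x t v -> is_derive y t w -> is_derive (fun s => (x s + y s)%C) t (v + w)%C.
Proof. apply (is_derive_plus (V := C_R_NormedModule)). Qed.

Lemma is_derive_subC (x y : R -> C) (t : R) (v w : C) :
  is_derive x t v -> is_derive y t w -> is_derive (fun s => (x s - y s)%C) t (v - w)%C.
Proof. apply (is_derive_minus (V := C_R_NormedModule)). Qed.

Lemma is_derive_eqC (x : R -> C) (t : R) (v w : C) : is_derive x t v -> v = w -> is_derive x t w.
Proof. intros; subst; assumption. Qed.

Lemma is_derive_extC (x y : R -> C) (t : R) (v : C) :
  (forall s, x s = y s) -> is_derive x t v -> is_derive y t v.
Proof. apply (is_derive_ext (V := C_R_NormedModule)). Qed.

Lemma is_derive_powC (x : R -> C) (n : nat) (t : R) (v : C) :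
  is_derive x t v -> is_derive (fun s => (x s ^ n)%C) t (INR n * x t ^ (pred n) * v)%C.
Proof.
intros Hx. induction n as [|n IH].
- simpl. eapply is_derive_eqC; [apply is_derive_constC|]. ring.
- eapply is_derive_eqC; [apply (is_derive_mulC x (fun s => (x s ^ n)%C) t v _ Hx IH)|].
  rewrite S_INR, RtoC_plus. simpl. destruct n; simpl; ring.
Qed.

Lemma is_derive_invC (x : R -> C) (t : R) (v : C) :
  is_derive x t v -> x t <> 0 -> is_derive (fun s => (/ x s)%C) t (- v / (x t * x t))%C.
Proof.
rewrite !is_derive_C_pair. intros [H1 H2] Hn.
assert (Hp : 0 < fst (x t) * fst (x t) + snd (x t) * snd (x t)).
{ apply Cmod_gt_0 in Hn. assert (H := Cmod_sqr (x t)). nra. }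
(* The squared modulus of [x t * x t], which is the denominator that [field] meets. *)
assert (Hq : 0 < (fst (x t) * fst (x t) - snd (x t) * snd (x t)) * (fst (x t) * fst (x t) - snd (x t) * snd (x t))
      + (fst (x t) * snd (x t) + snd (x t) * fst (x t)) * (fst (x t) * snd (x t) + snd (x t) * fst (x t))).
{ replace (_ + _) with ((fst (x t) * fst (x t) + snd (x t) * snd (x t)) * (fst (x t) * fst (x t) + snd (x t) * snd (x t))) by ring. nra. }
assert (Hs : is_derive (fun s => fst (x s) ^ 2 + snd (x s) ^ 2) t (2 * fst v * fst (x t) + 2 * snd v * snd (x t))).
{ evar_last. apply (is_derive_plus (V := R_NormedModule)); apply is_derive_pow; eassumption.
  unfold plus; simpl; ring. }
split.
- apply (is_derive_ext (fun s => fst (x s) / (fst (x s) ^ 2 + snd (x s) ^ 2))); [reflexivity|].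
  evar_last. apply is_derive_div; [exact H1|exact Hs|nra].
  simpl. field. repeat split; nra.
- apply (is_derive_ext (fun s => - snd (x s) / (fst (x s) ^ 2 + snd (x s) ^ 2))); [reflexivity|].
  evar_last. apply is_derive_div; [apply (is_derive_opp (V := R_NormedModule) _ _ _ H2)|exact Hs|nra].
  unfold opp; simpl. field. split; nra.
Qed.

Definition dotC (u v : C) : R := fst u * fst v + snd u * snd v.

Lemma dotC_le (u v : C) : Rabs (dotC u v) <= Cmod u * Cmod v.
Proof.
unfold dotC.
apply Rsqr_incr_0; [|apply Rabs_pos|apply Rmult_le_pos; apply Cmod_ge_0].
rewrite <- Rsqr_abs. unfold Rsqr.
replace (Cmod u * Cmod v * (Cmod u * Cmod v)) with (Cmod u ^ 2 * Cmod v ^ 2) by ring.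
rewrite !Cmod_sqr. assert (H := pow2_ge_0 (fst u * snd v - snd u * fst v)). nra.
Qed.

Lemma is_derive_dotC (x y : R -> C) (t : R) (v w : C) :
  is_derive x t v -> is_derive y t w ->
  is_derive (fun s => dotC (x s) (y s)) t (dotC v (y t) + dotC (x t) w).
Proof.
rewrite !is_derive_C_pair. intros [H1 H2] [H3 H4].
evar_last. apply (is_derive_plus (V := R_NormedModule)).
- apply (Derive.is_derive_mult _ _ _ _ _ H1 H3).
- apply (Derive.is_derive_mult _ _ _ _ _ H2 H4).
- unfold dotC, plus; simpl. ring.
Qed.

Lemma dotC_self (u : C) : dotC u u = Cmod u ^ 2.
Proof. rewrite Cmod_sqr. unfold dotC. ring. Qed.

(** The real mean value inequality is applied to the component of [x] along its own increment [u];
    one factor [Cmod u] then cancels. *)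
Lemma mvt_C (x x' : R -> C) (a b M : R) : a <= b ->
  (forall t, a <= t <= b -> is_derive x t (x' t)) ->
  (forall t, a <= t <= b -> Cmod (x' t) <= M) -> Cmod (x b - x a) <= M * (b - a).
Proof.
intros Hab Hd HM. set (u := (x b - x a)%C).
assert (H := mvt_le (fun t => dotC u (x t)) (fun t => dotC 0 (x t) + dotC u (x' t)) a b (Cmod u * M) Hab).
assert (H1 : dotC u (x b) - dotC u (x a) <= Cmod u * M * (b - a)).
{ apply H.
  - intros t Ht. apply (is_derive_dotC (fun _ => u)); [apply is_derive_constC|apply Hd, Ht].
  - intros t Ht. assert (H1 := dotC_le u (x' t)). assert (H2 := Rle_abs (dotC u (x' t))).
    assert (H3 := Rmult_le_compat_l (Cmod u) _ _ (Cmod_ge_0 u) (HM t Ht)).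
    unfold dotC in *. simpl in *. lra. }
replace (dotC u (x b) - dotC u (x a)) with (Cmod u ^ 2) in H1.
2: { rewrite <- dotC_self. unfold u, dotC; simpl. ring. }
destruct (Rle_lt_or_eq_dec 0 (Cmod u) (Cmod_ge_0 u)) as [Hu|Hu]; [nra|].
rewrite <- Hu. destruct (Rle_lt_or_eq_dec a b Hab) as [Hl|Hl].
- assert (0 <= M). { eapply Rle_trans; [apply Cmod_ge_0|apply (HM a); lra]. } nra.
- subst; lra.
Qed.

Lemma is_derive_reflectC (x : R -> C) (t : R) (v : C) :
  is_derive x (- t) v -> is_derive (fun s => x (- s)) t (- v)%C.
Proof.
intros H. eapply is_derive_eqC.
- apply (is_derive_comp (V := C_R_NormedModule) x (fun s => - s)); [exact H|].
  apply (is_derive_opp (V := R_NormedModule) (fun s => s)), (is_derive_id (K := R_AbsRing)).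
- destruct v. unfold scal, opp, one; simpl; unfold prod_scal, scal; simpl. unfold mult; simpl. unfold Copp; simpl; f_equal; ring.
Qed.

Lemma is_derive_shiftC (x : R -> C) (t c : R) (v : C) :
  is_derive x (t + c) v -> is_derive (fun s => x (s + c)) t v.
Proof.
intros H. eapply is_derive_eqC.
- apply (is_derive_comp (V := C_R_NormedModule) x (fun s => s + c)); [exact H|].
  evar_last. apply (is_derive_plus (V := R_NormedModule) (fun s => s) (fun _ => c)).
  apply (is_derive_id (K := R_AbsRing)). apply (is_derive_const (V := R_NormedModule)).
  reflexivity.
- destruct v. unfold scal, plus, zero, one; simpl; unfold prod_scal, scal; simpl. unfold mult; simpl. f_equal; ring.
Qed.

(** The squared distance grows at most at the rate [2 * L] times itself, so its product with exp(-2
    L t) is non-increasing. *)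
Lemma gronwall (x y x' y' : R -> C) (a b L : R) : a <= b -> 0 <= L ->
  (forall t, a <= t <= b -> is_derive x t (x' t) /\ is_derive y t (y' t) /\
     Cmod (x' t - y' t) <= L * Cmod (x t - y t)) ->
  Cmod (x b - y b) <= Cmod (x a - y a) * exp (L * (b - a)).
Proof.
intros Hab HL H.
set (e := fun t => dotC (x t - y t) (x t - y t)).
assert (Hm := mvt_le (fun t => e t * exp (- (2 * L * t)))
  (fun t => 2 * dotC (x t - y t) (x' t - y' t) * exp (- (2 * L * t)) + e t * (- (2 * L) * exp (- (2 * L * t)))) a b 0 Hab).
assert (H1 : e b * exp (- (2 * L * b)) <= e a * exp (- (2 * L * a))).
{ enough (e b * exp (- (2 * L * b)) - e a * exp (- (2 * L * a)) <= 0 * (b - a)) by lra. apply Hm.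
  - intros t Ht. destruct (H t Ht) as (Hx & Hy & _).
    apply (Derive.is_derive_mult e (fun t => exp (- (2 * L * t))) t (2 * dotC (x t - y t) (x' t - y' t)) (- (2 * L) * exp (- (2 * L * t)))).
    + evar_last. apply is_derive_dotC; apply is_derive_subC; eassumption. unfold dotC; ring.
    + auto_derive; [trivial|]. ring.
  - intros t Ht. destruct (H t Ht) as (_ & _ & Hl).
    assert (Hd := dotC_le (x t - y t) (x' t - y' t)). apply Rabs_le_between in Hd.
    assert (He : e t = Cmod (x t - y t) ^ 2) by apply dotC_self.
    assert (Hp := exp_pos (- (2 * L * t))). rewrite He.
    assert (dotC (x t - y t) (x' t - y' t) <= L * Cmod (x t - y t) ^ 2).
    { assert (Hg := Cmod_ge_0 (x t - y t)). nra. }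
    nra. }
unfold e in H1. rewrite !dotC_self in H1.
apply Rsqr_incr_0; [|apply Cmod_ge_0|apply Rmult_le_pos; [apply Cmod_ge_0|left; apply exp_pos]].
unfold Rsqr.
replace (Cmod (x a - y a) * exp (L * (b - a)) * (Cmod (x a - y a) * exp (L * (b - a))))
  with (Cmod (x a - y a) ^ 2 * exp (- (2 * L * a)) * exp (2 * L * b)).
2: { replace (L * (b - a)) with (- L * a + L * b) by ring.
  replace (- (2 * L * a)) with (- L * a + - L * a) by ring. replace (2 * L * b) with (L * b + L * b) by ring.
  rewrite !exp_plus. ring. }
replace (Cmod (x b - y b) * Cmod (x b - y b)) with (Cmod (x b - y b) ^ 2 * exp (- (2 * L * b)) * exp (2 * L * b)).
2: { rewrite Rmult_assoc, <- exp_plus. replace (- (2 * L * b) + 2 * L * b) with 0 by ring. rewrite exp_0. ring. }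
apply Rmult_le_compat_r; [left; apply exp_pos|exact H1].
Qed.

Lemma mvt_C_abs (x x' : R -> C) (t M : R) :
  (forall s, Rabs s <= Rabs t -> is_derive x s (x' s) /\ Cmod (x' s) <= M) ->
  Cmod (x t - x 0) <= M * Rabs t.
Proof.
intros H. destruct (Rle_dec 0 t) as [Ht|Ht].
- rewrite (Rabs_right t) in * by lra. replace t with (t - 0) at 2 by ring.
  apply (mvt_C x x'); [lra| |]; intros s Hs; apply H; rewrite Rabs_right; lra.
- rewrite (Rabs_left t) in * by lra. replace (- t) with (0 - t) by ring.
  rewrite Cmod_minus_sym.
  apply (mvt_C x x'); [lra| |]; intros s Hs; apply H; apply Rabs_le; lra.
Qed.

(** The explicit rate replaces uniform convergence in the limit passage of the Picard iteration. *)
Lemma half_pow_bound (u : nat -> R) (K : R) :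
  (forall k, Rabs (u (S k) - u k) <= K * (1/2) ^ k) ->
  exists l, forall k, Rabs (u k - l) <= 2 * K * (1/2) ^ k.
Proof.
intros H.
assert (HK : 0 <= K). { specialize (H 0%nat). simpl in H. assert (H1 := Rabs_pos (u 1%nat - u 0%nat)). lra. }
assert (Hp : forall k, 0 < (1/2) ^ k) by (intros; apply pow_lt; lra).
(* Subtracting the tail still to come makes the bound telescope in [j]. *)
assert (Hj : forall j k, Rabs (u (k + j)%nat - u k) <= 2 * K * (1/2) ^ k - 2 * K * (1/2) ^ (k + j)).
{ induction j as [|j IH]; intros k.
  - rewrite Nat.add_0_r, Rminus_diag, Rabs_R0 by ring. lra.
  - rewrite Nat.add_succ_r. specialize (IH k). specialize (H (k + j)%nat).
    assert (H1 := Rabs_triang (u (S (k + j)) - u (k + j)%nat) (u (k + j)%nat - u k)).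
    replace (u (S (k + j)) - u (k + j)%nat + (u (k + j)%nat - u k)) with (u (S (k + j)) - u k) in H1 by ring.
    simpl. lra. }
assert (Hc : ex_finite_lim_seq u).
{ apply ex_lim_seq_cauchy_corr. intros e.
  destruct (pow_lt_1_zero (1/2)) with (y := e / (4 * (K + 1))) as [N HN].
  { rewrite Rabs_right; lra. }
  { apply Rdiv_lt_0_compat; [apply cond_pos|lra]. }
  exists N. intros n m Hn Hm.
  assert (Hs : forall n, (N <= n)%nat -> Rabs (u n - u N) <= 2 * K * (1/2) ^ N).
  { intros k Hk. specialize (Hj (k - N)%nat N). replace (N + (k - N))%nat with k in Hj by lia.
    assert (H1 := Hp k). nra. }
  specialize (HN N (le_n _)). rewrite Rabs_right in HN by (left; apply Rlt_gt, Hp).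
  apply Rmult_lt_compat_r with (r := 4 * (K + 1)) in HN; [|lra].
  replace (e / (4 * (K + 1)) * (4 * (K + 1))) with (e : R) in HN by (field; lra).
  assert (H1 := Hs n Hn). assert (H2 := Hs m Hm).
  assert (H3 := Rabs_triang (u n - u N) (- (u m - u N))). rewrite Rabs_Ropp in H3.
  replace (u n - u N + - (u m - u N)) with (u n - u m) in H3 by ring. specialize (Hp N). nra. }
destruct Hc as [l Hl]. exists l. intros k.
apply (is_lim_seq_le (fun n => Rabs (u k - u (k + n)%nat)) (fun _ => 2 * K * (1/2) ^ k) (Rabs (u k - l)) (2 * K * (1/2)^k)).
- intros n. rewrite Rabs_minus_sym. specialize (Hj n k). assert (H1 := Hp (k + n)%nat). nra.
- apply (is_lim_seq_abs _ (u k - l)). apply is_lim_seq_minus'; [apply is_lim_seq_const|].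
  apply (is_lim_seq_ext (fun n => u (n + k)%nat)); [intros n; f_equal; lia|].
  apply (is_lim_seq_incr_n u k), Hl.
- apply is_lim_seq_const.
Qed.

Lemma half_pow_bound_C (u : nat -> C) (K : R) :
  (forall k, Cmod (u (S k) - u k) <= K * (1/2) ^ k) ->
  exists l : C, forall k, Cmod (u k - l) <= 4 * K * (1/2) ^ k.
Proof.
intros H.
destruct (half_pow_bound (fun k => fst (u k)) K) as [l1 H1].
{ intros k. eapply Rle_trans; [|apply H]. apply (Cmod_fst (u (S k) - u k)). }
destruct (half_pow_bound (fun k => snd (u k)) K) as [l2 H2].
{ intros k. eapply Rle_trans; [|apply H]. apply (Cmod_snd (u (S k) - u k)). }
exists (l1, l2). intros k. eapply Rle_trans; [apply Cmod_le_sum|].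
specialize (H1 k). specialize (H2 k). simpl. unfold Rminus in *. lra.
Qed.

(** * Picard iteration *)

Definition prim (z0 : C) (f : R -> C) (t : R) : C := (z0 + RInt (V := C_R_CompleteNormedModule) f 0 t)%C.

Lemma prim_0 (z0 : C) (f : R -> C) : prim z0 f 0 = z0.
Proof. unfold prim. rewrite RInt_point. change (z0 + 0 = z0)%C. ring. Qed.

Lemma is_derive_prim (z0 : C) (f : R -> C) (a b : Rbar) (t : R) :
  Rbar_lt a 0 -> Rbar_lt 0 b ->
  (forall s : R, Rbar_lt a s -> Rbar_lt s b -> continuous f s) ->
  Rbar_lt a t -> Rbar_lt t b -> is_derive (prim z0 f) t (f t).
Proof.
intros Ha0 H0b Hc Hat Htb. unfold prim.
eapply is_derive_eqC; [apply is_derive_addC; [apply is_derive_constC|]|].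
2: apply Cplus_0_l.
apply (is_derive_RInt (V := C_R_NormedModule) f _ 0).
2: exact (Hc t Hat Htb).
assert (Hl : locally t (fun s : R => Rbar_lt a s /\ Rbar_lt s b)).
{ apply filter_and; [apply (open_Rbar_gt' t a)|apply (open_Rbar_lt' t b)]; assumption. }
revert Hl. apply filter_imp. intros s [Has Hsb].
apply (RInt_correct (V := C_R_CompleteNormedModule)).
apply (ex_RInt_continuous (V := C_R_CompleteNormedModule)). intros u [Hu1 Hu2]. apply Hc.
- revert Hu1. apply Rmin_case; intros Hu; [exact (Rbar_lt_le_trans a 0 u Ha0 Hu)|exact (Rbar_lt_le_trans a s u Has Hu)].
- revert Hu2. apply Rmax_case; intros Hu; [exact (Rbar_le_lt_trans u 0 b Hu H0b)|exact (Rbar_le_lt_trans u s b Hu Hsb)].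
Qed.

(** [M * tau <= rho] keeps the iterates in the disc where the bounds hold, and [L * tau <= 1/2]
    makes the integral operator halve distances. *)
Lemma picard (F : C -> C) (z0 : C) (rho L M tau : R) :
  0 < rho -> 0 <= L -> 0 < tau -> M * tau <= rho -> L * tau <= 1/2 ->
  (forall z w, Cmod (z - z0) <= rho -> Cmod (w - z0) <= rho -> Cmod (F z - F w) <= L * Cmod (z - w)) ->
  (forall z, Cmod (z - z0) <= rho -> Cmod (F z) <= M) ->
  exists x : R -> C, x 0 = z0 /\ forall t, Rabs t < tau -> Cmod (x t - z0) <= rho /\ is_derive x t (F (x t)).
Proof.
intros Hrho HL Htau HM HLt Hlip Hbd.
assert (HM0 : 0 <= M). { eapply Rle_trans; [apply Cmod_ge_0|apply (Hbd z0)]. rewrite Cmod_sub_diag. lra. }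
set (xs := fix xs (k : nat) : R -> C := match k with O => fun _ => z0 | S k => prim z0 (fun s => F (xs k s)) end).
assert (Hcomp : forall x : R -> C, (forall t, Rabs t < tau -> continuous x t /\ Cmod (x t - z0) <= rho) ->
  forall t, Rabs t < tau -> continuous (fun s => F (x s)) t).
{ intros x Hx t Ht. apply continuous_C. intros e He.
  assert (He' : 0 < e / (L + 1)) by (apply Rdiv_lt_0_compat; lra).
  destruct (proj1 (continuous_C x t) (proj1 (Hx t Ht)) _ He') as [d [Hd Hs]].
  exists (Rmin d (tau - Rabs t)). split; [apply Rmin_pos; lra|]. intros s Hst.
  assert (H1 := Rlt_le_trans _ _ _ Hst (Rmin_l _ _)). assert (H2 := Rlt_le_trans _ _ _ Hst (Rmin_r _ _)).
  assert (Hsa : Rabs s < tau). { assert (H3 := Rabs_triang (s - t) t). replace (s - t + t) with s in H3 by ring. lra. }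
  eapply Rle_lt_trans; [apply Hlip; apply Hx; assumption|].
  specialize (Hs s H1). apply Rmult_lt_compat_l with (r := L + 1) in Hs; [|lra].
  replace ((L + 1) * (e / (L + 1))) with e in Hs by (field; lra).
  assert (H3 := Cmod_ge_0 (x s - x t)). nra. }
assert (Hprim : forall x : R -> C, (forall t, Rabs t < tau -> continuous x t /\ Cmod (x t - z0) <= rho) ->
  forall t, Rabs t < tau -> is_derive (prim z0 (fun s => F (x s))) t (F (x t))).
{ intros x Hx t Ht. apply Rabs_def2 in Ht.
  apply (is_derive_prim z0 (fun s => F (x s)) (- tau) tau); simpl; try lra.
  intros s H1 H2. apply (Hcomp x Hx). apply Rabs_def1; lra. }
assert (Hxs : forall k t, Rabs t < tau -> continuous (xs k) t /\ Cmod (xs k t - z0) <= rho).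
{ induction k as [|k IH]; intros t Ht.
  - simpl. split; [apply continuous_const|]. rewrite Cmod_sub_diag; lra.
  - split; [eapply is_derive_C_continuous, (Hprim (xs k) IH t Ht)|].
    rewrite <- (prim_0 z0 (fun s => F (xs k s))) at 1.
    eapply Rle_trans; [apply (mvt_C_abs (prim z0 (fun s => F (xs k s))) (fun s => F (xs k s)) t M)|].
    + intros s Hs. split; [apply (Hprim (xs k) IH); lra|apply Hbd, IH; lra].
    + assert (H := Rabs_pos t). nra. }
(* Stated for arbitrary curves, because it is applied both to consecutive iterates and to the limit
   together with an iterate. *)
assert (Hstep : forall (x y : R -> C) K,
  (forall t, Rabs t < tau -> continuous x t /\ Cmod (x t - z0) <= rho) ->
  (forall t, Rabs t < tau -> continuous y t /\ Cmod (y t - z0) <= rho) ->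
  (forall t, Rabs t < tau -> Cmod (x t - y t) <= K) -> forall t, Rabs t < tau ->
  Cmod (prim z0 (fun s => F (x s)) t - prim z0 (fun s => F (y s)) t) <= K * (1/2)).
{ intros x y K Hx Hy HK t Ht.
  assert (H := mvt_C_abs (fun t => prim z0 (fun s => F (x s)) t - prim z0 (fun s => F (y s)) t)%C
    (fun t => F (x t) - F (y t))%C t (L * K)).
  cbv beta in H. rewrite !prim_0 in H.
  replace (prim z0 (fun s => F (x s)) t - prim z0 (fun s => F (y s)) t - (z0 - z0))%C with
    (prim z0 (fun s => F (x s)) t - prim z0 (fun s => F (y s)) t)%C in H by ring.
  assert (0 <= K). { eapply Rle_trans; [apply Cmod_ge_0|apply (HK t Ht)]. }
  eapply Rle_trans; [apply H|].
  - intros s Hs. split.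
    + apply is_derive_subC; apply Hprim; auto; lra.
    + eapply Rle_trans; [apply Hlip; [apply Hx|apply Hy]; lra|].
      apply Rmult_le_compat_l; [lra|apply HK; lra].
  - assert (H1 := Rabs_pos t). assert (L * Rabs t <= 1/2) by nra. nra. }
assert (Hdiff : forall k t, Rabs t < tau -> Cmod (xs (S k) t - xs k t) <= rho * (1/2) ^ k).
{ induction k as [|k IH]; intros t Ht.
  - simpl (xs 0%nat t). rewrite Rmult_1_r. apply (Hxs 1%nat t Ht).
  - simpl pow. replace (rho * (1/2 * (1/2)^k)) with (rho * (1/2)^k * (1/2)) by ring.
    apply (Hstep (xs (S k)) (xs k)); auto. }
set (x := fun t => epsilon (inhabits (RtoC 0)) (fun l : C => forall k, Cmod (xs k t - l) <= 4 * rho * (1/2) ^ k)).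
assert (Hx : forall t, Rabs t < tau -> forall k, Cmod (xs k t - x t) <= 4 * rho * (1/2) ^ k).
{ intros t Ht. unfold x. apply epsilon_spec. apply (half_pow_bound_C (fun k => xs k t)). intros; auto. }
assert (Hsmall : forall e, 0 < e -> exists k, 4 * rho * (1/2) ^ k < e).
{ intros e He. destruct (pow_lt_1_zero (1/2)) with (y := e / (4 * rho)) as [N HN].
  { rewrite Rabs_right; lra. } { apply Rdiv_lt_0_compat; lra. }
  exists N. specialize (HN N (le_n _)). rewrite Rabs_right in HN by (apply Rle_ge, pow_le; lra).
  apply Rmult_lt_compat_l with (r := 4 * rho) in HN; [|lra].
  replace (4 * rho * (e / (4 * rho))) with e in HN by (field; lra). exact HN. }
assert (Hxc : forall t, Rabs t < tau -> continuous x t /\ Cmod (x t - z0) <= rho).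
{ intros t Ht. split.
  - apply continuous_C. intros e He. destruct (Hsmall (e / 3)) as [k Hk]; [lra|].
    destruct (proj1 (continuous_C (xs k) t) (proj1 (Hxs k t Ht)) (e/3)) as [d [Hd Hs]]; [lra|].
    exists (Rmin d (tau - Rabs t)). split; [apply Rmin_pos; lra|]. intros s Hst.
    assert (H1 := Rlt_le_trans _ _ _ Hst (Rmin_l _ _)). assert (H2 := Rlt_le_trans _ _ _ Hst (Rmin_r _ _)).
    assert (Hsa : Rabs s < tau). { assert (H3 := Rabs_triang (s - t) t). replace (s - t + t) with s in H3 by ring. lra. }
    assert (H3 := Hx t Ht k). assert (H4 := Hx s Hsa k). specialize (Hs s H1).
    assert (H5 := Cmod_minus_triangle (x s) (xs k s) (x t)). assert (H6 := Cmod_minus_triangle (xs k s) (xs k t) (x t)).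
    rewrite (Cmod_minus_sym (x s) (xs k s)) in H5. lra.
  - apply Rnot_lt_le. intros Hlt. destruct (Hsmall (Cmod (x t - z0) - rho)) as [k Hk]; [lra|].
    assert (H1 := Hx t Ht k). assert (H2 := proj2 (Hxs k t Ht)).
    assert (H5 := Cmod_minus_triangle (x t) (xs k t) z0). rewrite (Cmod_minus_sym (x t) (xs k t)) in H5. lra. }
set (X := prim z0 (fun s => F (x s))).
(* The limit is a fixed point: [X t] and [x t] are both within every positive distance of a late
   iterate. *)
assert (HX : forall t, Rabs t < tau -> X t = x t).
{ intros t Ht. apply NNPP. intros Hne. apply Cmod_sub_pos in Hne.
  destruct (Hsmall (Cmod (X t - x t) / 2)) as [k Hk]; [lra|].
  assert (H1 := Hstep x (xs k) (4 * rho * (1/2)^k) Hxc (Hxs k)).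
  assert (H2 : Cmod (X t - xs (S k) t) <= 4 * rho * (1/2) ^ k * (1/2)).
  { apply H1; auto. intros s Hs. rewrite Cmod_minus_sym. auto. }
  assert (H3 := Hx t Ht (S k)). simpl pow in H3.
  assert (H5 := Cmod_minus_triangle (X t) (xs (S k) t) (x t)).
  set (p := (1/2) ^ k) in *. replace (4 * rho * (1/2 * p)) with (4 * rho * p * (1/2)) in H3 by ring. lra. }
(* The primitive is returned instead of [x], whose values were chosen point by point and are
   arbitrary outside the time interval. *)
exists X. split; [apply prim_0|]. intros t Ht. rewrite (HX t Ht). split; [apply Hxc, Ht|].
apply Hprim; auto.
Qed.

(** * Maximal solutions of a locally Lipschitz equation *)

(** The clause [O u] also makes [O] open. *)
Definition loc_lip (O : C -> Prop) (F : C -> C) : Prop :=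
  forall z, O z -> exists rho L, 0 < rho /\ 0 <= L /\
    forall u v, Cmod (u - z) <= rho -> Cmod (v - z) <= rho -> O u /\ Cmod (F u - F v) <= L * Cmod (u - v).

Definition solves_at (O : C -> Prop) (F : C -> C) (x : R -> C) (t : R) : Prop :=
  O (x t) /\ is_derive x t (F (x t)).

Definition vopp (F : C -> C) (z : C) : C := (- F z)%C.

Lemma loc_lip_opp O F : loc_lip O F -> loc_lip O (vopp F).
Proof.
intros H z Hz. destruct (H z Hz) as (rho & L & Hr & HL & Hb). exists rho, L. repeat split; auto.
- apply (Hb u v); auto.
- unfold vopp. replace (- F u - - F v)%C with (- (F u - F v))%C by ring. rewrite Cmod_opp. apply Hb; auto.
Qed.

Lemma solves_at_continuous O F x t : solves_at O F x t -> continuous x t.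
Proof. intros [_ H]. exact (is_derive_C_continuous x t _ H). Qed.

Lemma solves_at_reflect O F x t : solves_at O F x (- t) -> solves_at O (vopp F) (fun s => x (- s)) t.
Proof. intros [H1 H2]. split; [exact H1|]. apply is_derive_reflectC, H2. Qed.

Lemma solves_at_shift O F x c t : solves_at O F x (t + c) -> solves_at O F (fun s => x (s + c)) t.
Proof. intros [H1 H2]. split; [exact H1|]. apply is_derive_shiftC, H2. Qed.

Lemma solves_at_ext_loc O F x y a b t : a < t < b -> (forall s, a < s < b -> x s = y s) ->
  solves_at O F x t -> solves_at O F y t.
Proof.
intros Ht Hxy [H1 H2]. unfold solves_at. rewrite <- (Hxy t Ht). split; [exact H1|].
apply (@is_derive_ext_loc R_AbsRing C_R_NormedModule x); [|exact H2].
apply locally_Rabs. exists (Rmin (t - a) (b - t)). split; [apply Rmin_pos; lra|].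
intros s Hs. apply Hxy.
assert (H3 := Rlt_le_trans _ _ _ Hs (Rmin_l _ _)). assert (H4 := Rlt_le_trans _ _ _ Hs (Rmin_r _ _)).
apply Rabs_def2 in H3. apply Rabs_def2 in H4. lra.
Qed.

Section ODE.
Context (O : C -> Prop) (F : C -> C) (HF : loc_lip O F).

Lemma local_flow_lip (z0 : C) : O z0 -> exists rho tau L, 0 < rho /\ 0 < tau /\ 0 <= L /\
  (forall u v, Cmod (u - z0) <= rho -> Cmod (v - z0) <= rho -> O u /\ Cmod (F u - F v) <= L * Cmod (u - v)) /\
  forall y0, Cmod (y0 - z0) <= rho / 2 -> exists x, x 0 = y0 /\
    forall t, Rabs t < tau -> solves_at O F x t /\ Cmod (x t - z0) <= rho.
Proof.
intros Hz. destruct (HF z0 Hz) as (rho & L & Hr & HL & Hb).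
set (M := Cmod (F z0) + L * rho).
assert (HM : 0 <= M). { unfold M. pose proof (Cmod_ge_0 (F z0)). nra. }
(* Speeds in the ball of radius [rho] are at most [M]. The first bound keeps orbits from the half
   ball inside the ball, the second is the contraction condition. Neither depends on [y0], which is
   what continuous dependence requires. *)
set (tau := Rmin (rho / 2 / (M + 1)) (1 / 2 / (L + 1))).
assert (Htau : 0 < tau). { apply Rmin_pos; apply Rdiv_lt_0_compat; lra. }
exists rho, tau, L. split; [exact Hr|]. split; [exact Htau|]. split; [exact HL|]. split; [exact Hb|]. intros y0 Hy0.
assert (Hin : forall z, Cmod (z - y0) <= rho / 2 -> Cmod (z - z0) <= rho).
{ intros z H1. assert (H := Cmod_minus_triangle z y0 z0). lra. }
destruct (picard F y0 (rho / 2) L M tau) as (x & Hx0 & Hx); try lra.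
- assert (H : tau <= rho / 2 / (M + 1)) by apply Rmin_l.
  apply Rmult_le_compat_r with (r := M + 1) in H; [|lra].
  replace (rho / 2 / (M + 1) * (M + 1)) with (rho / 2) in H by (field; lra). nra.
- assert (H : tau <= 1 / 2 / (L + 1)) by apply Rmin_r.
  apply Rmult_le_compat_r with (r := L + 1) in H; [|lra].
  replace (1 / 2 / (L + 1) * (L + 1)) with (1 / 2) in H by (field; lra). nra.
- intros z w H1 H2. apply Hb; apply Hin; assumption.
- intros z H1. specialize (Hin z H1).
  assert (H2 : Cmod (F z - F z0) <= L * Cmod (z - z0)).
  { apply Hb; [exact Hin|]. rewrite Cmod_sub_diag. lra. }
  assert (H3 := Cmod_rev_triangle (F z) (F z0)). unfold M. nra.
- exists x. split; [exact Hx0|]. intros t Ht. destruct (Hx t Ht) as [H1 H2]. split; [|apply Hin, H1]. split; [|exact H2].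
  apply (Hb (x t) (x t)); apply Hin, H1.
Qed.

Lemma local_flow (z0 : C) : O z0 -> exists x tau, 0 < tau /\ x 0 = z0 /\ forall t, Rabs t < tau -> solves_at O F x t.
Proof.
intros Hz. destruct (local_flow_lip z0 Hz) as (rho & tau & L & Hr & Ht & _ & _ & Hf).
destruct (Hf z0) as (x & Hx0 & Hx). { rewrite Cmod_sub_diag; lra. }
exists x, tau. repeat split; auto; apply Hx; assumption.
Qed.

(** Real induction: agreement before [t] passes to [t] by continuity, and Gronwall with initial
    distance 0 carries it a little beyond [t]. *)
Lemma solves_unique_right (x y : R -> C) (a b : R) :
  (forall t, a <= t <= b -> solves_at O F x t /\ solves_at O F y t) -> x a = y a ->
  forall t, a <= t <= b -> x t = y t.
Proof.
intros Hs Ha. apply real_induction. intros t Ht Hlt.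
assert (Hxc : continuous x t) by exact (solves_at_continuous O F x t (proj1 (Hs t Ht))).
assert (Hyc : continuous y t) by exact (solves_at_continuous O F y t (proj2 (Hs t Ht))).
rewrite continuous_C in Hxc, Hyc.
assert (Het : x t = y t).
{ destruct (Req_dec a t) as [<-|Hne]; [exact Ha|].
  apply NNPP. intros Hn. apply Cmod_sub_pos in Hn. set (e := Cmod (x t - y t)) in *.
  destruct (Hxc (e / 2)) as [d1 [Hd1 H1]]; [lra|]. destruct (Hyc (e / 2)) as [d2 [Hd2 H2]]; [lra|].
  set (s := Rmax a (t - Rmin d1 d2 / 2)).
  assert (H3 := Rmin_l d1 d2). assert (H4 := Rmin_r d1 d2). assert (H5 := Rmin_pos d1 d2 Hd1 Hd2).
  assert (Hsr : a <= s < t /\ t - s <= Rmin d1 d2 / 2). { unfold s. split; [split; [apply Rmax_l|apply Rmax_lub_lt; lra]|]. assert (H6 := Rmax_r a (t - Rmin d1 d2 / 2)). lra. }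
  specialize (H1 s). specialize (H2 s). rewrite Rabs_left in H1, H2 by lra.
  specialize (H1 ltac:(lra)). specialize (H2 ltac:(lra)). rewrite <- (Hlt s) in H2 by lra.
  assert (H6 := Cmod_minus_triangle (x t) (x s) (y t)). rewrite (Cmod_minus_sym (x t) (x s)) in H6. fold e in H6. lra. }
destruct (HF (x t)) as (rho & L & Hr & HL & Hb); [apply Hs, Ht|].
destruct (Hxc rho Hr) as [d1 [Hd1 H1]]. destruct (Hyc rho Hr) as [d2 [Hd2 H2]].
exists (Rmin d1 d2). split; [apply Rmin_pos; assumption|]. intros s Hst Hsb.
assert (H3 := Rmin_l d1 d2). assert (H4 := Rmin_r d1 d2).
apply Cmod_sub_0. apply Rle_antisym; [|apply Cmod_ge_0].
assert (H := gronwall x y (fun s => F (x s)) (fun s => F (y s)) t s L).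
replace (x t - y t)%C with (RtoC 0) in H by (rewrite Het; ring). rewrite Cmod_0, Rmult_0_l in H.
apply H; [lra|exact HL|]. intros u Hu. split; [|split].
- apply Hs; lra.
- apply Hs; lra.
- apply Hb.
  + left; apply H1. rewrite Rabs_right; lra.
  + rewrite Het. left; apply H2. rewrite Rabs_right; lra.
Qed.
End ODE.

Lemma solves_unique O F (HF : loc_lip O F) (x y : R -> C) (a b c : R) : a < c < b ->
  (forall t, a < t < b -> solves_at O F x t /\ solves_at O F y t) -> x c = y c ->
  forall t, a < t < b -> x t = y t.
Proof.
intros Hc Hs He t Ht. destruct (Rle_dec c t) as [Hl|Hl].
- apply (solves_unique_right O F HF x y c t); [intros; apply Hs; lra|exact He|lra].
- assert (H := solves_unique_right O (vopp F) (loc_lip_opp _ _ HF) (fun s => x (- s)) (fun s => y (- s)) (- c) (- t)).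
  cbv beta in H. rewrite Ropp_involutive in H. specialize (fun h => H h He (- t)).
  rewrite Ropp_involutive in H. apply H; [|lra].
  intros s Hst. split; apply solves_at_reflect, Hs; lra.
Qed.

Section Maximal.
Context (O : C -> Prop) (F : C -> C) (HF : loc_lip O F).

Definition candidate (y0 : C) (a b : R) (x : R -> C) : Prop :=
  a < 0 < b /\ x 0 = y0 /\ forall s, a < s < b -> solves_at O F x s.

Definition reachable (y0 : C) (t : R) : Prop := exists a b x, candidate y0 a b x /\ a < t < b.

(** The union of all local solutions through [y0]. They agree where they overlap, so the choice is
    harmless on [reachable y0]; elsewhere the value is arbitrary. *)
Definition flow (y0 : C) (t : R) : C :=
  epsilon (inhabits (RtoC 0)) (fun z => exists a b x, candidate y0 a b x /\ a < t < b /\ x t = z).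

Lemma candidate_unique y0 a b x a' b' x' t : candidate y0 a b x -> candidate y0 a' b' x' ->
  a < t < b -> a' < t < b' -> x t = x' t.
Proof.
intros (H1 & H2 & H3) (H1' & H2' & H3') Ht Ht'.
apply (solves_unique O F HF x x' (Rmax a a') (Rmin b b') 0).
- split; [apply Rmax_lub_lt; lra|apply Rmin_glb_lt; lra].
- intros s [Hs1 Hs2]. 
  assert (H4 := Rmax_l a a'). assert (H5 := Rmax_r a a'). assert (H6 := Rmin_l b b'). assert (H7 := Rmin_r b b').
  split; [apply H3|apply H3']; lra.
- congruence.
- split; [apply Rmax_lub_lt; lra|apply Rmin_glb_lt; lra].
Qed.

Lemma flow_candidate y0 a b x t : candidate y0 a b x -> a < t < b -> flow y0 t = x t.
Proof.
intros Hc Ht. unfold flow.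
assert (H := epsilon_spec (inhabits (RtoC 0)) (fun z => exists a b x, candidate y0 a b x /\ a < t < b /\ x t = z)).
destruct H as (a' & b' & x' & Hc' & Ht' & He).
{ exists (x t), a, b, x. auto. }
rewrite <- He. eapply candidate_unique; eauto.
Qed.

Lemma time_interval_reachable y0 : O y0 -> time_interval (reachable y0).
Proof.
intros Hy. destruct (local_flow O F HF y0 Hy) as (x & tau & Ht & Hx0 & Hx).
assert (Hc : candidate y0 (- tau) tau x). { split; [lra|]. split; [exact Hx0|]. intros s Hs. apply Hx, Rabs_def1; lra. }
destruct (ex_lub_Rbar (reachable y0)) as [hi [Hi1 Hi2]]. destruct (ex_glb_Rbar (reachable y0)) as [lo [Hl1 Hl2]].
assert (Hmid : forall t, reachable y0 t -> exists t1 t2, t1 < t < t2 /\ reachable y0 t1 /\ reachable y0 t2).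
{ intros t (a & b & y & Hy' & Hab). exists ((a + t) / 2), ((t + b) / 2). split; [lra|].
  split; exists a, b, y; (split; [exact Hy'|lra]). }
assert (H0 : reachable y0 0) by (exists (- tau), tau, x; split; [exact Hc|lra]).
assert (Hb : forall t, reachable y0 t -> Rbar_lt lo t /\ Rbar_lt t hi).
{ intros t Hrt. destruct (Hmid t Hrt) as (t1 & t2 & Ht12 & Hr1 & Hr2). split.
  - apply Rbar_le_lt_trans with t1; [apply Hl1, Hr1|apply Ht12].
  - apply Rbar_lt_le_trans with t2; [apply Ht12|apply Hi1, Hr2]. }
exists lo, hi. split; [apply Hb, H0|]. split; [apply Hb, H0|].
intros t. split; [apply Hb|]. intros [H1 H2].
destruct (Rle_dec 0 t) as [Hpos|Hneg].
- assert (exists u, reachable y0 u /\ t < u) as (u & (a & b & y & Hy' & Hab) & Htu).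
  { apply NNPP. intros Hn. apply (Rbar_lt_not_le _ _ H2). apply Hi2. intros u Hu. simpl.
    apply Rnot_lt_le. intros Hlt. apply Hn. exists u; auto. }
  exists a, b, y. split; [exact Hy'|]. destruct Hy' as [Hy' _]. lra.
- assert (exists u, reachable y0 u /\ u < t) as (u & (a & b & y & Hy' & Hab) & Htu).
  { apply NNPP. intros Hn. apply (Rbar_lt_not_le _ _ H1). apply Hl2. intros u Hu. simpl.
    apply Rnot_lt_le. intros Hlt. apply Hn. exists u; auto. }
  exists a, b, y. split; [exact Hy'|]. destruct Hy' as [Hy' _]. lra.
Qed.

Lemma time_interval_segment I t : time_interval I -> I t -> exists a b, a < 0 < b /\ a < t < b /\ forall s, a < s < b -> I s.
Proof.
intros (lo & hi & Hlo & Hhi & HI) Ht. apply HI in Ht. destruct Ht as [H1 H2].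
assert (exists a : R, Rbar_le lo a /\ a < 0 /\ a < t) as (a & Ha & Ha0 & Hat).
{ destruct lo as [l| |]; simpl in *; [exists l; simpl; lra|tauto|exists (Rmin 0 t - 1)].
  assert (H3 := Rmin_l 0 t). assert (H4 := Rmin_r 0 t). simpl; lra. }
assert (exists b : R, Rbar_le b hi /\ 0 < b /\ t < b) as (b & Hb & Hb0 & Htb).
{ destruct hi as [l| |]; simpl in *; [exists l; simpl; lra|exists (Rmax 0 t + 1)|tauto].
  assert (H3 := Rmax_l 0 t). assert (H4 := Rmax_r 0 t). simpl; lra. }
exists a, b. split; [lra|]. split; [lra|]. intros s Hs. apply HI. split.
- apply Rbar_le_lt_trans with a; [exact Ha|apply Hs].
- apply Rbar_lt_le_trans with b; [apply Hs|exact Hb].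
Qed.

Lemma solution_candidate I x t : time_interval I -> is_solution O F I x -> I t -> exists a b, candidate (x 0) a b x /\ a < t < b /\ forall s, a < s < b -> I s.
Proof.
intros HI Hx Ht. destruct (time_interval_segment I t HI Ht) as (a & b & Hab & Habt & Hs).
exists a, b. split; [|split; [exact Habt|exact Hs]]. split; [exact Hab|]. split; [reflexivity|]. intros s Hst. apply Hx, Hs, Hst.
Qed.

Lemma flow_max (y0 : C) : O y0 -> max_solution O F (reachable y0) (flow y0) /\ flow y0 0 = y0.
Proof.
intros Hy. assert (HI := time_interval_reachable y0 Hy).
assert (H0 : flow y0 0 = y0).
{ assert (reachable y0 0) as (a & b & x & Hc & Hab).
  { destruct HI as (lo & hi & H1 & H2 & H3). apply H3. auto. }
  rewrite (flow_candidate y0 a b x 0 Hc Hab). apply Hc. }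
split; [|exact H0]. split; [exact HI|]. split.
- intros t (a & b & x & Hc & Hab).
  apply (solves_at_ext_loc O F x (flow y0) a b t Hab); [|apply Hc, Hab].
  intros s Hs. symmetry. eapply flow_candidate; eauto.
- intros J y HJ Hsol _ Hext t Ht.
  destruct (solution_candidate J y t HJ Hsol Ht) as (a & b & Hc & Hab & _).
  exists a, b, y. split; [|exact Hab].
  rewrite Hext, H0 in Hc; [exact Hc|]. destruct HI as (lo & hi & H1 & H2 & H3). apply H3. auto.
Qed.

Lemma max_exists (y0 : C) : O y0 -> exists I x, max_solution O F I x /\ x 0 = y0.
Proof. intros H. exists (reachable y0), (flow y0). apply flow_max, H. Qed.

Lemma max_solution_0 I x : max_solution O F I x -> I 0.
Proof. intros ((lo & hi & H1 & H2 & H3) & _). apply H3; auto. Qed.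

Lemma max_solution_flow I x : max_solution O F I x -> forall t, (I t <-> reachable (x 0) t) /\ (I t -> x t = flow (x 0) t).
Proof.
intros (HI & Hsol & Hmax).
assert (HI0 : I 0) by (destruct HI as (lo & hi & H1 & H2 & H3); apply H3; auto).
assert (Hy : O (x 0)) by (apply Hsol, HI0).
destruct (flow_max (x 0) Hy) as [(HR & HfS & _) _].
assert (H1 : forall t, I t -> reachable (x 0) t /\ flow (x 0) t = x t).
{ intros t Ht. destruct (solution_candidate I x t HI Hsol Ht) as (a & b & Hc & Hab & _).
  split; [exists a, b, x; auto|eapply flow_candidate; eauto]. }
intros t. split; [split|].
- intros Ht; apply H1, Ht.
- apply (Hmax (reachable (x 0)) (flow (x 0))); auto; intros s Hs; apply H1, Hs.
- intros Ht. symmetry; apply H1, Ht.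
Qed.

Lemma max_unique I x J y : max_solution O F I x -> max_solution O F J y -> x 0 = y 0 ->
  forall t, (I t <-> J t) /\ (I t -> x t = y t).
Proof.
intros Hx Hy H0 t. destruct (max_solution_flow I x Hx t) as [H1 H2]. destruct (max_solution_flow J y Hy t) as [H3 H4].
rewrite H0 in *. split; [tauto|]. intros Ht. rewrite H2, H4; tauto.
Qed.

Lemma max_contains I x a b y : max_solution O F I x -> candidate (x 0) a b y ->
  forall t, a < t < b -> I t /\ x t = y t.
Proof.
intros Hx Hc t Ht. destruct (max_solution_flow I x Hx t) as [H1 H2].
assert (HI : I t) by (apply H1; exists a, b, y; auto). split; [exact HI|].
rewrite H2 by exact HI. eapply flow_candidate; eauto.
Qed.

Lemma max_shift I x c : max_solution O F I x -> I c ->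
  max_solution O F (fun t => I (t + c)) (fun t => x (t + c)).
Proof.
intros (HI & Hsol & Hmax) Hc.
assert (Hsh : forall J c, time_interval J -> J c -> time_interval (fun t => J (t + c))).
{ intros J e (lo & hi & H1 & H2 & H3) He. apply H3 in He.
  exists (Rbar_plus lo (- e)), (Rbar_plus hi (- e)).
  split; [|split].
  - destruct lo; simpl in *; try tauto; lra.
  - destruct hi; simpl in *; try tauto; lra.
  - intros t. rewrite H3. destruct lo, hi; simpl; split; try tauto; lra. }
split; [apply Hsh; assumption|]. split.
- intros t Ht. apply (solves_at_shift O F x c t). apply Hsol, Ht.
- intros J y HJ Hy HIJ Hext t Ht.
  assert (HI0 : I 0) by (destruct HI as (lo & hi & H1 & H2 & H3); apply H3; auto).
  apply (Hmax (fun s => J (s + - c)) (fun s => y (s + - c))).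
  + apply Hsh; [exact HJ|]. apply HIJ. replace (- c + c) with 0 by ring. exact HI0.
  + intros s Hs. apply (solves_at_shift O F y (- c) s). apply Hy, Hs.
  + intros s Hs. apply HIJ. replace (s + - c + c) with s by ring. exact Hs.
  + intros s Hs. rewrite Hext by (replace (s + - c + c) with s by ring; exact Hs). f_equal; ring.
  + replace (t + c + - c) with t by ring. exact Ht.
Qed.

(** With one existence time [tau] for all points visited, the solution can be prolonged by [tau / 2]
    again and again. *)
Lemma max_escape I x tau : 0 < tau -> max_solution O F I x ->
  (forall t, I t -> 0 <= t -> exists y, y 0 = x t /\ forall s, Rabs s < tau -> solves_at O F y s) ->
  forall t, 0 <= t -> I t.
Proof.
intros Htau Hx Hloc.
assert (HI0 := max_solution_0 I x Hx).
assert (Hstep : forall t, I t -> 0 <= t -> I (t + tau / 2)).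
{ intros t Ht Ht0. destruct (Hloc t Ht Ht0) as (y & Hy0 & Hy).
  assert (Hs := max_shift I x t Hx Ht).
  destruct (max_contains _ _ (- tau) tau y Hs) with (t := tau / 2) as [H1 _].
  - split; [lra|]. split; [rewrite Rplus_0_l; exact Hy0|]. intros s Hst. apply Hy, Rabs_def1; lra.
  - lra.
  - rewrite Rplus_comm. exact H1. }
assert (Hn : forall n : nat, I (INR n * (tau / 2))).
{ induction n as [|n IH]; [rewrite Rmult_0_l; exact HI0|].
  rewrite S_INR. replace ((INR n + 1) * (tau / 2)) with (INR n * (tau / 2) + tau / 2) by ring.
  apply Hstep; [exact IH|]. apply Rmult_le_pos; [apply pos_INR|lra]. }
intros t Ht.
destruct (INR_unbounded (t / (tau / 2))) as [n Hnt].
assert (Htn : t < INR n * (tau / 2)).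
{ apply Rmult_lt_reg_r with (/ (tau / 2)); [apply Rinv_0_lt_compat; lra|].
  rewrite Rmult_assoc, Rinv_r by lra. unfold Rdiv at 1 in Hnt. lra. }
specialize (Hn n). destruct Hx as ((lo & hi & H1 & H2 & H3) & _). apply H3. apply H3 in Hn. split.
- apply Rbar_lt_le_trans with 0; [exact H1|exact Ht].
- apply Rbar_lt_trans with (INR n * (tau / 2)); [exact Htn|apply Hn].
Qed.

(** Real induction on the time up to which closeness can be enforced. Near [t] the estimate is
    restarted at a slightly earlier time [s]; the local flow from [y s] shows that [y] still exists,
    and Gronwall controls the distance over a time below [tau]. *)
Lemma continuous_dependence I x T : max_solution O F I x -> 0 <= T -> I T -> forall eta, 0 < eta ->
  exists delta, 0 < delta /\ forall J y, max_solution O F J y -> Cmod (y 0 - x 0) < delta ->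
    forall t, 0 <= t <= T -> J t /\ Cmod (y t - x t) < eta.
Proof.
intros Hx HT HIT.
assert (HI : forall t, 0 <= t <= T -> I t).
{ destruct Hx as ((lo & hi & H1 & H2 & H3) & _). intros t Ht. apply H3. apply H3 in HIT. split.
  - apply Rbar_lt_le_trans with 0; [exact H1|apply Ht].
  - apply Rbar_le_lt_trans with T; [apply Ht|apply HIT]. }
set (P := fun u => forall eta, 0 < eta -> exists delta, 0 < delta /\ forall J y, max_solution O F J y -> Cmod (y 0 - x 0) < delta ->
    forall t, 0 <= t <= u -> J t /\ Cmod (y t - x t) < eta).
enough (HP : forall t, 0 <= t <= T -> P t) by (apply (HP T); lra).
apply real_induction. intros t Ht HPlt.
assert (Hxt : solves_at O F x t) by (apply Hx, HI, Ht).
destruct (local_flow_lip O F HF (x t)) as (rho & tau & L & Hr & Htau & HL & Hb & Hf); [apply Hxt|].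
destruct (proj1 (continuous_C x t) (solves_at_continuous O F x t Hxt) (rho / 4)) as [d [Hd Hxd]]; [lra|].
set (e := Rmin d tau / 4).
assert (He1 := Rmin_l d tau). assert (He2 := Rmin_r d tau). assert (He := Rmin_pos d tau Hd Htau).
set (s := Rmax 0 (t - e)).
assert (Hs : 0 <= s <= t /\ t - e <= s).
{ unfold s. split; [split; [apply Rmax_l|apply Rmax_lub; unfold e; lra]|apply Rmax_r]. }
assert (HPs : P s).
{ destruct (Rle_lt_or_eq_dec 0 t (proj1 Ht)) as [H0|H0].
  - apply HPlt. split; [lra|]. unfold s. apply Rmax_lub_lt; unfold e; lra.
  - intros eta Heta. exists eta. split; [exact Heta|]. intros J y Hy Hy0 r Hr'.
    replace r with 0 by lra. split; [exact (max_solution_0 J y Hy)|exact Hy0]. }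
exists e. split; [unfold e; lra|]. intros u Hu HuT eta Heta.
(* Gronwall enlarges the distance at most by exp(L tau). The quarter of [rho] keeps [y s] in the
   half ball on which the local flow is defined. *)
set (eta' := Rmin eta rho / 4 * exp (- (L * tau))).
assert (Hm := Rmin_pos eta rho Heta Hr). assert (Hm1 := Rmin_l eta rho). assert (Hm2 := Rmin_r eta rho).
assert (Heta' : 0 < eta') by (apply Rmult_lt_0_compat; [lra|apply exp_pos]).
assert (Hee : eta' * exp (L * tau) = Rmin eta rho / 4).
{ unfold eta'. rewrite Rmult_assoc, <- exp_plus. replace (- (L * tau) + L * tau) with 0 by ring. rewrite exp_0. ring. }
assert (Heta1 : eta' <= Rmin eta rho / 4).
{ rewrite <- Hee. assert (1 <= exp (L * tau)); [|nra]. rewrite <- exp_0.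
  destruct (Rle_lt_or_eq_dec 0 (L * tau)) as [H|H]; [nra|left; apply exp_increasing, H|rewrite <- H; right; reflexivity]. }
destruct (HPs eta' Heta') as [delta [Hdelta HPd]].
exists delta. split; [exact Hdelta|]. intros J y Hy Hy0 r Hrr.
destruct (Rle_dec r s) as [Hrs|Hrs].
{ destruct (HPd J y Hy Hy0 r) as [H1 H2]; [lra|]. split; [exact H1|lra]. }
destruct (HPd J y Hy Hy0 s) as [HJs Hys]; [lra|].
assert (Hxs : forall r, s <= r <= u -> Cmod (x r - x t) < rho / 4).
{ intros r' Hr'. apply Hxd. apply Rabs_def1; unfold e in *; lra. }
destruct (Hf (y s)) as (w & Hw0 & Hw).
{ assert (H1 := Cmod_minus_triangle (y s) (x s) (x t)). assert (H2 := Hxs s). lra. }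
assert (Hyw : forall r, s <= r <= u -> J r /\ Cmod (y r - x t) <= rho).
{ intros r' Hr'.
  destruct (max_contains _ _ (- tau) tau w (max_shift J y s Hy HJs)) with (t := r' - s) as [H1 H2].
  - split; [lra|]. split; [rewrite Rplus_0_l; exact Hw0|]. intros q Hq. apply Hw, Rabs_def1; lra.
  - unfold e in *; lra.
  - replace (r' - s + s) with r' in * by ring. split; [exact H1|]. rewrite H2. apply Hw.
    apply Rabs_def1; unfold e in *; lra. }
split; [apply Hyw; lra|].
assert (Hg := gronwall y x (fun q => F (y q)) (fun q => F (x q)) s r L).
eapply Rle_lt_trans; [apply Hg; [lra|exact HL|]|].
- intros q Hq. split; [|split].
  + apply (proj1 (proj2 Hy) q), Hyw; lra.
  + apply (proj1 (proj2 Hx) q), HI; lra.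
  + apply Hb; [apply Hyw; lra|]. assert (H1 := Hxs q). lra.
- assert (H1 : exp (L * (r - s)) <= exp (L * tau)).
  { destruct (Rle_lt_or_eq_dec (L * (r - s)) (L * tau)) as [H|H].
    - apply Rmult_le_compat_l; [exact HL|unfold e in *; lra].
    - left; apply exp_increasing, H.
    - rewrite H; right; reflexivity. }
  assert (H2 := exp_pos (L * (r - s))). assert (H3 := Cmod_ge_0 (y s - x s)). nra.
Qed.
End Maximal.

Lemma max_reflect O F I x : max_solution O F I x -> max_solution O (vopp F) (fun t => I (- t)) (fun t => x (- t)).
Proof.
intros (HI & Hsol & Hmax).
assert (Hsh : forall J, time_interval J -> time_interval (fun t => J (- t))).
{ intros J (lo & hi & H1 & H2 & H3). exists (Rbar_opp hi), (Rbar_opp lo).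
  split; [|split].
  - destruct hi; simpl in *; try tauto; lra.
  - destruct lo; simpl in *; try tauto; lra.
  - intros t. rewrite H3. destruct lo, hi; simpl; split; try tauto; lra. }
split; [apply Hsh; assumption|]. split.
- intros t Ht. apply (solves_at_reflect O F x t). apply Hsol, Ht.
- intros J y HJ Hy HIJ Hext t Ht.
  apply (Hmax (fun s => J (- s)) (fun s => y (- s))).
  + apply Hsh; exact HJ.
  + intros s Hs. assert (H := solves_at_reflect O (vopp F) y s (Hy (- s) Hs)).
    destruct H as [H1 H2]. split; [exact H1|]. eapply is_derive_eqC; [exact H2|]. unfold vopp. ring.
  + intros s Hs. apply HIJ. rewrite Ropp_involutive. exact Hs.
  + intros s Hs. rewrite Hext; rewrite Ropp_involutive; auto.
  + rewrite Ropp_involutive. exact Ht.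
Qed.

(** * Bounded complementary components of polar regions *)

Definition Pol (a : C) (rho phi : R) : C := (a + RtoC rho * unit_dir phi)%C.

Lemma Cmod_unit_dir phi : Cmod (unit_dir phi) = 1.
Proof.
assert (H := Cmod_sqr (unit_dir phi)). simpl fst in H; simpl snd in H.
assert (H1 := sin2_cos2 phi). unfold Rsqr in H1. assert (H2 := Cmod_ge_0 (unit_dir phi)). nra.
Qed.

Lemma Pol_sub a rho phi : (Pol a rho phi - a = RtoC rho * unit_dir phi)%C.
Proof. unfold Pol. ring. Qed.

Lemma Pol_radius a rho phi : 0 <= rho -> Cmod (Pol a rho phi - a) = rho.
Proof. intros H. rewrite Pol_sub, Cmod_mult, Cmod_unit_dir, Cmod_R, Rabs_right; lra. Qed.

Lemma unit_dir_plus x y : unit_dir (x + y) = (unit_dir x * unit_dir y)%C.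
Proof. unfold unit_dir, Cmult; simpl. rewrite cos_plus, sin_plus. f_equal; ring. Qed.

Lemma unit_dir_period x (k : Z) : unit_dir (x + 2 * PI * IZR k) = unit_dir x.
Proof.
assert (Hn : forall n, unit_dir (2 * PI * INR n) = RtoC 1).
{ induction n as [|n IH].
  - rewrite Rmult_0_r. unfold unit_dir. rewrite cos_0, sin_0. reflexivity.
  - rewrite S_INR, Rmult_plus_distr_l, unit_dir_plus, IH, Rmult_1_r. unfold unit_dir. rewrite cos_2PI, sin_2PI.
    change (1 * 1 = 1)%C. ring. }
rewrite unit_dir_plus. replace (unit_dir (2 * PI * IZR k)) with (RtoC 1); [ring|].
destruct (Z.le_gt_cases 0 k) as [Hk|Hk].
- replace (IZR k) with (INR (Z.to_nat k)) by (rewrite INR_IZR_INZ, Z2Nat.id; auto). auto.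
- assert (H := unit_dir_plus (2 * PI * IZR k) (2 * PI * INR (Z.to_nat (- k)))).
  rewrite Hn in H. rewrite INR_IZR_INZ, Z2Nat.id, opp_IZR in H by lia.
  replace (2 * PI * IZR k + 2 * PI * - IZR k) with 0 in H by ring.
  rewrite Cmult_1_r in H. rewrite <- H. unfold unit_dir. rewrite cos_0, sin_0. reflexivity.
Qed.

Lemma unit_dir_eq x y : unit_dir x = unit_dir y -> exists k : Z, y = x + 2 * PI * IZR k.
Proof.
intros H. injection H as H1 H2.
(* The half angle turns cos(y - x) = 1 into sin((y - x) / 2) = 0, whose solutions are known. *)
assert (Hc : cos (2 * ((y - x) / 2)) = 1).
{ replace (2 * ((y - x) / 2)) with (y - x) by field. rewrite cos_minus, H1, H2.
  assert (H3 := sin2_cos2 y). unfold Rsqr in H3. lra. }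
rewrite cos_2a_sin in Hc.
destruct (sin_eq_0_0 ((y - x) / 2)) as [k Hk]; [nra|].
exists k. lra.
Qed.

Lemma Pol_period a rho phi (k : Z) : Pol a rho (phi + 2 * PI * IZR k) = Pol a rho phi.
Proof. unfold Pol. rewrite unit_dir_period. reflexivity. Qed.

Lemma Pol_inj a rho phi rho' phi' : 0 < rho -> 0 <= rho' -> Pol a rho phi = Pol a rho' phi' ->
  rho' = rho /\ exists k : Z, phi' = phi + 2 * PI * IZR k.
Proof.
intros H1 H2 H.
assert (Hr : rho' = rho) by (rewrite <- (Pol_radius a rho phi), <- (Pol_radius a rho' phi'), H by lra; reflexivity).
subst rho'. split; [reflexivity|]. apply unit_dir_eq.
assert (H3 : (RtoC rho * unit_dir phi = RtoC rho * unit_dir phi')%C) by (rewrite <- !(Pol_sub a), H; reflexivity).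
assert (Hn : RtoC rho <> 0) by (intros He; apply RtoC_inj in He; lra).
replace (unit_dir phi) with (/ rho * (rho * unit_dir phi))%C by (field; exact Hn). rewrite H3. field; exact Hn.
Qed.

Lemma Pol_angle_eq a rho phi phi' : 0 < rho -> Pol a rho phi = Pol a rho phi' ->
  - (2 * PI) < phi' - phi < 2 * PI -> phi = phi'.
Proof.
intros H1 H Hb. destruct (Pol_inj a rho phi rho phi' H1 (Rlt_le _ _ H1) H) as [_ [k Hk]].
assert (Hp := PI_RGT_0).
assert (-1 < IZR k < 1) as [Hk1 Hk2] by (split; nra).
apply lt_IZR in Hk1, Hk2. replace k with 0%Z in Hk by lia. lra.
Qed.

Lemma angle_mod (c x : R) : exists k : Z, c <= x + 2 * PI * IZR k < c + 2 * PI.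
Proof.
assert (Hp := PI_RGT_0).
destruct (archimed ((c - x) / (2 * PI))) as [H1 H2].
set (k := up ((c - x) / (2 * PI))) in *.
assert (He : c - x = (c - x) / (2 * PI) * (2 * PI)) by (field; lra).
set (q := (c - x) / (2 * PI)) in *.
destruct (Req_dec (IZR k - q) 1) as [Hq|Hq].
- exists (k - 1)%Z. rewrite minus_IZR. nra.
- exists k. nra.
Qed.

Lemma Pol_exists (a z : C) (c : R) : exists phi, c <= phi < c + 2 * PI /\ z = Pol a (Cmod (z - a)) phi.
Proof.
assert (Hex : exists phi, z = Pol a (Cmod (z - a)) phi).
{ destruct (Rle_lt_or_eq_dec 0 (Cmod (z - a)) (Cmod_ge_0 _)) as [Hr|Hr].
  - set (w := (z - a)%C) in *. set (r := Cmod w) in *.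
    assert (Hs : r ^ 2 = fst w ^ 2 + snd w ^ 2) by apply Cmod_sqr.
    assert (H1 := Cmod_fst w). fold r in H1. apply Rabs_le_between in H1.
    assert (Hu : -1 <= fst w / r <= 1).
    { split; [apply Rle_div_r|apply Rle_div_l]; lra. }
    assert (Hsq : sqrt (1 - (fst w / r)²) = Rabs (snd w / r)).
    { rewrite <- sqrt_Rsqr_abs. f_equal. unfold Rsqr. field_simplify; [|lra|lra]. f_equal. nra. }
    assert (Hz : forall phi, cos phi = fst w / r -> sin phi = snd w / r -> z = Pol a r phi).
    { intros phi Hc Hsn. replace z with (a + w)%C by (unfold w; ring). unfold Pol. f_equal.
      unfold unit_dir. rewrite Hc, Hsn. apply injective_projections; simpl; field; lra. }
    destruct (Rle_dec 0 (snd w)) as [Hp|Hp].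
    + exists (acos (fst w / r)). apply Hz; [apply cos_acos, Hu|].
      rewrite sin_acos, Hsq by exact Hu. apply Rabs_right. apply Rle_ge, Rdiv_le_0_compat; lra.
    + exists (- acos (fst w / r)). apply Hz; [rewrite cos_neg; apply cos_acos, Hu|].
      rewrite sin_neg, sin_acos, Hsq by exact Hu. rewrite Rabs_left; [ring|].
      unfold Rdiv. apply Rnot_le_lt in Hp. assert (H3 := Rinv_0_lt_compat _ Hr). nra.
  - exists 0. rewrite <- Hr. unfold Pol. rewrite (Cmod_sub_0 z a) by auto. ring. }
destruct Hex as [phi Hphi]. destruct (angle_mod c phi) as [k Hk].
exists (phi + 2 * PI * IZR k). split; [exact Hk|]. rewrite Pol_period. exact Hphi.
Qed.

(** Angles are only determined up to full turns; the representative within [PI] of [phi] is the one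
    that is close, because a large angle would force a long chord. *)
Lemma Pol_near a rho phi eta : 0 < rho -> 0 < eta -> exists d, 0 < d /\ forall z, Cmod (z - Pol a rho phi) < d ->
  exists phi', Rabs (phi' - phi) < eta /\ z = Pol a (Cmod (z - a)) phi'.
Proof.
intros Hr Heta. set (e := Rmin eta 1).
assert (He : 0 < e) by (apply Rmin_pos; lra). assert (He1 : e <= eta) by apply Rmin_l. assert (He2 : e <= 1) by apply Rmin_r.
assert (Hp := PI_RGT_0). assert (Hp3 : 3 < PI) by (assert (H := PI2_3_2); lra).
(* Two unit vectors at an angle of at least [e] have squared distance at least [2 * q]. The choice
   of [d] forces this squared distance below [q]. *)
set (q := 1 - cos e).
assert (Hq : 0 < q). { unfold q. rewrite <- cos_0. assert (cos e < cos 0); [|lra]. apply cos_decreasing_1; lra. }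
set (d := rho * sqrt q / 2).
assert (Hd : 0 < d). { unfold d. apply Rdiv_lt_0_compat; [|lra]. apply Rmult_lt_0_compat; [lra|apply sqrt_lt_R0, Hq]. }
exists d. split; [exact Hd|]. intros z Hz.
destruct (Pol_exists a z (phi - PI)) as (phi' & Hphi' & Hzp).
exists phi'. split; [|exact Hzp].
apply Rnot_le_lt. intros Hge.
set (r' := Cmod (z - a)) in *.
assert (Hrr : Rabs (r' - rho) < d).
{ assert (H1 := Cmod_minus_triangle z (Pol a rho phi) a). assert (H2 := Cmod_minus_triangle (Pol a rho phi) z a).
  rewrite (Cmod_minus_sym (Pol a rho phi) z) in H2. rewrite Pol_radius in H1, H2 by lra. fold r' in H1, H2. apply Rabs_def1; lra. }
assert (Hcos : cos (phi' - phi) <= cos e).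
{ assert (Hpp : Rabs (phi' - phi) <= PI) by (apply Rabs_le; lra).
  replace (cos (phi' - phi)) with (cos (Rabs (phi' - phi))).
  - apply cos_decr_1; lra.
  - unfold Rabs. destruct (Rcase_abs (phi' - phi)); [apply cos_neg|reflexivity]. }
assert (Hu : Cmod (unit_dir phi' - unit_dir phi) ^ 2 = 2 * (1 - cos (phi' - phi))).
{ rewrite Cmod_sqr. simpl fst; simpl snd. rewrite cos_minus.
  assert (H1 := sin2_cos2 phi). assert (H2 := sin2_cos2 phi'). unfold Rsqr in *. nra. }
assert (Hlt : rho * Cmod (unit_dir phi' - unit_dir phi) < 2 * d).
{ rewrite <- (Rabs_right rho) at 1 by lra. rewrite <- Cmod_R, <- Cmod_mult.
  replace (rho * (unit_dir phi' - unit_dir phi))%C with ((z - Pol a rho phi) + RtoC (rho - r') * unit_dir phi')%C.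
  - eapply Rle_lt_trans; [apply Cmod_triangle|]. rewrite Cmod_mult, Cmod_unit_dir, Cmod_R, Rabs_minus_sym. lra.
  - rewrite Hzp at 1. unfold Pol. rewrite RtoC_minus. ring. }
unfold d in Hlt. assert (Hs := sqrt_sqrt q (Rlt_le _ _ Hq)). assert (Hsp := sqrt_pos q).
assert (Hg := Cmod_ge_0 (unit_dir phi' - unit_dir phi)).
assert (Cmod (unit_dir phi' - unit_dir phi) < sqrt q).
{ apply Rmult_lt_reg_l with rho; lra. }
assert (2 * (1 - cos (phi' - phi)) < q) by (rewrite <- Hu; nra).
unfold q in *. lra.
Qed.

Lemma Pol_near_between a (g1 g2 : R -> R) rho phi eta : 0 < rho -> 0 < eta ->
  continuous g1 rho -> continuous g2 rho -> g1 rho < phi < g2 rho ->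
  exists d, 0 < d /\ forall z, Cmod (z - Pol a rho phi) < d ->
  exists rho' phi', 0 < rho' /\ Rabs (rho' - rho) < eta /\ g1 rho' < phi' < g2 rho' /\ z = Pol a rho' phi'.
Proof.
intros Hr Heta Hc1 Hc2 Hb. rewrite continuous_R in Hc1, Hc2.
set (e := Rmin (phi - g1 rho) (g2 rho - phi) / 2).
assert (H1 := Rmin_l (phi - g1 rho) (g2 rho - phi)). assert (H2 := Rmin_r (phi - g1 rho) (g2 rho - phi)).
assert (He : 0 < e). { assert (0 < Rmin (phi - g1 rho) (g2 rho - phi)) by (apply Rmin_pos; lra). unfold e; lra. }
destruct (Hc1 e He) as [d1 [Hd1 Hg1]]. destruct (Hc2 e He) as [d2 [Hd2 Hg2]].
destruct (Pol_near a rho phi e Hr He) as [d3 [Hd3 Hn]].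
exists (Rmin (Rmin d1 d2) (Rmin d3 (Rmin eta rho))).
split; [repeat apply Rmin_pos; assumption|]. intros z Hz.
assert (Hz1 : Cmod (z - Pol a rho phi) < d1) by (eapply Rlt_le_trans; [exact Hz|eapply Rle_trans; [apply Rmin_l|apply Rmin_l]]).
assert (Hz2 : Cmod (z - Pol a rho phi) < d2) by (eapply Rlt_le_trans; [exact Hz|eapply Rle_trans; [apply Rmin_l|apply Rmin_r]]).
assert (Hz3 : Cmod (z - Pol a rho phi) < d3) by (eapply Rlt_le_trans; [exact Hz|eapply Rle_trans; [apply Rmin_r|apply Rmin_l]]).
assert (Hz4 : Cmod (z - Pol a rho phi) < eta) by (eapply Rlt_le_trans; [exact Hz|eapply Rle_trans; [apply Rmin_r|eapply Rle_trans; [apply Rmin_r|apply Rmin_l]]]).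
assert (Hz5 : Cmod (z - Pol a rho phi) < rho) by (eapply Rlt_le_trans; [exact Hz|eapply Rle_trans; [apply Rmin_r|eapply Rle_trans; [apply Rmin_r|apply Rmin_r]]]).
assert (Hrr : Rabs (Cmod (z - a) - rho) <= Cmod (z - Pol a rho phi)).
{ assert (H3 := Cmod_minus_triangle z (Pol a rho phi) a). assert (H4 := Cmod_minus_triangle (Pol a rho phi) z a).
  rewrite (Cmod_minus_sym (Pol a rho phi) z) in H4. rewrite Pol_radius in H3, H4 by lra. apply Rabs_le; lra. }
destruct (Hn z Hz3) as (phi' & Hphi' & Hzp).
exists (Cmod (z - a)), phi'. split; [apply Rabs_le_between in Hrr; lra|]. split; [lra|]. split; [|exact Hzp].
specialize (Hg1 (Cmod (z - a)) ltac:(lra)). specialize (Hg2 (Cmod (z - a)) ltac:(lra)).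
apply Rabs_def2 in Hg1, Hg2, Hphi'. unfold e in *. lra.
Qed.

Lemma continuous_Pol a (f g : R -> R) t : continuous f t -> continuous g t -> continuous (fun s => Pol a (f s) (g s)) t.
Proof.
intros Hf Hg.
assert (Hcos : continuous (fun s => cos (g s)) t).
{ apply (continuous_comp g cos); [exact Hg|]. apply (ex_derive_continuous (V := R_NormedModule)). auto_derive; trivial. }
assert (Hsin : continuous (fun s => sin (g s)) t).
{ apply (continuous_comp g sin); [exact Hg|]. apply (ex_derive_continuous (V := R_NormedModule)). auto_derive; trivial. }
apply (continuous_ext (fun s => (fst a + f s * cos (g s), snd a + f s * sin (g s)) : C)).
{ intros s. unfold Pol, unit_dir, Cplus, Cmult, RtoC; simpl. f_equal; ring. }
apply (continuous_C_pair (fun s => fst a + f s * cos (g s)) (fun s => snd a + f s * sin (g s)));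
 apply (continuous_plus (V := R_NormedModule)); try apply continuous_const; apply (continuous_mult (K := R_AbsRing)); assumption.
Qed.

(** * Interiors of closed curves through paths *)

Lemma path_disc (a : C) (r : R) (c : R -> C) :
  (forall s, 0 <= s <= 1 -> continuous c s) -> Cmod (c 0 - a) < r ->
  (forall s, 0 <= s <= 1 -> Cmod (c s - a) <> r) -> forall s, 0 <= s <= 1 -> Cmod (c s - a) < r.
Proof.
intros Hc H0 Hn s Hs. apply Rnot_le_lt. intros Hge.
destruct (ivt_zero (fun s => Cmod (c s - a) - r) 0 s) as (t & Ht & He); try lra.
- intros t Ht. apply (continuous_minus (V := R_NormedModule)); [apply continuous_Cmod_sub, Hc; lra|apply continuous_const].
- apply (Hn t); lra.
Qed.

(** Following the graph of [th] to ever larger radii gives a path that avoids [S] and leaves every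
    disc. *)
Lemma not_Int_set_escape (S : C -> Prop) (a : C) (rho : R) (th : R -> R) : 0 < rho ->
  (forall x, rho <= x -> continuous th x) ->
  (forall x, rho <= x -> ~ S (Pol a x (th x))) -> ~ Int_set S (Pol a rho (th rho)).
Proof.
intros Hr Hc HS [_ (Rb & HRb & HI)].
(* The radius reached at parameter 1 is [rho + M], which exceeds [Rb] even after the centre [a] is
   moved to the origin. *)
set (M := Rb + Cmod a + 1).
assert (HM : 0 < M) by (unfold M; pose proof (Cmod_ge_0 a); lra).
set (g := fun s => rho + Rmax 0 s * M).
assert (Hg : forall s, continuous g s).
{ intros s. apply (continuous_plus (V := R_NormedModule)); [apply continuous_const|].
  apply (continuous_mult (K := R_AbsRing)); [|apply continuous_const].
  apply continuous_R. intros e He. exists e. split; [exact He|]. intros t Ht. eapply Rle_lt_trans; [|exact Ht].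
  unfold Rmax. destruct (Rle_dec 0 t), (Rle_dec 0 s); unfold Rabs; repeat destruct Rcase_abs; lra. }
assert (Hgr : forall s, rho <= g s). { intros s. unfold g. assert (0 <= Rmax 0 s) by apply Rmax_l. nra. }
specialize (HI (fun s => Pol a (g s) (th (g s)))).
assert (Hle : Cmod (Pol a (g 1) (th (g 1))) <= Rb).
{ apply HI.
  - intros s _. apply continuous_Pol; [apply Hg|]. apply (continuous_comp g th); [apply Hg|apply Hc, Hgr].
  - unfold g. rewrite Rmax_left by lra. rewrite Rmult_0_l, Rplus_0_r. reflexivity.
  - intros s _. apply HS, Hgr. }
assert (H1 := Pol_radius a (g 1) (th (g 1))). specialize (H1 ltac:(specialize (Hgr 1); lra)).
assert (H2 := Cmod_triangle (Pol a (g 1) (th (g 1))) (- a)). rewrite Cmod_opp in H2.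
change (Pol a (g 1) (th (g 1)) + - a)%C with (Pol a (g 1) (th (g 1)) - a)%C in H2.
rewrite H1 in H2. unfold g in H2 at 1. rewrite Rmax_right in H2 by lra. unfold M in H2. lra.
Qed.

Lemma Int_set_ext (S S' : C -> Prop) z : (forall w, S w <-> S' w) -> Int_set S z -> Int_set S' z.
Proof.
intros H [H1 (Rb & HRb & HI)]. split; [rewrite <- H; exact H1|]. exists Rb. split; [exact HRb|].
intros c Hc H0 Hn. apply HI; auto. intros s Hs. rewrite H. auto.
Qed.

Lemma Int_set_circle (S : C -> Prop) (a : C) (r : R) : 0 < r -> (forall w, S w <-> Cmod (w - a) = r) ->
  forall z, Int_set S z <-> Cmod (z - a) < r.
Proof.
intros Hr HS z. split.
- intros HI. apply Rnot_le_lt. intros Hge. destruct Hge as [Hgt|He]; [|destruct HI as [HI _]; rewrite HS in HI; auto].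
  destruct (Pol_exists a z 0) as (phi & _ & Hz). 
  apply (not_Int_set_escape S a (Cmod (z - a)) (fun _ => phi)); [lra|intros; apply continuous_const| |rewrite <- Hz; exact HI].
  intros x Hx. rewrite HS, Pol_radius; lra.
- intros Hlt. split; [rewrite HS; lra|]. exists (r + Cmod a). split; [pose proof (Cmod_ge_0 a); lra|].
  intros c Hc H0 Hn. assert (H := path_disc a r c Hc). rewrite H0 in H. specialize (H Hlt).
  assert (H1 : Cmod (c 1 - a) < r). { apply H; [|lra]. intros s Hs He. apply (Hn s Hs), HS, He. }
  assert (H2 := Cmod_triangle (c 1 - a) a). replace (c 1 - a + a)%C with (c 1) in H2 by ring. lra.
Qed.

Section PolarRegion.
Context (a : C) (r : R) (f1 f2 : R -> R).
Context (Hr : 0 < r).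
Context (Hf1 : forall rho, 0 < rho -> continuous f1 rho) (Hf2 : forall rho, 0 < rho -> continuous f2 rho).
Context (Hlt : forall rho, 0 < rho < r -> f1 rho < f2 rho < f1 rho + 2 * PI).
Context (Hle : forall rho, r <= rho -> f1 rho <= f2 rho < f1 rho + 2 * PI).

(** The graphs may coincide from radius [r] on. This is the case for a homoclinic loop, whose arc
    shrinks to the point of tangency. *)
Definition polar_boundary (z : C) : Prop :=
  z = a \/ (exists rho, 0 < rho < r /\ (z = Pol a rho (f1 rho) \/ z = Pol a rho (f2 rho))) \/
  exists phi, f1 r <= phi <= f2 r /\ z = Pol a r phi.

Definition polar_region (z : C) : Prop := exists rho phi, 0 < rho < r /\ f1 rho < phi < f2 rho /\ z = Pol a rho phi.

Definition polar_outside (z : C) : Prop :=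
  exists rho phi, 0 < rho /\ (r < rho \/ f2 rho < phi < f1 rho + 2 * PI) /\ z = Pol a rho phi.

Lemma polar_closed_repr z : polar_boundary z \/ polar_region z ->
  z = a \/ exists rho phi, 0 < rho <= r /\ f1 rho <= phi <= f2 rho /\ z = Pol a rho phi.
Proof.
intros [[H|[(rho & H1 & [H|H])|(phi & H1 & H)]]|(rho & phi & H1 & H2 & H)].
- left; exact H.
- right. exists rho, (f1 rho). specialize (Hlt rho H1). split; [lra|]. split; [lra|exact H].
- right. exists rho, (f2 rho). specialize (Hlt rho H1). split; [lra|]. split; [lra|exact H].
- right. exists r, phi. split; [lra|]. auto.
- right. exists rho, phi. split; [lra|]. split; [lra|exact H].
Qed.

(** The angle is taken in the turn beginning at [f1]. Over a radius below [r], the region and the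
    gap from [f2] to [f1 + 2 * PI] are then the two open intervals left by the boundary. *)
Lemma polar_outside_spec z : polar_outside z <-> ~ polar_boundary z /\ ~ polar_region z.
Proof.
split.
- intros (rho & phi & H1 & H2 & H).
  enough (~ (polar_boundary z \/ polar_region z)) by tauto. intros Hcl.
  destruct (polar_closed_repr z Hcl) as [Ha|(rho' & phi' & H3 & H4 & H5)].
  + assert (H6 := Pol_radius a rho phi (Rlt_le _ _ H1)). rewrite <- H, Ha in H6.
    rewrite Cmod_sub_diag in H6. lra.
  + assert (H6 := Pol_radius a rho phi (Rlt_le _ _ H1)). assert (H7 := Pol_radius a rho' phi').
    rewrite <- H5, H, H6 in H7. specialize (H7 ltac:(lra)). subst rho'. destruct H2 as [H2|H2]; [lra|].
    assert (phi = phi'); [|lra]. apply (Pol_angle_eq a rho); [exact H1|congruence|lra].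
- intros [H1 H2].
  destruct (Pol_exists a z (f1 (Cmod (z - a)))) as (phi & Hphi & Hz). set (rho := Cmod (z - a)) in *.
  assert (Hrho : 0 < rho). { apply Cmod_sub_pos. intros ->. apply H1. left; reflexivity. }
  exists rho, phi. split; [exact Hrho|]. split; [|exact Hz].
  destruct (Rlt_dec r rho) as [Hrr|Hrr]; [left; exact Hrr|right]. split; [|apply Hphi].
  apply Rnot_le_lt. intros Hphi2.
  destruct (Req_dec rho r) as [Her|Hne].
  + apply H1. right; right. exists phi. rewrite <- Her. split; [lra|exact Hz].
  + destruct (Req_dec phi (f1 rho)) as [He|He1]; [apply H1; right; left; exists rho; split; [lra|left; congruence]|].
    destruct (Req_dec phi (f2 rho)) as [He|He2]; [apply H1; right; left; exists rho; split; [lra|right; congruence]|].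
    apply H2. exists rho, phi. split; [lra|]. split; [lra|exact Hz].
Qed.

(** A point outside escapes: radially if its radius exceeds [r], and otherwise at a constant
    fraction [l] of the gap from [f2] to [f1 + 2 * PI]. The second path passes through all larger
    radii, hence the continuation of [f1] and [f2] beyond [r]. *)
Lemma polar_Int_region z : Int_set polar_boundary z -> polar_region z.
Proof.
intros HI. apply NNPP. intros Hn.
assert (Hout : polar_outside z) by (apply polar_outside_spec; split; [apply HI|exact Hn]).
destruct Hout as (rho & phi & H1 & H2 & Hz).
assert (Hno : forall z, polar_outside z -> ~ polar_boundary z) by (intros w Hw; apply polar_outside_spec, Hw).
destruct H2 as [H2|H2].
- revert HI. rewrite Hz. apply (not_Int_set_escape _ a rho (fun _ => phi)); [exact H1|intros; apply continuous_const|].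
  intros x Hx. apply Hno. exists x, phi. split; [lra|]. split; [left; lra|reflexivity].
- set (l := (phi - f2 rho) / (f1 rho + 2 * PI - f2 rho)).
  set (th := fun x => f2 x + l * (f1 x + 2 * PI - f2 x)).
  assert (Hl : 0 < l < 1). { unfold l. split; [apply Rdiv_lt_0_compat; lra|apply Rlt_div_l; lra]. }
  assert (Hth : phi = th rho) by (unfold th, l; field; lra).
  revert HI. rewrite Hz, Hth. apply (not_Int_set_escape _ a rho th); [exact H1| |].
  + intros x Hx. assert (C1 := Hf1 x ltac:(lra)). assert (C2 := Hf2 x ltac:(lra)).
    apply (continuous_plus (V := R_NormedModule)); [exact C2|].
    apply (continuous_mult (K := R_AbsRing)); [apply continuous_const|].
    apply (continuous_minus (V := R_NormedModule)); [|exact C2].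
    apply (continuous_plus (V := R_NormedModule)); [exact C1|apply continuous_const].
  + intros x Hx. apply Hno. exists x, (th x). split; [lra|]. split; [|reflexivity]. right.
    assert (f2 x < f1 x + 2 * PI). { destruct (Rlt_dec x r); [apply Hlt; lra|apply Hle; lra]. }
    unfold th. nra.
Qed.

Lemma polar_region_open z : polar_region z -> exists d, 0 < d /\ forall w, Cmod (w - z) < d -> polar_region w.
Proof.
intros (rho & phi & H1 & H2 & ->).
destruct (Pol_near_between a f1 f2 rho phi (r - rho)) as [d [Hd Hw]]; [lra|lra|apply Hf1; lra|apply Hf2; lra|exact H2|].
exists d. split; [exact Hd|]. intros w Hwd. destruct (Hw w Hwd) as (rho' & phi' & H3 & H4 & H5 & H6).
exists rho', phi'. apply Rabs_def2 in H4. split; [lra|]. split; [exact H5|exact H6].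
Qed.

Lemma polar_outside_open z : polar_outside z -> exists d, 0 < d /\ forall w, Cmod (w - z) < d -> polar_outside w.
Proof.
intros (rho & phi & H1 & [H2|H2] & ->).
- exists (rho - r). split; [lra|]. intros w Hw.
  destruct (Pol_exists a w 0) as (psi & _ & Hwp). exists (Cmod (w - a)), psi.
  assert (H3 := Cmod_minus_triangle (Pol a rho phi) w a). rewrite (Cmod_minus_sym _ w), Pol_radius in H3 by lra.
  split; [lra|]. split; [left; lra|exact Hwp].
- destruct (Pol_near_between a f2 (fun x => f1 x + 2 * PI) rho phi 1) as [d [Hd Hw]]; [lra|lra|apply Hf2; lra| |exact H2|].
  { apply (continuous_plus (V := R_NormedModule)); [apply Hf1; lra|apply continuous_const]. }
  exists d. split; [exact Hd|]. intros w Hwd. destruct (Hw w Hwd) as (rho' & phi' & H3 & H4 & H5 & H6).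
  exists rho', phi'. split; [exact H3|]. split; [right; exact H5|exact H6].
Qed.

(** Region and outside are open and, together with the boundary, cover the plane. A path avoiding
    the boundary therefore stays in the bounded region, by real induction. *)
Lemma polar_region_Int z : polar_region z -> Int_set polar_boundary z.
Proof.
intros Hz. split.
{ intros Hb. assert (Ho : ~ polar_outside z) by (rewrite polar_outside_spec; tauto).
  destruct (polar_region_open z Hz) as [d [Hd Hw]].
  destruct Hz as (rho & phi & H1 & H2 & Hz).
  destruct Hb as [Hb|[(rho' & H3 & Hb)|(phi' & H3 & Hb)]].
  - assert (H6 := Pol_radius a rho phi ltac:(lra)). rewrite <- Hz, Hb in H6.
    rewrite Cmod_sub_diag in H6. lra.
  - assert (H6 := Pol_radius a rho phi ltac:(lra)).
    assert (rho' = rho).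
    { destruct Hb as [Hb|Hb].
      - assert (H7 := Pol_radius a rho' (f1 rho') ltac:(lra)). rewrite <- Hb, Hz, H6 in H7. auto.
      - assert (H7 := Pol_radius a rho' (f2 rho') ltac:(lra)). rewrite <- Hb, Hz, H6 in H7. auto. }
    subst rho'. specialize (Hlt rho H1).
    destruct Hb as [Hb|Hb].
    + assert (phi = f1 rho); [|lra]. apply (Pol_angle_eq a rho); [lra|congruence|lra].
    + assert (phi = f2 rho); [|lra]. apply (Pol_angle_eq a rho); [lra|congruence|lra].
  - assert (H6 := Pol_radius a rho phi ltac:(lra)). assert (H7 := Pol_radius a r phi' ltac:(lra)).
    rewrite <- Hb, Hz, H6 in H7. lra. }
exists (r + Cmod a). split; [pose proof (Cmod_ge_0 a); lra|].
intros c Hc H0 Hn.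
assert (HR : forall s, 0 <= s <= 1 -> polar_region (c s)).
{ apply real_induction. intros t Ht Hs.
  assert (Hct := Hc t Ht). rewrite continuous_C in Hct.
  assert (HRt : polar_region (c t)).
  { destruct (Req_dec t 0) as [->|Hne]; [rewrite H0; exact Hz|].
    apply NNPP. intros HnR.
    destruct (polar_outside_open (c t)) as [d [Hd Hw]]; [apply polar_outside_spec; split; auto|].
    destruct (Hct d Hd) as [e [He Hce]].
    set (s := Rmax 0 (t - e / 2)).
    assert (Hst : 0 <= s < t /\ t - s < e).
    { unfold s. assert (H1 := Rmax_r 0 (t - e / 2)). split; [split; [apply Rmax_l|apply Rmax_lub_lt; lra]|lra]. }
    assert (Ho : polar_outside (c s)) by (apply Hw, Hce; apply Rabs_def1; lra).
    apply polar_outside_spec in Ho. apply Ho, Hs; lra. }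
  destruct (polar_region_open (c t) HRt) as [d [Hd Hw]].
  destruct (Hct d Hd) as [e [He Hce]]. exists e. split; [exact He|].
  intros s Hs1 Hs2. apply Hw, Hce. apply Rabs_def1; lra. }
destruct (HR 1) as (rho & phi & H1 & H2 & H3); [lra|].
assert (H4 := Pol_radius a rho phi ltac:(lra)). rewrite <- H3 in H4.
assert (H5 := Cmod_triangle (c 1 - a) a). replace (c 1 - a + a)%C with (c 1) in H5 by ring. lra.
Qed.
End PolarRegion.

(** * The vector field near its zero *)

Lemma open_ball_C (O : C -> Prop) (z : C) : open O -> O z -> exists r, 0 < r /\ forall w, Cmod (w - z) < r -> O w.
Proof. intros HO Hz. exact (proj1 (locally_Cmod z O) (HO z Hz)). Qed.

Lemma is_derive_C_cont (f : C -> C) (z l : C) : is_derive (K := C_AbsRing) (V := C_NormedModule) f z l ->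
  forall e, 0 < e -> exists d, 0 < d /\ forall w, Cmod (w - z) < d -> Cmod (f w - f z) <= e.
Proof.
intros H e He. destruct (proj1 (is_derive_C_eps f z l) H 1 Rlt_0_1) as [d [Hd Hw]].
assert (Hg := Cmod_ge_0 l).
assert (He' : 0 < e / (1 + Cmod l)) by (apply Rdiv_lt_0_compat; lra).
exists (Rmin d (e / (1 + Cmod l))). split; [apply Rmin_pos; lra|]. intros w Hwz.
assert (H1 := Rlt_le_trans _ _ _ Hwz (Rmin_l _ _)). assert (H2 := Rlt_le_trans _ _ _ Hwz (Rmin_r _ _)).
specialize (Hw w H1). replace (f w - f z)%C with ((f w - f z - l * (w - z)) + l * (w - z))%C by ring.
eapply Rle_trans; [apply Cmod_triangle|]. rewrite Cmod_mult.
apply Rmult_lt_compat_r with (r := 1 + Cmod l) in H2; [|lra].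
replace (e / (1 + Cmod l) * (1 + Cmod l)) with e in H2 by (field; lra). lra.
Qed.

Lemma is_derive_segment (f : C -> C) (z w l : C) (s : R) :
  is_derive (K := C_AbsRing) (V := C_NormedModule) f (z + RtoC s * w)%C l ->
  is_derive (fun u => f (z + RtoC u * w)%C) s (l * w)%C.
Proof.
intros H. apply (is_derive_compC f (fun u => z + RtoC u * w)%C); [exact H|].
apply is_derive_C_pair. simpl. split.
- auto_derive; [trivial|]. ring.
- auto_derive; [trivial|]. ring.
Qed.

(** The disc is convex, so the mean value inequality applies along the segment from [v] to [u]. *)
Lemma cderiv_bound_lipschitz (f f' : C -> C) (z : C) (r M : R) :
  (forall u, Cmod (u - z) <= r -> is_derive (K := C_AbsRing) (V := C_NormedModule) f u (f' u) /\ Cmod (f' u) <= M) ->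
  forall u v, Cmod (u - z) <= r -> Cmod (v - z) <= r -> Cmod (f u - f v) <= M * Cmod (u - v).
Proof.
intros H u v Hu Hv.
assert (Hin : forall s, 0 <= s <= 1 -> Cmod (v + RtoC s * (u - v) - z) <= r).
{ intros s Hs. replace (v + RtoC s * (u - v) - z)%C with (RtoC s * (u - z) + RtoC (1 - s) * (v - z))%C by (rewrite RtoC_minus; ring).
  eapply Rle_trans; [apply Cmod_triangle|]. rewrite !Cmod_mult, !Cmod_R, !Rabs_right by lra. nra. }
assert (Hm := mvt_C (fun s => f (v + RtoC s * (u - v))%C) (fun s => f' (v + RtoC s * (u - v)) * (u - v))%C 0 1 (M * Cmod (u - v))).
cbv beta in Hm.
replace (v + RtoC 1 * (u - v))%C with u in Hm by ring. replace (v + RtoC 0 * (u - v))%C with v in Hm by ring.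
rewrite Rminus_0_r, Rmult_1_r in Hm. apply Hm; [lra| |].
- intros t Ht. apply is_derive_segment, H, Hin, Ht.
- intros t Ht. rewrite Cmod_mult. apply Rmult_le_compat_r; [apply Cmod_ge_0|apply H, Hin, Ht].
Qed.

Lemma loc_lip_cderivs O F D : open O -> cderivs O F D -> loc_lip O F.
Proof.
intros HO [HD0 HD] z Hz.
destruct (open_ball_C O z HO Hz) as [r [Hr Hball]].
destruct (is_derive_C_cont (D 1%nat) z _ (HD 1%nat z Hz) 1 Rlt_0_1) as [d [Hd Hc]].
set (rho := Rmin r d / 2).
assert (H1 := Rmin_l r d). assert (H2 := Rmin_r r d). assert (H3 := Rmin_pos r d Hr Hd).
exists rho, (Cmod (D 1%nat z) + 1). split; [unfold rho; lra|]. split; [pose proof (Cmod_ge_0 (D 1%nat z)); lra|].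
assert (Hin : forall u, Cmod (u - z) <= rho -> O u) by (intros u Hu; apply Hball; unfold rho in Hu; lra).
intros u v Hu Hv. split; [apply Hin, Hu|].
rewrite <- !HD0 by (apply Hin; assumption).
apply (cderiv_bound_lipschitz (D 0%nat) (D 1%nat) z rho); [|exact Hu|exact Hv].
intros w Hw. split; [apply HD, Hin, Hw|].
assert (H4 := Hc w). assert (H5 := Cmod_rev_triangle (D 1%nat w) (D 1%nat z)). unfold rho in Hw. lra.
Qed.

Lemma is_derive_cderivs O F D z : open O -> cderivs O F D -> O z ->
  is_derive (K := C_AbsRing) (V := C_NormedModule) F z (D 1%nat z).
Proof.
intros HO [HD0 HD] Hz. apply is_derive_C_eps. intros e He.
destruct (open_ball_C O z HO Hz) as [r [Hr Hball]].
destruct (proj1 (is_derive_C_eps _ _ _) (HD 0%nat z Hz) e He) as [d [Hd Hw]].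
exists (Rmin r d). split; [apply Rmin_pos; assumption|]. intros w Hwz.
rewrite <- (HD0 z Hz), <- (HD0 w).
- apply Hw. eapply Rlt_le_trans; [exact Hwz|apply Rmin_r].
- apply Hball. eapply Rlt_le_trans; [exact Hwz|apply Rmin_l].
Qed.

Lemma is_derive_C_eq_unique (f : C -> C) (z l l' : C) :
  is_derive (K := C_AbsRing) (V := C_NormedModule) f z l -> is_derive (K := C_AbsRing) (V := C_NormedModule) f z l' -> l = l'.
Proof. intros H H'. rewrite <- (is_C_derive_unique _ _ _ H). apply is_C_derive_unique, H'. Qed.

(** Once [D k] and [D' k] agree on the open set, the shifted sequence [D' (k + j)] is a sequence of
    derivatives of [D k], so the next terms agree as well. *)
Lemma cderivs_unique O F D D' : open O -> cderivs O F D -> cderivs O F D' -> forall k z, O z -> D k z = D' k z.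
Proof.
intros HO [H0 HD] [H0' HD'] k. induction k as [|k IH]; intros z Hz; [rewrite H0, H0'; auto|].
apply (is_derive_C_eq_unique (D k) z); [apply HD, Hz|].
apply (is_derive_cderivs O (D k) (fun j => D' (k + j)%nat) z HO) in Hz as H.
- rewrite Nat.add_1_r in H. exact H.
- split.
  + intros w Hw. rewrite Nat.add_0_r. symmetry; apply IH, Hw.
  + intros j w Hw. rewrite Nat.add_succ_r. apply HD', Hw.
Qed.

(** The Peano remainder, by induction on [m] with [j] free: the remainder of [D j] has as derivative
    the remainder of [D (S j)], which is integrated along the segment from [a]. No power series is
    involved. *)
Lemma taylor_little_o (O : C -> Prop) (D : nat -> C -> C) (a : C) : open O -> O a ->
  (forall k z, O z -> is_derive (K := C_AbsRing) (V := C_NormedModule) (D k) z (D (S k) z)) ->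
  forall m j, (forall k, (k < m)%nat -> D (j + k)%nat a = 0) ->
  forall e, 0 < e -> exists r, 0 < r /\ forall z, Cmod (z - a) <= r ->
    O z /\ Cmod (D j z - D (j + m)%nat a / INR (fact m) * (z - a) ^ m) <= e * Cmod (z - a) ^ m.
Proof.
intros HO Ha HD. destruct (open_ball_C O a HO Ha) as [r1 [Hr1 Hball]].
induction m as [|m IH]; intros j Hj e He.
- destruct (is_derive_C_cont (D j) a _ (HD j a Ha) e He) as [d [Hd Hc]].
  assert (H3 := Rmin_pos r1 d Hr1 Hd). assert (H1 := Rmin_l r1 d). assert (H2 := Rmin_r r1 d).
  exists (Rmin r1 d / 2). split; [lra|]. intros z Hz. split; [apply Hball; lra|].
  rewrite Nat.add_0_r. simpl. replace (D j z - D j a / 1 * 1)%C with (D j z - D j a)%C by field.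
  rewrite Rmult_1_r. apply Hc; lra.
- destruct (IH (S j)) with (e := e) as [r [Hr Hz]]; [|exact He|].
  { intros k Hk. rewrite Nat.add_succ_l, <- Nat.add_succ_r. apply Hj; lia. }
  assert (Hja : D j a = 0). { rewrite <- (Nat.add_0_r j). apply Hj; lia. }
  exists r. split; [exact Hr|]. intros z Hzr. split; [apply Hz, Hzr|].
  rewrite Nat.add_succ_r. change (S (j + m)) with (S j + m)%nat.
  set (c := (D (S j + m)%nat a / INR (fact m))%C).
  set (w := (z - a)%C).
  assert (Hfm : RtoC (INR (fact m)) <> 0) by (intros H; apply RtoC_inj in H; apply (INR_fact_neq_0 m H)).
  assert (Hsm : RtoC (INR (S m)) <> 0) by (intros H; apply RtoC_inj in H; apply (not_0_INR (S m)); [lia|exact H]).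
  assert (Hcc : (D (S j + m)%nat a / INR (fact (S m)) = c / INR (S m))%C).
  { unfold c. rewrite fact_simpl, mult_INR, RtoC_mult. field. split; assumption. }
  rewrite Hcc.
  assert (Hin : forall s, 0 <= s <= 1 -> Cmod (a + RtoC s * w - a) <= r /\ Cmod (a + RtoC s * w - a) <= Cmod w).
  { intros s Hs. replace (a + RtoC s * w - a)%C with (RtoC s * w)%C by ring.
    rewrite Cmod_mult, Cmod_R, Rabs_right by lra. assert (H1 := Cmod_ge_0 w). fold w in Hzr. split; nra. }
  assert (Hm := mvt_C (fun s => D j (a + RtoC s * w) - c / INR (S m) * (RtoC s * w) ^ S m)%C
     (fun s => (D (S j) (a + RtoC s * w) - c * (RtoC s * w) ^ m) * w)%C 0 1 (e * Cmod w ^ S m)).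
  cbv beta in Hm. rewrite Rminus_0_r, Rmult_1_r in Hm.
  replace (D j (a + RtoC 1 * w) - c / INR (S m) * (RtoC 1 * w) ^ S m - (D j (a + RtoC 0 * w) - c / INR (S m) * (RtoC 0 * w) ^ S m))%C
    with (D j z - c / INR (S m) * w ^ S m)%C in Hm.
  2: { replace (a + RtoC 1 * w)%C with z by (unfold w; ring). replace (a + RtoC 0 * w)%C with a by ring.
       rewrite Hja, Cmult_1_l, Cmult_0_l. simpl (0 ^ S m)%C. ring. }
  apply Hm; [lra| |].
  + intros t Ht.
    assert (Hw : is_derive (fun u => RtoC u * w)%C t w).
    { apply is_derive_C_pair. simpl. split; auto_derive; trivial; ring. }
    eapply is_derive_eqC.
    * apply is_derive_subC; [apply is_derive_segment, HD, Hz, Hin, Ht|].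
      apply is_derive_mulC; [apply is_derive_constC|apply (is_derive_powC _ (S m) t w Hw)].
    * cbv beta. change (pred (S m)) with m. field. exact Hsm.
  + intros t Ht. rewrite Cmod_mult. simpl pow. rewrite (Rmult_comm (Cmod w)), <- Rmult_assoc.
    apply Rmult_le_compat_r; [apply Cmod_ge_0|].
    destruct (Hin t Ht) as [H1 H2]. destruct (Hz _ H1) as [_ H3]. fold c in H3.
    replace (a + RtoC t * w - a)%C with (RtoC t * w)%C in * by ring.
    eapply Rle_trans; [exact H3|]. apply Rmult_le_compat_l; [lra|].
    apply pow_incr. split; [apply Cmod_ge_0|exact H2].
Qed.

(** Here the order of the zero is [S n] and [c0] is its leading Taylor coefficient. The fixed
    tolerance 1/20 governs convexity and signs in the whole disc; the limit statement [lf_lim]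
    determines the exact directions at [a]. All clauses survive the change of [F] and [c0] to their
    negatives with the same radius. *)
Record local_form (O : C -> Prop) (F F' : C -> C) (a : C) (n : nat) (c0 : C) (r0 : R) : Prop := {
  lf_lip : loc_lip O F;
  lf_derive : forall z, O z -> is_derive (K := C_AbsRing) (V := C_NormedModule) F z (F' z);
  lf_n : (1 <= n)%nat;
  lf_c0 : c0 <> 0;
  lf_r0 : 0 < r0;
  lf_ball : forall z, Cmod (z - a) <= r0 -> O z;
  lf_Fa : F a = 0;
  lf_F : forall z, Cmod (z - a) <= r0 -> Cmod (F z - c0 * (z - a) ^ S n) <= 1/20 * Cmod (c0 * (z - a) ^ S n);
  lf_F' : forall z, Cmod (z - a) <= r0 -> Cmod (F' z - INR (S n) * c0 * (z - a) ^ n) <= 1/20 * Cmod (INR (S n) * c0 * (z - a) ^ n);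
  lf_lim : forall e, 0 < e -> exists d, 0 < d /\ forall z, 0 < Cmod (z - a) < d -> Cmod (F z - c0 * (z - a) ^ S n) <= e * Cmod (c0 * (z - a) ^ S n) }.
Arguments lf_lip {O F F' a n c0 r0} _.
Arguments lf_derive {O F F' a n c0 r0} _.
Arguments lf_n {O F F' a n c0 r0} _.
Arguments lf_c0 {O F F' a n c0 r0} _.
Arguments lf_r0 {O F F' a n c0 r0} _.
Arguments lf_ball {O F F' a n c0 r0} _.
Arguments lf_Fa {O F F' a n c0 r0} _.
Arguments lf_F {O F F' a n c0 r0} _.
Arguments lf_F' {O F F' a n c0 r0} _.
Arguments lf_lim {O F F' a n c0 r0} _.

Lemma local_form_opp O F F' a n c0 r0 : local_form O F F' a n c0 r0 -> local_form O (vopp F) (vopp F') a n (- c0) r0.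
Proof.
intros [H1 H2 H3 H4 H5 H6 H7 H8 H9 H10].
assert (Hs : forall z, (vopp F z - - c0 * (z - a) ^ S n)%C = (- (F z - c0 * (z - a) ^ S n))%C) by (intros; unfold vopp; ring).
assert (Hs' : forall z, (vopp F' z - INR (S n) * - c0 * (z - a) ^ n)%C = (- (F' z - INR (S n) * c0 * (z - a) ^ n))%C) by (intros; unfold vopp; ring).
assert (Ht : forall z, (- c0 * (z - a) ^ S n)%C = (- (c0 * (z - a) ^ S n))%C) by (intros; ring).
assert (Ht' : forall z, (INR (S n) * - c0 * (z - a) ^ n)%C = (- (INR (S n) * c0 * (z - a) ^ n))%C) by (intros; ring).
constructor; auto.
- apply loc_lip_opp, H1.
- intros z Hz. apply (is_derive_opp (V := C_NormedModule) F), H2, Hz.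
- intros H. apply H4. replace c0 with (- - c0)%C by ring. rewrite H. ring.
- unfold vopp. rewrite H7. ring.
- intros z Hz. rewrite Hs, Ht, !Cmod_opp. auto.
- intros z Hz. rewrite Hs', Ht', !Cmod_opp. auto.
- intros e He. destruct (H10 e He) as [d [Hd H]]. exists d. split; [exact Hd|].
  intros z Hz. rewrite Hs, Ht, !Cmod_opp. auto.
Qed.
Arguments local_form_opp {O F F' a n c0 r0}.

Lemma local_form_exists (O : C -> Prop) (F : C -> C) (a : C) n D : open O -> O a -> F a = 0 -> (1 <= n)%nat ->
  cderivs O F D -> (forall k, (k < S n)%nat -> D k a = 0) -> D (S n) a <> 0 ->
  exists r0, local_form O F (D 1%nat) a n (D (S n) a / INR (fact (S n)))%C r0.
Proof.
intros HO Ha HFa Hn HD Hz Hnz.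
assert (HD' := HD). destruct HD' as [HD0 HDd].
set (c0 := (D (S n) a / INR (fact (S n)))%C).
assert (Hfm : RtoC (INR (fact n)) <> 0) by (intros H; apply RtoC_inj in H; apply (INR_fact_neq_0 n H)).
assert (Hsm : RtoC (INR (S n)) <> 0) by (intros H; apply RtoC_inj in H; apply (not_0_INR (S n)); [lia|exact H]).
assert (Hc1 : (D (S n) a / INR (fact n) = INR (S n) * c0)%C).
{ unfold c0. rewrite fact_simpl, mult_INR, RtoC_mult. field. split; assumption. }
assert (Hc0 : c0 <> 0).
{ intros H. rewrite H in Hc1. apply Hnz. replace (D (S n) a) with (D (S n) a / INR (fact n) * INR (fact n))%C by (field; exact Hfm).
  rewrite Hc1. ring. }
assert (Hcp : 0 < Cmod c0) by (apply Cmod_gt_0, Hc0).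
assert (HF : forall e, 0 < e -> exists r, 0 < r /\ forall z, Cmod (z - a) <= r ->
    O z /\ Cmod (F z - c0 * (z - a) ^ S n) <= e * Cmod (c0 * (z - a) ^ S n)).
{ intros e He. destruct (taylor_little_o O D a HO Ha HDd (S n) 0%nat) with (e := e * Cmod c0) as [r [Hr H]].
  - exact Hz.
  - nra.
  - exists r. split; [exact Hr|]. intros z Hzr. destruct (H z Hzr) as [H1 H2]. split; [exact H1|].
    rewrite HD0 in H2 by exact H1. rewrite Cmod_mult, Cmod_pow. rewrite <- Rmult_assoc. exact H2. }
assert (HF' : exists r, 0 < r /\ forall z, Cmod (z - a) <= r ->
    O z /\ Cmod (D 1%nat z - INR (S n) * c0 * (z - a) ^ n) <= 1/20 * Cmod (INR (S n) * c0 * (z - a) ^ n)).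
{ assert (Hq : 0 < Cmod (INR (S n) * c0)) by (apply Cmod_gt_0, Cmult_neq_0; assumption).
  destruct (taylor_little_o O D a HO Ha HDd n 1%nat) with (e := 1/20 * Cmod (INR (S n) * c0)) as [r [Hr H]].
  - intros k Hk. apply Hz; lia.
  - lra.
  - exists r. split; [exact Hr|]. intros z Hzr. destruct (H z Hzr) as [H1 H2]. split; [exact H1|].
    change (1 + n)%nat with (S n) in H2. rewrite Hc1 in H2. rewrite (Cmod_mult (INR (S n) * c0)), Cmod_pow. rewrite <- Rmult_assoc. exact H2. }
destruct (HF (1/20)) as [r1 [Hr1 HF1]]; [lra|]. destruct HF' as [r2 [Hr2 HF2]].
assert (H1 := Rmin_l r1 r2). assert (H2 := Rmin_r r1 r2).
exists (Rmin r1 r2). constructor.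
- apply (loc_lip_cderivs O F D); assumption.
- intros z Hzz. apply (is_derive_cderivs O F D); assumption.
- exact Hn.
- exact Hc0.
- apply Rmin_pos; assumption.
- intros z Hzz. apply HF1; lra.
- exact HFa.
- intros z Hzz. apply HF1; lra.
- intros z Hzz. apply HF2; lra.
- intros e He. destruct (HF e He) as [r [Hr H]]. exists r. split; [exact Hr|]. intros z Hzz. apply H; lra.
Qed.

(** * Convexity along orbits near the zero *)

Lemma continuous_le_left (f : R -> R) (t c : R) : 0 < t -> continuous f t ->
  (forall s, 0 <= s < t -> f s <= c) -> f t <= c.
Proof.
intros Ht Hc H. apply Rnot_lt_le. intros Hlt. rewrite continuous_R in Hc.
destruct (Hc (f t - c)) as [d [Hd Hs]]; [lra|].
set (s := Rmax 0 (t - d / 2)).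
assert (Hst : 0 <= s < t /\ t - s < d).
{ unfold s. assert (H1 := Rmax_r 0 (t - d / 2)). split; [split; [apply Rmax_l|apply Rmax_lub_lt; lra]|lra]. }
specialize (Hs s ltac:(apply Rabs_def1; lra)). apply Rabs_def2 in Hs. specialize (H s (proj1 Hst)). lra.
Qed.

Lemma continuous_nbhd_lt (f : R -> R) (t c : R) : continuous f t -> f t < c ->
  exists d, 0 < d /\ forall s, Rabs (s - t) < d -> f s < c.
Proof.
intros Hc Hlt. rewrite continuous_R in Hc. destruct (Hc (c - f t)) as [d [Hd Hs]]; [lra|].
exists d. split; [exact Hd|]. intros s Hst. specialize (Hs s Hst). apply Rabs_def2 in Hs. lra.
Qed.

Lemma time_interval_convex I t : time_interval I -> I t -> forall s, Rmin 0 t <= s <= Rmax 0 t -> I s.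
Proof.
intros (lo & hi & H1 & H2 & H3) Ht s Hs. apply H3. apply H3 in Ht. destruct Ht as [H4 H5]. destruct Hs as [Hs1 Hs2]. split.
- revert Hs1. apply Rmin_case; intros Hs; [exact (Rbar_lt_le_trans _ 0 s H1 Hs)|exact (Rbar_lt_le_trans _ t s H4 Hs)].
- revert Hs2. apply Rmax_case; intros Hs; [exact (Rbar_le_lt_trans s 0 _ Hs H2)|exact (Rbar_le_lt_trans s t _ Hs H5)].
Qed.

Lemma time_interval_pos I t s : time_interval I -> I t -> 0 <= s <= t -> I s.
Proof. intros HI Ht Hs. apply (time_interval_convex I t HI Ht). rewrite Rmin_left, Rmax_right by lra. exact Hs. Qed.

Lemma time_interval_neg I t s : time_interval I -> I t -> t <= s <= 0 -> I s.
Proof. intros HI Ht Hs. apply (time_interval_convex I t HI Ht). rewrite Rmin_right, Rmax_left by lra. exact Hs. Qed.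

Lemma tends_fwd_eps I x a : tends_fwd I x a <->
  (forall t, 0 <= t -> I t) /\ forall e, 0 < e -> exists M, forall t, M < t -> Cmod (x t - a) < e.
Proof.
unfold tends_fwd. rewrite (filterlim_C (Rbar_locally p_infty) _ x a). reflexivity.
Qed.

Lemma tends_bwd_eps I x a : tends_bwd I x a <->
  (forall t, t <= 0 -> I t) /\ forall e, 0 < e -> exists M, forall t, t < M -> Cmod (x t - a) < e.
Proof.
unfold tends_bwd. rewrite (filterlim_C (Rbar_locally m_infty) _ x a). reflexivity.
Qed.

Lemma tends_fwd_reflect I x a : tends_fwd (fun t => I (- t)) (fun t => x (- t)) a <-> tends_bwd I x a.
Proof.
rewrite tends_fwd_eps, tends_bwd_eps. split; intros [H1 H2]; split.
- intros t Ht. rewrite <- (Ropp_involutive t). apply H1. lra.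
- intros e He. destruct (H2 e He) as [M HM]. exists (- M). intros t Ht. rewrite <- (Ropp_involutive t). apply HM. lra.
- intros t Ht. apply H1. lra.
- intros e He. destruct (H2 e He) as [M HM]. exists (- M). intros t Ht. apply HM. lra.
Qed.

Lemma tends_fwd_shift I x a c : time_interval I -> I c ->
  (tends_fwd (fun t => I (t + c)) (fun t => x (t + c)) a <-> tends_fwd I x a).
Proof.
intros HI Hc. rewrite !tends_fwd_eps. split; intros [H1 H2]; split.
- intros t Ht. destruct (Rle_dec 0 (t - c)) as [H|H].
  + replace t with (t - c + c) by ring. apply H1, H.
  + apply (time_interval_pos I c t HI Hc). lra.
- intros e He. destruct (H2 e He) as [M HM]. exists (M + c). intros t Ht. replace t with (t - c + c) by ring. apply HM. lra.
- intros t Ht. destruct (Rle_dec 0 (t + c)) as [H|H]; [apply H1, H|].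
  apply (time_interval_neg I c _ HI Hc). lra.
- intros e He. destruct (H2 e He) as [M HM]. exists (M - c). intros t Ht. apply HM. lra.
Qed.

Lemma tends_bwd_shift I x a c : time_interval I -> I c ->
  (tends_bwd (fun t => I (t + c)) (fun t => x (t + c)) a <-> tends_bwd I x a).
Proof.
intros HI Hc. rewrite !tends_bwd_eps. split; intros [H1 H2]; split.
- intros t Ht. destruct (Rle_dec (t - c) 0) as [H|H].
  + replace t with (t - c + c) by ring. apply H1, H.
  + apply (time_interval_neg I c t HI Hc). lra.
- intros e He. destruct (H2 e He) as [M HM]. exists (M + c). intros t Ht. replace t with (t - c + c) by ring. apply HM. lra.
- intros t Ht. destruct (Rle_dec (t + c) 0) as [H|H]; [apply H1, H|].
  apply (time_interval_pos I c _ HI Hc). lra.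
- intros e He. destruct (H2 e He) as [M HM]. exists (M - c). intros t Ht. apply HM. lra.
Qed.

(* With [F = c0 w^(n+1) G] and [w = z - a], the function [-1/(n c0 w^n)] has derivative [G] along orbits, and [radial] is half the derivative of its squared modulus. *)
Definition Pinv (a : C) (n : nat) (c0 : C) (z : C) : C := (- / (INR n * c0 * (z - a) ^ n))%C.
Definition Gfac (F : C -> C) (a : C) (n : nat) (c0 : C) (z : C) : C := (F z / (c0 * (z - a) ^ S n))%C.
Definition radial (F : C -> C) (a : C) (n : nat) (c0 : C) (z : C) : R := dotC (Pinv a n c0 z) (Gfac F a n c0 z).

Lemma RtoC_INR_neq_0 n : (1 <= n)%nat -> RtoC (INR n) <> 0.
Proof. intros Hn H. apply RtoC_inj in H. apply (not_0_INR n); [lia|exact H]. Qed.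

Lemma radial_opp F a (n : nat) (c0 : C) z : (1 <= n)%nat -> c0 <> 0 -> z <> a -> radial (vopp F) a n (- c0) z = - radial F a n c0 z.
Proof.
intros Hn Hc Hz.
assert (Hw : (z - a)%C <> 0) by exact (fun H => Hz (Csub_eq_0 _ _ H)).
assert (Hn0 := RtoC_INR_neq_0 n Hn).
assert (H1 : Pinv a n (- c0) z = (- Pinv a n c0 z)%C).
{ unfold Pinv. field. repeat split; auto. apply Cpow_nz, Hw. }
assert (H2 : Gfac (vopp F) a n (- c0) z = Gfac F a n c0 z).
{ unfold Gfac, vopp. field. repeat split; auto. apply Cpow_nz, Hw. }
unfold radial. rewrite H1, H2. unfold dotC. simpl. ring.
Qed.

Section Radial.
Context (O : C -> Prop) (F F' : C -> C) (a : C) (n : nat) (c0 : C) (r0 : R).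
Context (LF : local_form O F F' a n c0 r0).

Let P := Pinv a n c0.
Let G := Gfac F a n c0.
Let N := radial F a n c0.
(** The derivative of [G] along orbits: the complex derivative of [G] times [F], with
    [F / (c0 w^(n+1))] regrouped as [G]. The bracket vanishes for the pure power. *)
Let dG (z : C) : C := (G z * (F' z - INR (S n) * F z / (z - a)))%C.

Lemma Gfac_near_1 z : 0 < Cmod (z - a) <= r0 -> Cmod (G z - 1) <= 1/20.
Proof.
intros [Hz1 Hz2]. assert (Hw : (z - a)%C <> 0) by (apply Cmod_gt_0, Hz1).
assert (Hq : (c0 * (z - a) ^ S n)%C <> 0) by (apply Cmult_neq_0; [apply (lf_c0 LF)|apply Cpow_nz, Hw]).
assert (H := lf_F LF z Hz2). unfold G, Gfac.
replace (F z / (c0 * (z - a) ^ S n) - 1)%C with ((F z - c0 * (z - a) ^ S n) / (c0 * (z - a) ^ S n))%C by (field; split; [apply Cpow_nz, Hw|apply (lf_c0 LF)]).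
rewrite Cmod_div by exact Hq. apply Rle_div_l; [apply Cmod_gt_0, Hq|exact H].
Qed.

Lemma Cmod_Pinv z : Cmod (z - a) <> 0 -> Cmod (P z) = / (INR n * Cmod c0) / Cmod (z - a) ^ n.
Proof.
intros Hz. assert (Hw : (z - a)%C <> 0) by (intros H; apply Hz; rewrite H; apply Cmod_0).
assert (Hn := RtoC_INR_neq_0 n (lf_n LF)).
assert (Hc := lf_c0 LF).
unfold P, Pinv. rewrite Cmod_opp, Cmod_inv.
2: { apply Cmult_neq_0; [apply Cmult_neq_0; assumption|apply Cpow_nz, Hw]. }
rewrite !Cmod_mult, Cmod_R, Cmod_pow, Rabs_right by (apply Rle_ge, pos_INR).
assert (Hc' : Cmod c0 <> 0) by (intros H; apply Hc, Cmod_eq_0, H).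
assert (Hn' : INR n <> 0) by (intros H; apply Hn; rewrite H; reflexivity).
assert (Hz' : Cmod (z - a) ^ n <> 0) by (apply pow_nonzero, Hz).
field. auto.
Qed.

Lemma Pinv_const_pos : 0 < / (INR n * Cmod c0).
Proof.
apply Rinv_0_lt_compat, Rmult_lt_0_compat.
- apply lt_0_INR. assert (H := lf_n LF). lia.
- apply Cmod_gt_0, (lf_c0 LF).
Qed.

Lemma Pinv_pos z : 0 < Cmod (z - a) -> 0 < Cmod (P z).
Proof.
intros H. rewrite Cmod_Pinv by lra. apply Rdiv_lt_0_compat; [apply Pinv_const_pos|apply pow_lt, H].
Qed.

Lemma Pinv_antitone z w : 0 < Cmod (z - a) -> 0 < Cmod (w - a) -> Cmod (P z) <= Cmod (P w) -> Cmod (w - a) <= Cmod (z - a).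
Proof.
intros Hz Hw H. apply Rnot_lt_le. intros Hlt. revert H. rewrite !Cmod_Pinv by lra. apply Rlt_not_le.
apply Rmult_lt_compat_l; [apply Pinv_const_pos|]. apply Rinv_lt_contravar.
- apply Rmult_lt_0_compat; apply pow_lt; assumption.
- assert (Hn := lf_n LF). clear - Hlt Hz Hn. destruct n as [|k]; [lia|]. clear Hn.
  induction k as [|k IH]; [simpl; lra|].
  change (Cmod (z - a) * Cmod (z - a) ^ S k < Cmod (w - a) * Cmod (w - a) ^ S k).
  assert (0 < Cmod (z - a) ^ S k) by (apply pow_lt, Hz). nra.
Qed.

Lemma Pinv_strict z w : 0 < Cmod (z - a) -> 0 < Cmod (w - a) -> Cmod (P z) < Cmod (P w) -> Cmod (w - a) < Cmod (z - a).
Proof.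
intros Hz Hw H. destruct (Pinv_antitone z w Hz Hw (Rlt_le _ _ H)) as [H1|H1]; [exact H1|].
exfalso. revert H. rewrite !Cmod_Pinv by lra. rewrite H1. lra.
Qed.

Lemma is_derive_Pinv x t : solves_at O F x t -> x t <> a -> is_derive (fun s => P (x s)) t (G (x t)).
Proof.
intros [_ Hd] Hne.
assert (Hw : (x t - a)%C <> 0) by exact (fun H => Hne (Csub_eq_0 _ _ H)).
assert (Hn := RtoC_INR_neq_0 n (lf_n LF)).
assert (Hc := lf_c0 LF).
assert (Hwd : is_derive (fun s => (x s - a)%C) t (F (x t))).
{ eapply is_derive_eqC; [apply is_derive_subC; [exact Hd|apply is_derive_constC]|]. ring. }
assert (Hq := is_derive_mulC (fun _ => (INR n * c0)%C) _ t _ _ (is_derive_constC (INR n * c0)%C t) (is_derive_powC _ n t _ Hwd)).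
assert (Hi := is_derive_invC _ t _ Hq). cbv beta in Hi.
assert (Hm := is_derive_subC _ _ t _ _ (is_derive_constC 0 t) (Hi (Cmult_neq_0 _ _ (Cmult_neq_0 _ _ Hn Hc) (Cpow_nz _ _ Hw)))).
eapply is_derive_eqC; [eapply is_derive_extC; [|exact Hm]|].
- intros s. unfold P, Pinv. ring.
- unfold G, Gfac. destruct n as [|k]; [exfalso; apply Hn; reflexivity|].
  change (pred (S k)) with k. simpl Cpow. field. repeat split; auto. apply Cpow_nz, Hw.
Qed.

Lemma is_derive_Gfac_curve (x : R -> C) (t : R) (v : C) : O (x t) -> is_derive x t v -> x t <> a ->
  is_derive (fun s => G (x s)) t ((F' (x t) - INR (S n) * F (x t) / (x t - a)) / (c0 * (x t - a) ^ S n) * v)%C.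
Proof.
intros HO Hd Hne.
assert (Hw : (x t - a)%C <> 0) by exact (fun H => Hne (Csub_eq_0 _ _ H)).
assert (Hc := lf_c0 LF).
assert (Hwd : is_derive (fun s => (x s - a)%C) t v).
{ eapply is_derive_eqC; [apply is_derive_subC; [exact Hd|apply is_derive_constC]|]. ring. }
assert (Hq := is_derive_mulC (fun _ => c0) _ t _ _ (is_derive_constC c0 t) (is_derive_powC _ (S n) t _ Hwd)).
assert (Hi := is_derive_invC _ t _ Hq). cbv beta in Hi.
assert (Hm := is_derive_mulC _ _ t _ _ (is_derive_compC F x t _ _ (lf_derive LF _ HO) Hd) (Hi (Cmult_neq_0 _ _ Hc (Cpow_nz _ _ Hw)))).
eapply is_derive_eqC; [exact Hm|].
change (pred (S n)) with n. cbv beta. rewrite !Cpow_S. field. repeat split; auto. apply Cpow_nz, Hw.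
Qed.

Lemma is_derive_Gfac x t : solves_at O F x t -> x t <> a -> is_derive (fun s => G (x s)) t (dG (x t)).
Proof.
intros [HO Hd] Hne. eapply is_derive_eqC; [apply is_derive_Gfac_curve; eassumption|].
assert (Hw : (x t - a)%C <> 0) by exact (fun H => Hne (Csub_eq_0 _ _ H)).
assert (Hc := lf_c0 LF). assert (Hwn := Cpow_nz _ n Hw).
unfold dG, G, Gfac. rewrite !Cpow_S. field. auto.
Qed.

(** The leading terms of [F'] and of [(n+1) F / w] cancel; two errors of 1/20 remain. *)
Lemma logarithmic_defect z : 0 < Cmod (z - a) <= r0 ->
  Cmod (F' z - INR (S n) * F z / (z - a)) <= 1/10 * (INR (S n) * Cmod c0 * Cmod (z - a) ^ n).
Proof.
intros [Hz1 Hz2]. assert (Hw : (z - a)%C <> 0) by (apply Cmod_gt_0, Hz1).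
assert (H1 := lf_F LF z Hz2). assert (H2 := lf_F' LF z Hz2).
replace (F' z - INR (S n) * F z / (z - a))%C with
  ((F' z - INR (S n) * c0 * (z - a) ^ n) - INR (S n) * ((F z - c0 * (z - a) ^ S n) / (z - a)))%C.
2: { simpl Cpow. field. exact Hw. }
unfold Cminus at 1. eapply Rle_trans; [apply Cmod_triangle|]. rewrite Cmod_opp, (Cmod_mult (INR (S n))), Cmod_div by exact Hw.
rewrite !Cmod_mult, !Cmod_pow, !Cmod_R, !(Rabs_right (INR (S n))) in * by (apply Rle_ge, pos_INR).
assert (H3 : Cmod (F z - c0 * (z - a) ^ S n) / Cmod (z - a) <= 1/20 * (Cmod c0 * Cmod (z - a) ^ n)).
{ apply Rle_div_l; [exact Hz1|]. simpl pow in H1. lra. }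
assert (H4 := pos_INR (S n)). nra.
Qed.

(* Strict convexity of [Cmod (P x)^2] along orbits: the right-hand side is the derivative of [N]. *)
Lemma radial_derivative_bound z : 0 < Cmod (z - a) <= r0 -> 1/2 <= dotC (G z) (G z) + dotC (P z) (dG z).
Proof.
intros Hz. assert (HG := Gfac_near_1 z Hz). assert (HD := logarithmic_defect z Hz).
assert (H1 : 19/20 <= Cmod (G z) <= 21/20).
{ assert (H1 := Cmod_rev_triangle (G z) 1). assert (H2 := Cmod_rev_triangle 1 (G z)).
  rewrite (Cmod_minus_sym 1 (G z)), Cmod_1 in *. lra. }
rewrite dotC_self.
(* The product is at most (21/20)(1/10)(n+1)/n <= 21/100, whereas the square of [Cmod (G z)] is at
   least (19/20)^2 > 9/10. The difference stays above 1/2. *)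
assert (H2 : Cmod (P z) * Cmod (dG z) <= 22/100).
{ unfold dG. rewrite Cmod_mult, Cmod_Pinv by lra.
  assert (Hn : 1 <= INR n). { replace 1 with (INR 1) by reflexivity. apply le_INR, (lf_n LF). }
  assert (Hc : 0 < Cmod c0) by apply Cmod_gt_0, (lf_c0 LF).
  assert (Hp : 0 < Cmod (z - a) ^ n) by (apply pow_lt, Hz).
  apply Rle_trans with (/ (INR n * Cmod c0) / Cmod (z - a) ^ n * (21/20 * (1/10 * (INR (S n) * Cmod c0 * Cmod (z - a) ^ n)))).
  - apply Rmult_le_compat_l.
    + left. apply Rdiv_lt_0_compat; [apply Pinv_const_pos|exact Hp].
    + apply Rmult_le_compat; try apply Cmod_ge_0; lra.
  - rewrite S_INR. replace (_ * _) with (21/200 * ((INR n + 1) / INR n)) by (field; repeat split; lra).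
    assert ((INR n + 1) / INR n <= 2) by (apply Rle_div_l; lra). lra. }
assert (H3 := dotC_le (P z) (dG z)). apply Rabs_le_between in H3. nra.
Qed.

Lemma is_derive_radial x t : solves_at O F x t -> x t <> a ->
  is_derive (fun s => N (x s)) t (dotC (G (x t)) (G (x t)) + dotC (P (x t)) (dG (x t))).
Proof.
intros H1 H2. apply is_derive_dotC; [apply is_derive_Pinv; assumption|apply is_derive_Gfac; assumption].
Qed.

Lemma radial_growth x t1 t2 : t1 <= t2 -> (forall t, t1 <= t <= t2 -> solves_at O F x t /\ 0 < Cmod (x t - a) <= r0) ->
  N (x t1) + (t2 - t1) / 2 <= N (x t2).
Proof.
intros Ht H.
assert (Hne : forall t, t1 <= t <= t2 -> x t <> a).
{ intros t Htt He. destruct (H t Htt) as [_ [H1 _]]. rewrite He in H1. rewrite Cmod_sub_diag in H1. lra. }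
assert (Hm := mvt_ge (fun t => N (x t)) _ t1 t2 (1/2) Ht (fun t Htt => is_derive_radial x t (proj1 (H t Htt)) (Hne t Htt))).
cbv beta in Hm. assert (1 / 2 * (t2 - t1) <= N (x t2) - N (x t1)); [|lra]. apply Hm.
intros t Htt. apply radial_derivative_bound, H, Htt.
Qed.

(** [2 * N] is the derivative of the squared modulus of [P], so [radial_growth] is integrated once
    more. *)
Lemma Pinv_growth x t1 t2 : t1 <= t2 -> (forall t, t1 <= t <= t2 -> solves_at O F x t /\ 0 < Cmod (x t - a) <= r0) ->
  Cmod (P (x t1)) ^ 2 + 2 * N (x t1) * (t2 - t1) + (t2 - t1) ^ 2 / 2 <= Cmod (P (x t2)) ^ 2.
Proof.
intros Ht H.
assert (Hne : forall t, t1 <= t <= t2 -> x t <> a).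
{ intros t Htt He. destruct (H t Htt) as [_ [H1 _]]. rewrite He in H1. rewrite Cmod_sub_diag in H1. lra. }
assert (Hm := mvt_ge (fun t => dotC (P (x t)) (P (x t)) - (2 * N (x t1) * (t - t1) + (t - t1) ^ 2 / 2))
  (fun t => 2 * N (x t) - (2 * N (x t1) + (t - t1))) t1 t2 0 Ht).
cbv beta in Hm. rewrite !dotC_self in Hm.
enough (0 * (t2 - t1) <= Cmod (P (x t2)) ^ 2 - (2 * N (x t1) * (t2 - t1) + (t2 - t1) ^ 2 / 2) - (Cmod (P (x t1)) ^ 2 - (2 * N (x t1) * (t1 - t1) + (t1 - t1) ^ 2 / 2))) by lra.
apply Hm.
- intros t Htt. apply (is_derive_minus (V := R_NormedModule)).
  + evar_last; [apply is_derive_dotC; apply is_derive_Pinv; try apply H; try apply Hne; assumption|].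
    unfold N, radial. fold P G. unfold dotC. ring.
  + auto_derive; [trivial|]. field.
- intros t Htt. assert (Hg := radial_growth x t1 t). enough (N (x t1) + (t - t1) / 2 <= N (x t)) by lra.
  apply Hg; [lra|]. intros s Hs. apply H; lra.
Qed.

(** The constant curve [a] is a solution, and solutions through a common point coincide. *)
Lemma max_never_a I x : max_solution O F I x -> x 0 <> a -> forall t, I t -> x t <> a.
Proof.
intros Hx H0 t Ht He. apply H0.
assert (HL := lf_lip LF).
destruct (solution_candidate O F I x t (proj1 Hx) (proj1 (proj2 Hx)) Ht) as (t1 & t2 & (Hc1 & _ & Hc2) & Ht12 & _).
apply (solves_unique O F HL x (fun _ => a) t1 t2 t Ht12); [|exact He|lra].
intros s Hs. split; [apply Hc2, Hs|]. split.
- apply (lf_ball LF). rewrite Cmod_sub_diag. left. apply (lf_r0 LF).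
- eapply is_derive_eqC; [apply is_derive_constC|]. symmetry. apply (lf_Fa LF).
Qed.

Lemma uniform_local_flow rho : rho < r0 -> exists tau, 0 < tau /\ forall z, Cmod (z - a) <= rho ->
  exists y, y 0 = z /\ forall s, Rabs s < tau -> solves_at O F y s.
Proof.
(* [L] bounds [F'] on the disc of radius [r0]: the leading term enlarged by 1/20. Since [F a = 0],
   speeds there are at most [L * r0], and one existence time serves all starting points. *)
intros Hrho. set (L := 21/20 * (INR (S n) * Cmod c0 * r0 ^ n)).
assert (Hr0 := lf_r0 LF).
assert (HL : 0 <= L).
{ unfold L. assert (H := pos_INR (S n)). assert (H1 := Cmod_ge_0 c0). assert (H2 : 0 < r0 ^ n) by (apply pow_lt, Hr0).
  apply Rmult_le_pos; [lra|]. apply Rmult_le_pos; [apply Rmult_le_pos; assumption|lra]. }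
assert (Hlip : forall u v, Cmod (u - a) <= r0 -> Cmod (v - a) <= r0 -> Cmod (F u - F v) <= L * Cmod (u - v)).
{ apply (cderiv_bound_lipschitz F F'). intros u Hu. split; [apply (lf_derive LF), (lf_ball LF), Hu|].
  assert (H := lf_F' LF u Hu). assert (H1 := Cmod_rev_triangle (F' u) (INR (S n) * c0 * (u - a) ^ n)).
  rewrite !Cmod_mult, Cmod_pow, Cmod_R, Rabs_right in * by (apply Rle_ge, pos_INR).
  assert (H2 : Cmod (u - a) ^ n <= r0 ^ n) by (apply pow_incr; split; [apply Cmod_ge_0|exact Hu]).
  apply Rle_trans with (21/20 * (INR (S n) * Cmod c0 * Cmod (u - a) ^ n)); [lra|]. unfold L.
  apply Rmult_le_compat_l; [lra|]. apply Rmult_le_compat_l; [apply Rmult_le_pos; [apply pos_INR|apply Cmod_ge_0]|exact H2]. }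
set (M := L * r0). assert (HM : 0 <= M) by (unfold M; nra).
set (tau := Rmin ((r0 - rho) / (M + 1)) (1 / 2 / (L + 1))).
assert (Htau : 0 < tau). { apply Rmin_pos; apply Rdiv_lt_0_compat; lra. }
exists tau. split; [exact Htau|]. intros z Hz.
assert (Hin : forall u, Cmod (u - z) <= r0 - rho -> Cmod (u - a) <= r0).
{ intros u Hu. assert (H := Cmod_minus_triangle u z a). lra. }
destruct (picard F z (r0 - rho) L M tau) as (x & Hx0 & Hx); try lra.
- assert (H : tau <= (r0 - rho) / (M + 1)) by apply Rmin_l.
  apply Rmult_le_compat_r with (r := M + 1) in H; [|lra].
  replace ((r0 - rho) / (M + 1) * (M + 1)) with (r0 - rho) in H by (field; lra). nra.
- assert (H : tau <= 1 / 2 / (L + 1)) by apply Rmin_r.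
  apply Rmult_le_compat_r with (r := L + 1) in H; [|lra].
  replace (1 / 2 / (L + 1) * (L + 1)) with (1 / 2) in H by (field; lra). nra.
- intros u v Hu Hv. apply Hlip; apply Hin; assumption.
- intros u Hu. assert (H := Hlip u a (Hin u Hu)). rewrite (lf_Fa LF) in H.
  replace (F u - 0)%C with (F u) in H by ring. rewrite Cmod_sub_diag in H.
  specialize (H ltac:(lra)). specialize (Hin u Hu). unfold M. nra.
- exists x. split; [exact Hx0|]. intros s Hs. destruct (Hx s Hs) as [H1 H2]. split; [|exact H2].
  apply (lf_ball LF), Hin, H1.
Qed.

Lemma max_continuous I x t : max_solution O F I x -> I t -> continuous x t.
Proof. intros Hx Ht. apply (solves_at_continuous O F x t), (proj1 (proj2 Hx)), Ht. Qed.

Lemma max_global_in_disc I x rho : rho < r0 -> max_solution O F I x ->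
  (forall t, I t -> 0 <= t -> Cmod (x t - a) <= rho) -> forall t, 0 <= t -> I t.
Proof.
intros Hrho Hx H. destruct (uniform_local_flow rho Hrho) as [tau [Htau Hf]].
apply (max_escape O F (lf_lip LF) I x tau Htau Hx). intros t Ht Ht0. apply Hf, H; assumption.
Qed.

(** While the orbit is in the disc, [Cmod (P (x t))] is at least its initial value, so the radius is
    at most its initial value, which is strictly below [r0]. This strictness allows real induction
    to continue. *)
Lemma inward_stays I x : max_solution O F I x -> 0 < Cmod (x 0 - a) < r0 -> 0 <= N (x 0) ->
  forall t, I t -> 0 <= t -> 0 < Cmod (x t - a) < r0.
Proof.
intros Hx H0 HN T HT HT0.
assert (Hne : forall t, I t -> 0 < Cmod (x t - a)).
{ intros t Ht. apply Cmod_sub_pos, (max_never_a I x Hx); [|exact Ht]. intros He. rewrite He in H0.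
  rewrite Cmod_sub_diag in H0. lra. }
split; [apply Hne, HT|].
assert (HI : forall t, 0 <= t <= T -> I t) by (intros t Ht; apply (time_interval_pos I T t (proj1 Hx) HT Ht)).
enough (H : forall t, 0 <= t <= T -> Cmod (x t - a) < r0) by (apply H; lra).
apply real_induction. intros t Ht Hs.
assert (Hle : forall s, 0 <= s < t -> Cmod (x s - a) <= Cmod (x 0 - a)).
{ intros s Hst. apply Pinv_antitone; [apply H0|apply Hne, HI; lra|].
  assert (Hg := Pinv_growth x 0 s (proj1 Hst)). assert (Hp := Pinv_pos (x 0) (proj1 H0)).
  assert (Hp' := Pinv_pos (x s) (Hne s (HI s ltac:(lra)))).
  assert (Cmod (P (x 0)) ^ 2 + 2 * N (x 0) * (s - 0) + (s - 0) ^ 2 / 2 <= Cmod (P (x s)) ^ 2); [|nra].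
  apply Hg. intros q Hq. split; [apply (proj1 (proj2 Hx)), HI; lra|]. split; [apply Hne, HI; lra|]. left; apply Hs; lra. }
assert (Hct := continuous_Cmod_sub x a t (max_continuous I x t Hx (HI t Ht))).
assert (Htt : Cmod (x t - a) < r0).
{ destruct (Req_dec t 0) as [->|Hnz]; [apply H0|].
  apply Rle_lt_trans with (Cmod (x 0 - a)); [|apply H0].
  apply (continuous_le_left (fun s => Cmod (x s - a)) t); [lra|exact Hct|exact Hle]. }
destruct (continuous_nbhd_lt _ t r0 Hct Htt) as [d [Hd Hn]]. exists d. split; [exact Hd|].
intros s Hst _. apply Hn, Rabs_def1; lra.
Qed.

(** With [N] nonnegative at the start, the squared modulus of [P] grows at least like t^2 / 2. Since
    [P] is infinite exactly at [a], the orbit tends to [a]. *)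
Theorem inward_tends I x : max_solution O F I x -> 0 < Cmod (x 0 - a) < r0 -> 0 <= N (x 0) ->
  tends_fwd I x a /\ forall t, 0 < t -> 0 < Cmod (x t - a) < Cmod (x 0 - a) /\ N (x 0) + t / 2 <= N (x t)
     /\ Cmod (P (x 0)) ^ 2 + t ^ 2 / 2 <= Cmod (P (x t)) ^ 2.
Proof.
intros Hx H0 HN. assert (Hst := inward_stays I x Hx H0 HN).
assert (Hseg : forall s t, 0 <= t -> I t -> 0 <= s <= t -> solves_at O F x s /\ 0 < Cmod (x s - a) <= r0).
{ intros s t Ht HIt Hs. assert (HIs := time_interval_pos I t s (proj1 Hx) HIt Hs).
  split; [apply (proj1 (proj2 Hx)), HIs|]. destruct (Hst s HIs (proj1 Hs)). lra. }
assert (Hgrow : forall t, I t -> 0 <= t -> Cmod (P (x 0)) ^ 2 + t ^ 2 / 2 <= Cmod (P (x t)) ^ 2).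
{ intros t Ht Ht0. assert (Hg := Pinv_growth x 0 t Ht0 (fun s Hs => Hseg s t Ht0 Ht Hs)).
  rewrite Rminus_0_r in Hg. nra. }
assert (Hle : forall t, I t -> 0 <= t -> Cmod (x t - a) <= Cmod (x 0 - a)).
{ intros t Ht Ht0. apply Pinv_antitone; [apply H0|apply Hst; assumption|].
  assert (Hg := Hgrow t Ht Ht0). assert (Hp := Pinv_pos (x 0) (proj1 H0)).
  assert (Hp' := Pinv_pos (x t) (proj1 (Hst t Ht Ht0))). nra. }
assert (HI : forall t, 0 <= t -> I t) by (apply (max_global_in_disc I x (Cmod (x 0 - a))); [apply H0|exact Hx|exact Hle]).
split; [apply tends_fwd_eps; split; [exact HI|]|].
- intros e He. set (K := / (INR n * Cmod c0)). assert (HK : 0 < K) by apply Pinv_const_pos.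
  assert (Hen : 0 < e ^ n) by (apply pow_lt, He).
  assert (HQ : 0 < K / e ^ n) by (apply Rdiv_lt_0_compat; assumption).
  (* At radius at least [e] the modulus of [P] is at most [K / e ^ n], and for [t] above twice this
     number t^2 / 2 exceeds its square. *)
  exists (2 * (K / e ^ n)). intros t Ht. apply Rnot_le_lt. intros Hge.
  assert (Hg := Hgrow t (HI t ltac:(lra)) ltac:(lra)).
  assert (HPt : Cmod (P (x t)) <= K / e ^ n).
  { assert (Hp : 0 < Cmod (x t - a)) by lra. rewrite Cmod_Pinv by lra. fold K. apply Rmult_le_compat_l; [lra|].
    apply Rinv_le_contravar; [exact Hen|]. apply pow_incr. lra. }
  assert (Hp := Cmod_ge_0 (P (x t))). assert (Hp0 := Cmod_ge_0 (P (x 0))). nra.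
- intros t Ht. assert (HIt := HI t (Rlt_le _ _ Ht)).
  assert (Hg := Hgrow t HIt (Rlt_le _ _ Ht)). split; [split; [apply Hst; [exact HIt|lra]|]|split; [|exact Hg]].
  + apply Pinv_strict; [apply H0|apply Hst; [exact HIt|lra]|].
    assert (Hp0 := Pinv_pos (x 0) (proj1 H0)).
    assert (Hp' := Pinv_pos (x t) (proj1 (Hst t HIt (Rlt_le _ _ Ht)))). nra.
  + assert (Hg' := radial_growth x 0 t (Rlt_le _ _ Ht) (fun s Hs => Hseg s t (Rlt_le _ _ Ht) HIt Hs)). lra.
Qed.

(** An orbit that does not tend to [a] has [N] negative at all its points in the disc of radius [r].
    As [N] increases at least at rate 1/2, it can stay there only for a bounded time. *)
Lemma exit_or_tends I x r : max_solution O F I x -> 0 < Cmod (x 0 - a) <= r -> r < r0 ->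
  tends_fwd I x a \/ exists t, 0 <= t /\ I t /\ Cmod (x t - a) = r /\ N (x t) < 0.
Proof.
intros Hx H0 Hr.
destruct (classic (tends_fwd I x a)) as [H|Hnt]; [left; exact H|right].
assert (Hne : forall t, I t -> 0 < Cmod (x t - a)).
{ intros t Ht. apply Cmod_sub_pos, (max_never_a I x Hx); [|exact Ht]. intros He. rewrite He in H0.
  rewrite Cmod_sub_diag in H0. lra. }
assert (HNneg : forall t, I t -> Cmod (x t - a) <= r -> N (x t) < 0).
{ intros t Ht Htr. apply Rnot_le_lt. intros HN. apply Hnt.
  apply (tends_fwd_shift I x a t (proj1 Hx) Ht).
  apply (inward_tends _ _ (max_shift O F I x t Hx Ht)); cbv beta; rewrite Rplus_0_l; [|exact HN].
  specialize (Hne t Ht). lra. }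
apply NNPP. intros Hno.
assert (Hin : forall t, I t -> 0 <= t -> Cmod (x t - a) < r).
{ intros t Ht Ht0. apply Rnot_le_lt. intros Hge.
  destruct (ivt_zero (fun s => Cmod (x s - a) - r) 0 t Ht0) as (s & Hs & Hes); [|lra|lra|].
  - intros s Hs. apply (continuous_minus (V := R_NormedModule)); [|apply continuous_const].
    apply continuous_Cmod_sub, (max_continuous I x s Hx), (time_interval_pos I t s (proj1 Hx) Ht Hs).
  - assert (HIs := time_interval_pos I t s (proj1 Hx) Ht Hs). apply Hno. exists s.
    split; [apply Hs|]. split; [exact HIs|]. split; [lra|]. apply HNneg; [exact HIs|lra]. }
assert (HI : forall t, 0 <= t -> I t).
{ apply (max_global_in_disc I x r Hr Hx). intros t Ht Ht0. left; apply Hin; assumption. }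
(* After time [T] the growth of [N] would bring it to at least 1. *)
set (T := 2 * (1 - N (x 0))).
assert (HT : 0 <= T). { unfold T. assert (N (x 0) < 0); [|lra]. apply HNneg; [apply HI; lra|apply H0]. }
assert (Hg := radial_growth x 0 T HT).
assert (N (x 0) + (T - 0) / 2 <= N (x T)).
{ apply Hg. intros t Ht. split; [apply (proj1 (proj2 Hx)), HI; lra|]. split; [apply Hne, HI; lra|]. specialize (Hin t (HI t (proj1 Ht)) (proj1 Ht)). lra. }
assert (N (x T) < 0) by (apply HNneg; [apply HI, HT|left; apply Hin; [apply HI, HT|exact HT]]).
unfold T in *. lra.
Qed.
End Radial.
Arguments inward_tends {O F F' a n c0 r0}.
Arguments max_never_a {O F F' a n c0 r0}.
Arguments Gfac_near_1 {O F F' a n c0 r0}.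
Arguments Cmod_Pinv {O F F' a n c0 r0}.
Arguments logarithmic_defect {O F F' a n c0 r0}.
Arguments exit_or_tends {O F F' a n c0 r0}.
Arguments radial_growth {O F F' a n c0 r0}.
Arguments is_derive_Pinv {O F F' a n c0 r0}.
Arguments is_derive_radial {O F F' a n c0 r0}.
Arguments Pinv_const_pos {O F F' a n c0 r0}.
Arguments is_derive_Gfac_curve {O F F' a n c0 r0}.

Theorem outward_tends O F F' a n c0 r0 (LF : local_form O F F' a n c0 r0) I x :
  max_solution O F I x -> 0 < Cmod (x 0 - a) < r0 -> radial F a n c0 (x 0) <= 0 ->
  tends_bwd I x a /\ forall t, t < 0 -> 0 < Cmod (x t - a) < Cmod (x 0 - a) /\ radial F a n c0 (x t) <= radial F a n c0 (x 0) + t / 2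
     /\ Cmod (Pinv a n c0 (x 0)) ^ 2 + t ^ 2 / 2 <= Cmod (Pinv a n c0 (x t)) ^ 2.
Proof.
intros Hx H0 HN.
assert (LF' := local_form_opp LF).
assert (Hn := lf_n LF). assert (Hc := lf_c0 LF).
assert (Hra : forall z, 0 < Cmod (z - a) -> radial (vopp F) a n (- c0) z = - radial F a n c0 z).
{ intros z Hz. apply radial_opp; auto. intros ->. rewrite Cmod_sub_diag in Hz. lra. }
assert (HP : forall z, 0 < Cmod (z - a) -> Cmod (Pinv a n (- c0) z) = Cmod (Pinv a n c0 z)).
{ intros z Hz. rewrite (Cmod_Pinv LF') by lra. rewrite (Cmod_Pinv LF) by lra. rewrite Cmod_opp. reflexivity. }
destruct (inward_tends LF' _ _ (max_reflect O F I x Hx)) as [H1 H2]; cbv beta.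
- rewrite Ropp_0. exact H0.
- rewrite Ropp_0, Hra by apply H0. lra.
- split; [apply tends_fwd_reflect, H1|]. intros t Ht. specialize (H2 (- t) ltac:(lra)). cbv beta in H2.
  rewrite Ropp_involutive, Ropp_0 in H2. destruct H2 as (H3 & H4 & H5). split; [exact H3|].
  rewrite !Hra in H4 by lra. rewrite !HP in H5 by lra. split; [lra|]. replace ((- t) ^ 2) with (t ^ 2) in H5 by ring. exact H5.
Qed.
Arguments outward_tends {O F F' a n c0 r0}.

(** * Outgoing branches as polar graphs *)

Lemma is_derive_unit_dir (g : R -> R) (t g' : R) : is_derive g t g' ->
  is_derive (fun s => unit_dir (g s)) t (RtoC g' * (Ci * unit_dir (g t)))%C.
Proof.
intros Hg. apply is_derive_C_pair. simpl. split.
- evar_last; [apply (is_derive_comp cos g); [apply is_derive_cos|exact Hg]|]. unfold scal; simpl; unfold mult; simpl. ring.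
- evar_last; [apply (is_derive_comp sin g); [apply is_derive_sin|exact Hg]|]. unfold scal; simpl; unfold mult; simpl. ring.
Qed.

Lemma Cmod_unit_dir_lipschitz x y : Cmod (unit_dir x - unit_dir y) <= Rabs (x - y).
Proof.
assert (H : forall x y, y <= x -> Cmod (unit_dir x - unit_dir y) <= 1 * (x - y)).
{ clear. intros x y Hyx. apply (mvt_C unit_dir (fun t => RtoC 1 * (Ci * unit_dir t))%C y x 1 Hyx).
  - intros t _. apply (is_derive_unit_dir (fun s => s)). apply (is_derive_id (K := R_AbsRing)).
  - intros t _. rewrite !Cmod_mult, Cmod_1, Cmod_Ci, Cmod_unit_dir. lra. }
destruct (Rle_dec y x) as [Hyx|Hyx].
- rewrite Rabs_right by lra. specialize (H x y Hyx). lra.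
- rewrite Cmod_minus_sym, Rabs_left by lra. specialize (H y x ltac:(lra)). lra.
Qed.

Lemma cos_le_small y e : 0 < e -> e <= Rabs y -> Rabs y <= PI -> cos y <= cos e.
Proof.
intros H1 H2 H3. replace (cos y) with (cos (Rabs y)).
- apply cos_decr_1; lra.
- unfold Rabs. destruct (Rcase_abs y); [apply cos_neg|reflexivity].
Qed.

Lemma cos_quarter y : Rabs y <= PI / 4 -> 7/10 <= cos y.
Proof.
intros H. assert (Hp := PI_RGT_0).
apply Rle_trans with (cos (PI / 4)).
- rewrite cos_PI4. assert (H2 := Rlt_sqrt2_0). apply (proj1 (Rle_div_r (7/10) 1 (sqrt 2) H2)).
  assert (sqrt 2 <= 10/7); [|lra]. apply Rsqr_incr_0; [|apply sqrt_pos|lra]. rewrite Rsqr_sqrt; unfold Rsqr; lra.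
- replace (cos y) with (cos (Rabs y)).
  + apply cos_decr_1; try apply Rabs_pos; lra.
  + unfold Rabs. destruct (Rcase_abs y); [apply cos_neg|reflexivity].
Qed.

Lemma cos_three_quarters y : 3 * PI / 4 <= Rabs y <= 5 * PI / 4 -> cos y <= - (7/10).
Proof.
intros H. replace (cos y) with (cos (Rabs y)).
- replace (Rabs y) with (Rabs y - PI + PI) by ring. rewrite neg_cos. assert (H1 := cos_quarter (Rabs y - PI)).
  assert (7/10 <= cos (Rabs y - PI)); [|lra]. apply H1, Rabs_le; lra.
- unfold Rabs. destruct (Rcase_abs y); [apply cos_neg|reflexivity].
Qed.

Lemma sin_quarter y : PI / 4 <= y <= 3 * PI / 4 -> 7/10 <= sin y.
Proof. intros H. rewrite <- cos_shift. apply cos_quarter, Rabs_le. lra. Qed.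

(* Up to the positive factor [Cmod c0 * rho ^ S n], the radial component of [F] at [Pol a rho phi], when [alpha] is an argument of [c0]. *)
Definition angle_fun (F : C -> C) (a : C) (n : nat) (c0 : C) (alpha rho phi : R) : R :=
  fst (unit_dir (INR n * phi + alpha) * Gfac F a n c0 (Pol a rho phi))%C.

Lemma unit_dir_pow x n : (unit_dir x ^ n)%C = unit_dir (INR n * x).
Proof.
induction n as [|n IH].
- simpl. rewrite Rmult_0_l. unfold unit_dir. rewrite cos_0, sin_0. reflexivity.
- rewrite S_INR, Cpow_S, IH, <- unit_dir_plus. f_equal. ring.
Qed.

Lemma unit_dir_opp x : (/ unit_dir x)%C = unit_dir (- x).
Proof.
assert (H : (unit_dir x * unit_dir (- x))%C = RtoC 1).
{ rewrite <- unit_dir_plus, Rplus_opp_r. unfold unit_dir. rewrite cos_0, sin_0. reflexivity. }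
assert (Hn : unit_dir x <> 0). { intros H0. rewrite H0 in H. rewrite Cmult_0_l in H. apply RtoC_inj in H. lra. }
replace (unit_dir (- x)) with (/ unit_dir x * (unit_dir x * unit_dir (- x)))%C by (field; exact Hn). rewrite H. ring.
Qed.

Lemma unit_dir_neq_0 x : unit_dir x <> 0.
Proof. intros H. assert (H1 := Cmod_unit_dir x). rewrite H, Cmod_0 in H1. lra. Qed.

Section Angular.
Context (O : C -> Prop) (F F' : C -> C) (a : C) (n : nat) (c0 : C) (r0 alpha : R).
Context (LF : local_form O F F' a n c0 r0).
Context (Hal : c0 = (RtoC (Cmod c0) * unit_dir alpha)%C).

Let P := Pinv a n c0.
Let G := Gfac F a n c0.
Let N := radial F a n c0.
Let H := angle_fun F a n c0 alpha.
Let Y (phi : R) := INR n * phi + alpha.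

Lemma INR_n_ge_1 : 1 <= INR n.
Proof. replace 1 with (INR 1) by reflexivity. apply le_INR, (lf_n LF). Qed.

Lemma Pol_neq_a rho phi : 0 < rho -> Pol a rho phi <> a.
Proof.
intros Hr He. assert (H1 := Pol_radius a rho phi (Rlt_le _ _ Hr)). rewrite He in H1.
rewrite Cmod_sub_diag in H1. lra.
Qed.

Lemma Pinv_Pol rho phi : 0 < rho ->
  P (Pol a rho phi) = (- (RtoC (/ (INR n * Cmod c0) / rho ^ n) * unit_dir (- Y phi)))%C.
Proof.
intros Hr. unfold P, Pinv. rewrite Pol_sub.
rewrite Hal at 1. rewrite Cpow_mult_l, unit_dir_pow, <- unit_dir_opp. unfold Y. rewrite unit_dir_plus.
assert (Hn := RtoC_INR_neq_0 n (lf_n LF)).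
assert (Hc : RtoC (Cmod c0) <> 0). { intros H0. apply RtoC_inj in H0. apply (lf_c0 LF), Cmod_eq_0, H0. }
assert (Hu1 := unit_dir_neq_0 (INR n * phi)). assert (Hu2 := unit_dir_neq_0 alpha).
assert (Hrn : RtoC rho <> 0) by (intros H0; apply RtoC_inj in H0; lra).
assert (Hrp := Cpow_nz _ n Hrn).
assert (Hcr : Cmod c0 <> 0) by (intros H0; apply Hc; rewrite H0; reflexivity).
assert (Hn1 := INR_n_ge_1). assert (Hp : rho ^ n <> 0) by (apply pow_nonzero; lra).
unfold Rdiv. rewrite RtoC_mult, !RtoC_inv, RtoC_mult, RtoC_pow.
- field. auto.
- exact Hp.
- apply Rmult_integral_contrapositive_currified; lra.
Qed.

(** The minus sign reflects that [P] shrinks as the point moves away from [a]: outward motion is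
    [N < 0] and [H > 0]. *)
Lemma radial_Pol rho phi : 0 < rho -> N (Pol a rho phi) = - (/ (INR n * Cmod c0) / rho ^ n * H rho phi).
Proof.
intros Hr. unfold N, radial. fold P. rewrite Pinv_Pol by exact Hr. unfold H, angle_fun. fold (Y phi). fold G.
unfold dotC, unit_dir. simpl. rewrite cos_neg, sin_neg. ring.
Qed.

Lemma radial_scale_pos rho : 0 < rho -> 0 < / (INR n * Cmod c0) / rho ^ n.
Proof. intros Hr. apply Rdiv_lt_0_compat; [apply (Pinv_const_pos LF)|apply pow_lt, Hr]. Qed.

Lemma radial_angle_sign rho phi : 0 < rho ->
  (N (Pol a rho phi) < 0 <-> 0 < H rho phi) /\ (N (Pol a rho phi) <= 0 <-> 0 <= H rho phi) /\ (N (Pol a rho phi) = 0 <-> H rho phi = 0).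
Proof.
intros Hr. rewrite radial_Pol by exact Hr. assert (Hs := radial_scale_pos rho Hr).
set (s := / (INR n * Cmod c0) / rho ^ n) in *.
split; [|split]; split; intros; nra.
Qed.

Lemma angle_near_cos rho phi : 0 < rho <= r0 -> Rabs (H rho phi - cos (Y phi)) <= 1/20.
Proof.
intros Hr. assert (HG := Gfac_near_1 LF (Pol a rho phi)). rewrite Pol_radius in HG by lra. specialize (HG Hr).
unfold H, angle_fun. fold (Y phi).
replace (fst (unit_dir (Y phi) * Gfac F a n c0 (Pol a rho phi))%C - cos (Y phi)) with
  (fst (unit_dir (Y phi) * (Gfac F a n c0 (Pol a rho phi) - 1))%C) by (simpl; ring).
eapply Rle_trans; [apply Cmod_fst|]. rewrite Cmod_mult, Cmod_unit_dir. lra.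
Qed.

(** For [G = 1] the function is cos Y, with derivative -n sin Y. The factor [G] contributes an error
    n/20, and its angular derivative one of (n+1)/10 <= n/5; together n/4. *)
Lemma is_derive_angle_fun rho phi : 0 < rho <= r0 ->
  exists d, is_derive (H rho) phi d /\ Rabs (d + INR n * sin (Y phi)) <= INR n / 4.
Proof.
intros Hr. assert (Hn1 := INR_n_ge_1).
assert (HPol : is_derive (fun s => Pol a rho s) phi (Ci * (Pol a rho phi - a))%C).
{ eapply is_derive_eqC.
  - apply is_derive_addC; [apply is_derive_constC|]. apply is_derive_mulC; [apply is_derive_constC|].
    apply (is_derive_unit_dir (fun s => s)). apply (is_derive_id (K := R_AbsRing)).
  - rewrite Pol_sub. change (RtoC one) with (RtoC 1). cbv beta. ring. }
assert (Hz : 0 < Cmod (Pol a rho phi - a) <= r0) by (rewrite Pol_radius; lra).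
assert (HG := is_derive_Gfac_curve LF (fun s => Pol a rho s) phi _ (lf_ball LF _ (proj2 Hz)) HPol (Pol_neq_a rho phi (proj1 Hr))).
assert (HU : is_derive (fun s => unit_dir (INR n * s + alpha)) phi (RtoC (INR n) * (Ci * unit_dir (INR n * phi + alpha)))%C).
{ apply (is_derive_unit_dir (fun s => INR n * s + alpha) phi (INR n)). auto_derive; [trivial|ring]. }
assert (HM := is_derive_mulC _ _ phi _ _ HU HG). apply is_derive_C_pair, proj1 in HM.
eexists. split; [exact HM|]. cbv beta.
assert (HG1 := Gfac_near_1 LF _ Hz). assert (HD := logarithmic_defect LF _ Hz).
set (z := Pol a rho phi) in *. fold (Y phi).
set (q := ((F' z - INR (S n) * F z / (z - a)) / (c0 * (z - a) ^ S n) * (Ci * (z - a)))%C).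
assert (Hw : (z - a)%C <> 0) by (apply Cmod_gt_0, Hz).
assert (Hc := lf_c0 LF). assert (Hcp : 0 < Cmod c0) by (apply Cmod_gt_0, Hc).
assert (Hq : Cmod q <= INR n / 5).
{ unfold q. rewrite !Cmod_mult, Cmod_Ci, Cmod_div by (apply Cmult_neq_0; [exact Hc|apply Cpow_nz, Hw]).
  rewrite Cmod_mult, Cmod_pow. simpl pow. set (w := Cmod (z - a)) in *.
  assert (Hwp : 0 < w ^ n) by (apply pow_lt, Hz).
  replace (Cmod (F' z - INR (S n) * F z / (z - a)) / (Cmod c0 * (w * w ^ n)) * (1 * w)) with (Cmod (F' z - INR (S n) * F z / (z - a)) / (Cmod c0 * w ^ n)) by (field; repeat split; lra).
  apply Rle_div_l; [apply Rmult_lt_0_compat; assumption|]. eapply Rle_trans; [exact HD|]. rewrite S_INR.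
  assert (Hcw : 0 < Cmod c0 * w ^ n) by (apply Rmult_lt_0_compat; assumption).
  replace (1/10 * ((INR n + 1) * Cmod c0 * w ^ n)) with ((INR n + 1) / 10 * (Cmod c0 * w ^ n)) by field.
  apply Rmult_le_compat_r; lra. }
replace (fst (RtoC (INR n) * (Ci * unit_dir (Y phi)) * Gfac F a n c0 z + unit_dir (Y phi) * q)%C + INR n * sin (Y phi))
  with (fst (RtoC (INR n) * (Ci * unit_dir (Y phi)) * (Gfac F a n c0 z - 1))%C + fst (unit_dir (Y phi) * q)%C) by (simpl; ring).
eapply Rle_trans; [apply Rabs_triang|].
assert (H1 := Cmod_fst (RtoC (INR n) * (Ci * unit_dir (Y phi)) * (Gfac F a n c0 z - 1))).
assert (H2 := Cmod_fst (unit_dir (Y phi) * q)).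
rewrite !Cmod_mult, Cmod_Ci, Cmod_unit_dir, Cmod_R, (Rabs_right (INR n)) in H1 by lra. rewrite Cmod_mult, Cmod_unit_dir in H2. nra.
Qed.

Lemma continuous_angle_fun rho phi : 0 < rho <= r0 -> continuous (H rho) phi.
Proof.
intros Hr. destruct (is_derive_angle_fun rho phi Hr) as [d [Hd _]].
apply (ex_derive_continuous (V := R_NormedModule)). exists d. exact Hd.
Qed.

Lemma angle_fun_decr rho phi1 phi2 : 0 < rho <= r0 -> PI / 4 <= Y phi1 -> phi1 < phi2 -> Y phi2 <= 3 * PI / 4 ->
  H rho phi2 < H rho phi1.
Proof.
intros Hr H1 H12 H2. assert (Hn1 := INR_n_ge_1).
set (dH := fun phi => epsilon (inhabits 0) (fun d => is_derive (H rho) phi d /\ Rabs (d + INR n * sin (Y phi)) <= INR n / 4)).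
assert (HdH : forall phi, is_derive (H rho) phi (dH phi) /\ Rabs (dH phi + INR n * sin (Y phi)) <= INR n / 4).
{ intros phi. unfold dH. apply epsilon_spec. apply is_derive_angle_fun, Hr. }
(* The slope bound is n (7/10 - 1/4): sin Y is at least 7/10 on this range. *)
assert (Hm := mvt_le (H rho) dH phi1 phi2 (- (INR n * (9/20))) (Rlt_le _ _ H12) (fun t _ => proj1 (HdH t))).
assert (H rho phi2 - H rho phi1 <= - (INR n * (9/20)) * (phi2 - phi1)); [|nra].
apply Hm. intros t Ht. destruct (HdH t) as [_ Hb]. apply Rabs_le_between in Hb.
assert (Hs := sin_quarter (Y t)). unfold Y in *. specialize (Hs ltac:(nra)). nra.
Qed.

(** Within pi/4 of 0 and of pi the cosine exceeds 7/10 in modulus, so the error 1/20 cannot change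
    the sign. In between, [H rho] is strictly decreasing and has exactly one zero. *)
Lemma tangency_exists rho : 0 < rho <= r0 -> exists eta, PI / 4 < Y eta < 3 * PI / 4 /\ H rho eta = 0 /\
  (forall phi, - (PI / 4) <= Y phi -> phi < eta -> 0 < H rho phi) /\
  (forall phi, eta < phi -> Y phi <= 5 * PI / 4 -> H rho phi < 0).
Proof.
intros Hr. assert (Hn1 := INR_n_ge_1). assert (Hp := PI_RGT_0).
assert (HYinv : forall y, Y ((y - alpha) / INR n) = y) by (intros y; unfold Y; field; lra).
assert (Hmono : forall p q, Y p < Y q -> p < q) by (unfold Y; intros; nra).
assert (Hmono' : forall p q, p < q -> Y p < Y q) by (unfold Y; intros; nra).
assert (Hpos : forall phi, - (PI / 4) <= Y phi <= PI / 4 -> 0 < H rho phi).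
{ intros phi Hphi. assert (H1 := angle_near_cos rho phi Hr). apply Rabs_le_between in H1.
  assert (H2 := cos_quarter (Y phi) ltac:(apply Rabs_le; lra)). lra. }
assert (Hneg : forall phi, 3 * PI / 4 <= Y phi <= 5 * PI / 4 -> H rho phi < 0).
{ intros phi Hphi. assert (H1 := angle_near_cos rho phi Hr). apply Rabs_le_between in H1.
  assert (H2 := cos_three_quarters (Y phi)). rewrite Rabs_right in H2 by lra. specialize (H2 Hphi). lra. }
destruct (ivt_zero (fun phi => - H rho phi) ((PI / 4 - alpha) / INR n) ((3 * PI / 4 - alpha) / INR n)) as (eta & He1 & He2).
- apply Rmult_le_compat_r; [left; apply Rinv_0_lt_compat; lra|lra].
- intros t _. apply (continuous_opp (V := R_NormedModule)), continuous_angle_fun, Hr.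
- assert (H1 := Hpos ((PI / 4 - alpha) / INR n)). rewrite HYinv in H1. specialize (H1 ltac:(lra)). lra.
- assert (H1 := Hneg ((3 * PI / 4 - alpha) / INR n)). rewrite HYinv in H1. specialize (H1 ltac:(lra)). lra.
- assert (Hz : H rho eta = 0) by lra.
  assert (HYe : PI / 4 < Y eta < 3 * PI / 4).
  { assert (PI / 4 <= Y eta <= 3 * PI / 4).
    { rewrite <- (HYinv (PI / 4)) at 1. rewrite <- (HYinv (3 * PI / 4)). unfold Y. nra. }
    split; apply Rnot_le_lt; intros Hle.
    - assert (H1 := Hpos eta ltac:(lra)). lra.
    - assert (H1 := Hneg eta ltac:(lra)). lra. }
  exists eta. split; [exact HYe|]. split; [exact Hz|]. split.
  + intros phi H1 H2. destruct (Rle_dec (Y phi) (PI / 4)) as [Hl|Hl]; [apply Hpos; lra|].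
    rewrite <- Hz. apply angle_fun_decr; try assumption; lra.
  + intros phi H1 H2. destruct (Rle_dec (3 * PI / 4) (Y phi)) as [Hl|Hl]; [apply Hneg; lra|].
    rewrite <- Hz. apply angle_fun_decr; try assumption; lra.
Qed.

(** With [L] a primitive of [F / (x - a)], the product of [x - a] and exp(-L) has derivative 0. The
    imaginary part of [L] is therefore the increase of a continuous angle. Zeros cause no trouble,
    since the orbit never reaches [a]. *)
Lemma angle_lift I x r phi0 : max_solution O F I x -> 0 < r -> x 0 = Pol a r phi0 ->
  exists phi : R -> R, phi 0 = phi0 /\ forall t, I t -> continuous phi t /\ x t = Pol a (Cmod (x t - a)) (phi t).
Proof.
intros Hx Hr Hx0.
assert (Hne0 : x 0 <> a) by (rewrite Hx0; apply Pol_neq_a, Hr).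
assert (Hne := max_never_a LF I x Hx Hne0).
assert (Hsub : forall z, z <> a -> (z - a)%C <> 0). { intros z Hz H0. apply Hz. replace z with (z - a + a)%C by ring. rewrite H0. ring. }
set (Q := fun t => (F (x t) * / (x t - a))%C).
assert (HdQ : forall t, I t -> continuous Q t).
{ intros t Ht. destruct (proj1 (proj2 Hx) t Ht) as [HOt Hd].
  assert (Hd2 : is_derive (fun s => (x s - a)%C) t (F (x t) - 0)%C) by (apply is_derive_subC; [exact Hd|apply is_derive_constC]).
  exact (is_derive_C_continuous Q t _ (is_derive_mulC _ _ t _ _ (is_derive_compC F x t _ _ (lf_derive LF _ HOt) Hd) (is_derive_invC _ t _ Hd2 (Hsub _ (Hne t Ht))))). }
destruct (proj1 Hx) as (lo & hi & Hlo & Hhi & HI).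
set (L := prim 0 Q).
assert (HL : forall t, I t -> is_derive L t (Q t)).
{ intros t Ht. apply HI in Ht. apply (is_derive_prim 0 Q lo hi); try tauto; try exact Hlo; try exact Hhi.
  intros s Hs1 Hs2. apply HdQ, HI; auto. }
(* The complex exponential of [- L t], written in polar form. *)
set (E := fun t => (RtoC (exp (- fst (L t))) * unit_dir (- snd (L t)))%C).
assert (HE : forall t, I t -> is_derive E t (- Q t * E t)%C).
{ intros t Ht. destruct (proj1 (is_derive_C_pair _ _ _) (HL t Ht)) as [H1 H2].
  assert (He : is_derive (fun s => RtoC (exp (- fst (L s)))) t (RtoC (- fst (Q t) * exp (- fst (L t))))).
  { apply is_derive_C_pair. simpl. split; [|apply (is_derive_const (V := R_NormedModule))].
    evar_last; [apply (is_derive_comp exp (fun s => - fst (L s))); [apply is_derive_exp|apply (is_derive_opp (V := R_NormedModule)), H1]|].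
    unfold scal, opp; simpl; unfold mult; simpl. ring. }
  assert (Hu := is_derive_unit_dir (fun s => - snd (L s)) t (- snd (Q t)) (is_derive_opp (V := R_NormedModule) _ _ _ H2)).
  eapply is_derive_eqC; [exact (is_derive_mulC _ _ t _ _ He Hu)|]. unfold E. cbv beta.
  rewrite RtoC_mult. 
  replace (- Q t)%C with (RtoC (- fst (Q t)) + RtoC (- snd (Q t)) * Ci)%C by (apply injective_projections; simpl; ring).
  ring. }
assert (HW : forall t, I t -> is_derive (fun s => ((x s - a) * E s)%C) t (RtoC 0)).
{ intros t Ht. destruct (proj1 (proj2 Hx) t Ht) as [HOt Hd].
  assert (Hd2 : is_derive (fun s => (x s - a)%C) t (F (x t) - 0)%C) by (apply is_derive_subC; [exact Hd|apply is_derive_constC]).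
  eapply is_derive_eqC; [exact (is_derive_mulC _ _ t _ _ Hd2 (HE t Ht))|]. unfold Q. cbv beta. field. apply Hsub, Hne, Ht. }
assert (HL0 : L 0 = 0) by apply prim_0.
assert (HE0 : E 0 = 1). { unfold E. rewrite HL0. simpl. rewrite Ropp_0, exp_0. unfold unit_dir. rewrite cos_0, sin_0. apply injective_projections; simpl; ring. }
assert (Hconst : forall t, I t -> ((x t - a) * E t)%C = (x 0 - a)%C).
{ intros t Ht. rewrite <- (Cmult_1_r (x 0 - a)), <- HE0.
  assert (Hm := fun p q => mvt_C (fun s => ((x s - a) * E s)%C) (fun _ => 0) p q 0). cbv beta in Hm.
  assert (Hseg := time_interval_convex I t (proj1 Hx) Ht).
  apply Cmod_sub_0, Rle_antisym; [|apply Cmod_ge_0].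
  destruct (Rle_dec 0 t) as [H0t|H0t].
  - rewrite Rmin_left, Rmax_right in Hseg by lra. specialize (Hm 0 t H0t). rewrite Rmult_0_l in Hm. apply Hm.
    + intros s Hs. apply HW, Hseg, Hs.
    + intros s _. rewrite Cmod_0. lra.
  - rewrite Rmin_right, Rmax_left in Hseg by lra. specialize (Hm t 0 ltac:(lra)). rewrite Rmult_0_l in Hm.
    rewrite Cmod_minus_sym. apply Hm.
    + intros s Hs. apply HW, Hseg, Hs.
    + intros s _. rewrite Cmod_0. lra. }
exists (fun t => phi0 + snd (L t)). split; [rewrite HL0; simpl; ring|].
intros t Ht. split.
- apply (continuous_plus (V := R_NormedModule)); [apply continuous_const|].
  apply continuous_C_snd. exact (is_derive_C_continuous L t _ (HL t Ht)).
- assert (Hc := Hconst t Ht). rewrite Hx0, Pol_sub in Hc.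
  assert (Hxa : (x t - a)%C = (RtoC (r * exp (fst (L t))) * unit_dir (phi0 + snd (L t)))%C).
  { assert (HEinv : (E t * (RtoC (exp (fst (L t))) * unit_dir (snd (L t))))%C = 1).
    { unfold E. replace (RtoC (exp (- fst (L t))) * unit_dir (- snd (L t)) * (RtoC (exp (fst (L t))) * unit_dir (snd (L t))))%C
        with ((RtoC (exp (- fst (L t))) * RtoC (exp (fst (L t)))) * (unit_dir (- snd (L t)) * unit_dir (snd (L t))))%C by ring.
      rewrite <- RtoC_mult, <- exp_plus, <- unit_dir_plus, !Rplus_opp_l, exp_0. unfold unit_dir. rewrite cos_0, sin_0. apply injective_projections; simpl; ring. }
    replace (x t - a)%C with ((x t - a) * E t * (RtoC (exp (fst (L t))) * unit_dir (snd (L t))))%C.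
    - rewrite Hc, unit_dir_plus, RtoC_mult. ring.
    - rewrite <- Cmult_assoc, HEinv. ring. }
  assert (Hmod : Cmod (x t - a) = r * exp (fst (L t))).
  { rewrite Hxa, Cmod_mult, Cmod_unit_dir, Cmod_R, Rabs_right; [ring|]. apply Rle_ge, Rmult_le_pos; [lra|left; apply exp_pos]. }
  unfold Pol. rewrite Hmod, <- Hxa. ring.
Qed.

(** Backwards [N] stays nonpositive, but at [Y] equal to plus or minus 3 pi/4 the function [H] is
    negative, that is [N] positive. The angle cannot reach these values. *)
Lemma outgoing_zone_persists I x phi : max_solution O F I x -> 0 < Cmod (x 0 - a) < r0 -> N (x 0) <= 0 ->
  (forall t, I t -> continuous phi t /\ x t = Pol a (Cmod (x t - a)) (phi t)) -> Rabs (Y (phi 0)) < 3 * PI / 4 ->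
  forall t, t <= 0 -> Rabs (Y (phi t)) < 3 * PI / 4.
Proof.
intros Hx H0 HN Hphi HY0 t Ht.
destruct (outward_tends LF I x Hx H0 HN) as [[HI _] Hout].
apply Rnot_le_lt. intros Hge.
destruct (ivt_zero (fun s => 3 * PI / 4 - Rabs (Y (phi s))) t 0 Ht) as (s & Hs & He).
- intros s Hs. apply (continuous_minus (V := R_NormedModule)); [apply continuous_const|].
  apply (continuous_comp (fun s => Y (phi s)) Rabs); [|apply continuous_Rabs].
  apply (continuous_plus (V := R_NormedModule)); [|apply continuous_const].
  apply (continuous_mult (K := R_AbsRing)); [apply continuous_const|apply Hphi, HI; lra].
- lra.
- lra.
- assert (Hr : 0 < Cmod (x s - a) <= r0 /\ N (x s) <= 0).
  { destruct (Req_dec s 0) as [->|Hne]; [split; lra|]. destruct (Hout s ltac:(lra)) as (H1 & H2 & _). fold N in H2. split; lra. }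
  destruct Hr as [Hr HNs]. destruct (Hphi s (HI s ltac:(lra))) as [_ Hxs]. rewrite Hxs in HNs.
  apply radial_angle_sign in HNs; [|lra].
  assert (H1 := angle_near_cos (Cmod (x s - a)) (phi s) Hr). apply Rabs_le_between in H1.
  assert (Hp := PI_RGT_0). assert (H2 := cos_three_quarters (Y (phi s)) ltac:(lra)). lra.
Qed.

(* Backwards in time [G] tends to 1, so [P x t / t] tends to 1, which fixes the limit of the angle. *)
Lemma outgoing_direction I x phi : max_solution O F I x -> 0 < Cmod (x 0 - a) < r0 -> N (x 0) <= 0 ->
  (forall t, I t -> continuous phi t /\ x t = Pol a (Cmod (x t - a)) (phi t)) -> Rabs (Y (phi 0)) < 3 * PI / 4 ->
  forall e, 0 < e -> exists M, forall t, t < M -> Rabs (Y (phi t)) < e.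
Proof.
intros Hx H0 HN Hphi HY0 e0 He0.
assert (Hzone := outgoing_zone_persists I x phi Hx H0 HN Hphi HY0).
destruct (outward_tends LF I x Hx H0 HN) as [Hbwd Hout].
apply tends_bwd_eps in Hbwd. destruct Hbwd as [HI Hlim].
assert (Hp := PI_RGT_0).
set (e := Rmin e0 1). assert (He : 0 < e) by (apply Rmin_pos; lra). assert (Hee0 : e <= e0) by apply Rmin_l. assert (He1 : e <= 1) by apply Rmin_r.
(* The target is cos Y > 1 - q. Relative errors q/16 from [G] and from the initial value give |P -
   t| <= q/8 |t|. An angle with cos Y <= 1 - q would then require 1 - q/8 <= (1 + q/8)(1 - q), which
   is false. *)
set (q := 1 - cos e).
assert (Hp3 : 3 < PI) by (assert (Hpi := PI2_3_2); lra).
assert (Hq : 0 < q <= 1). { unfold q. assert (cos e < cos 0) by (apply cos_decreasing_1; lra). rewrite cos_0 in *. assert (0 <= cos e) by (apply cos_ge_0; lra). lra. }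
set (d := q / 8).
destruct (lf_lim LF (q / 16)) as [rr [Hrr Hlf]]; [lra|].
destruct (Hlim rr Hrr) as [M1 HM1]. set (T := Rmin M1 0 - 1).
assert (HT1 : T < M1) by (assert (H1 := Rmin_l M1 0); unfold T; lra).
assert (HT0 : T < 0) by (assert (H1 := Rmin_r M1 0); unfold T; lra).
set (K := Cmod (P (x T)) + Rabs T).
(* Before this time the constant [K] inherited from time [T] is at most q/16 times [- t]. *)
exists (Rmin T (- (16 * K / q))).
intros t Ht. assert (HtT : t < T) by (eapply Rlt_le_trans; [exact Ht|apply Rmin_l]).
assert (HtK : t < - (16 * K / q)) by (eapply Rlt_le_trans; [exact Ht|apply Rmin_r]).
assert (HG1 : forall s, s <= T -> Cmod (G (x s) - 1) <= q / 16).
{ intros s Hs. assert (Hsr := HM1 s ltac:(lra)).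
  assert (Hs0 : 0 < Cmod (x s - a)) by (destruct (Hout s ltac:(lra)) as [H1 _]; lra).
  assert (Hw : (x s - a)%C <> 0) by (apply Cmod_gt_0, Hs0).
  assert (Hc := lf_c0 LF). assert (Hwn := Cpow_nz _ (S n) Hw).
  unfold G, Gfac. replace (F (x s) / (c0 * (x s - a) ^ S n) - 1)%C with ((F (x s) - c0 * (x s - a) ^ S n) / (c0 * (x s - a) ^ S n))%C by (field; auto).
  rewrite Cmod_div by (apply Cmult_neq_0; assumption). apply Rle_div_l; [apply Cmod_gt_0, Cmult_neq_0; assumption|].
  apply Hlf; lra. }
assert (Hm := mvt_C (fun s => P (x s) - RtoC s)%C (fun s => G (x s) - 1)%C t T (q / 16) (Rlt_le _ _ HtT)). cbv beta in Hm.
assert (Hdiff : Cmod (P (x T) - RtoC T - (P (x t) - RtoC t)) <= q / 16 * (T - t)).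
{ apply Hm.
  - intros s Hs. apply is_derive_subC.
    + apply (is_derive_Pinv LF).
      * apply (proj1 (proj2 Hx)), HI; lra.
      * apply (max_never_a LF I x Hx); [|apply HI; lra]. intros He'. rewrite He' in H0.
        rewrite Cmod_sub_diag in H0. lra.
    + apply is_derive_C_pair. simpl. split; [apply (is_derive_id (K := R_AbsRing))|apply (is_derive_const (V := R_NormedModule))].
  - intros s Hs. apply HG1; lra. }
assert (HPt : Cmod (P (x t) - RtoC t) <= q / 8 * (- t)).
{ replace (P (x t) - RtoC t)%C with (- (P (x T) - RtoC T - (P (x t) - RtoC t)) + (P (x T) - RtoC T))%C by ring.
  eapply Rle_trans; [apply Cmod_triangle|]. rewrite Cmod_opp.
  assert (H1 := Cmod_triangle (P (x T)) (- RtoC T)). rewrite Cmod_opp, Cmod_R in H1. fold K in H1.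
  change (P (x T) + - RtoC T)%C with (P (x T) - RtoC T)%C in H1.
  assert (H2 : K <= q / 16 * (- t)).
  { apply Rlt_le in HtK. assert (H3 := Rmult_le_compat_l (q / 16) _ _ ltac:(lra) HtK).
    replace (q / 16 * - (16 * K / q)) with (- K) in H3 by (field; lra). lra. }
  assert (q / 16 * (T - t) <= q / 16 * (- t)) by (apply Rmult_le_compat_l; lra). lra. }
destruct (Hphi t (HI t ltac:(lra))) as [_ Hxt].
assert (Hrt : 0 < Cmod (x t - a)) by (destruct (Hout t ltac:(lra)) as [H1 _]; lra).
rewrite Hxt, Pinv_Pol in HPt by exact Hrt.
set (s := / (INR n * Cmod c0) / Cmod (x t - a) ^ n) in HPt.
assert (Hs : 0 < s) by (apply radial_scale_pos, Hrt).
assert (Hfst := Cmod_fst (- (RtoC s * unit_dir (- Y (phi t))) - RtoC t)).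
assert (Hmods : s <= (1 + q / 8) * (- t)).
{ assert (H1 := Cmod_rev_triangle (- (RtoC s * unit_dir (- Y (phi t)))) (RtoC t)).
  rewrite Cmod_opp, Cmod_mult, Cmod_unit_dir, !Cmod_R, (Rabs_right s), (Rabs_left t) in H1 by lra. lra. }
simpl in Hfst. rewrite cos_neg in Hfst.
assert (Hcos : (1 - q / 8) * (- t) <= s * cos (Y (phi t))).
{ assert (H1 := Rle_trans _ _ _ Hfst HPt). apply Rabs_le_between in H1. lra. }
apply Rnot_le_lt. intros Hge.
assert (Hc := cos_le_small (Y (phi t)) e He ltac:(lra)). specialize (Hzone t ltac:(lra)). specialize (Hc ltac:(lra)).
assert (Hce : cos e = 1 - q) by (unfold q; ring). rewrite Hce in Hc.
assert (s * cos (Y (phi t)) <= s * (1 - q)) by (apply Rmult_le_compat_l; lra).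
nra.
Qed.

(* The backward orbit of [x] inside the disc of radius [r] is the polar graph [phi = f rho]; [f] is continued by a constant beyond [r]. *)
Record branch (I : R -> Prop) (x : R -> C) (r phi0 : R) (f : R -> R) : Prop := {
  br_cont : forall rho, 0 < rho -> continuous f rho;
  br_end : forall rho, r <= rho -> f rho = phi0;
  br_zone : forall rho, 0 < rho < r -> Rabs (Y (f rho)) < 3 * PI / 4 /\ 0 < H rho (f rho);
  br_orbit : forall t, t <= 0 -> I t /\ 0 < Cmod (x t - a) <= r /\ x t = Pol a (Cmod (x t - a)) (f (Cmod (x t - a)));
  br_mono : forall s t, s < t <= 0 -> Cmod (x s - a) < Cmod (x t - a);
  br_onto : forall rho, 0 < rho <= r -> exists t, t <= 0 /\ Cmod (x t - a) = rho;
  br_dir : tends_bwd_dir I x a (- alpha / INR n) }.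

(** Backwards from the circle the radius is strictly monotone and takes all values in (0, r]. Its
    inverse [tt] expresses time through radius, and composing the lifted angle with [tt] gives the
    graph. *)
Theorem outgoing_branch I x r phi0 : max_solution O F I x -> 0 < r < r0 -> x 0 = Pol a r phi0 ->
  Rabs (Y phi0) < 3 * PI / 4 -> 0 <= H r phi0 -> exists f, branch I x r phi0 f.
Proof.
intros Hx Hr Hx0 HY0 HH0. assert (Hn1 := INR_n_ge_1).
assert (Hrad0 : Cmod (x 0 - a) = r) by (rewrite Hx0, Pol_radius; lra).
assert (HN0 : N (x 0) <= 0) by (rewrite Hx0; apply radial_angle_sign; lra).
assert (H0 : 0 < Cmod (x 0 - a) < r0) by lra.
destruct (angle_lift I x r phi0 Hx (proj1 Hr) Hx0) as (phi & Hphi0 & Hphi).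
rewrite <- Hphi0 in HY0.
assert (Hzone := outgoing_zone_persists I x phi Hx H0 HN0 Hphi HY0).
assert (Hdir := outgoing_direction I x phi Hx H0 HN0 Hphi HY0).
destruct (outward_tends LF I x Hx H0 HN0) as [Hbwd Hout].
assert (Hbwd' := proj1 (tends_bwd_eps I x a) Hbwd). destruct Hbwd' as [HI Hlim].
set (rad := fun t => Cmod (x t - a)).
assert (Hradc : forall t, t <= 0 -> continuous rad t).
{ intros t Ht. apply continuous_Cmod_sub. apply (max_continuous O F I x t Hx), HI, Ht. }
assert (Hmono : forall s t, s < t <= 0 -> rad s < rad t).
{ intros s t Hst.
  assert (Hrt : 0 < Cmod (x t - a) < r0 /\ N (x t) <= 0).
  { destruct (Req_dec t 0) as [->|Hne]; [split; assumption|]. destruct (Hout t ltac:(lra)) as (H1 & H2 & _). fold N in H2. split; lra. }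
  destruct (outward_tends LF _ _ (max_shift O F I x t Hx (HI t ltac:(lra)))) as [_ Hout']; cbv beta in *; rewrite ?Rplus_0_l in *; [apply Hrt|apply Hrt|].
  destruct (Hout' (s - t) ltac:(lra)) as (H1 & _). replace (s - t + t) with s in H1 by ring. apply H1. }
assert (Hmono' : forall s t, s <= 0 -> t <= 0 -> rad s < rad t -> s < t).
{ intros s t Hs Ht Hlt. apply Rnot_le_lt. intros [Hle| ->]; [|lra]. specialize (Hmono t s ltac:(lra)). lra. }
assert (Hradpos : forall t, t <= 0 -> 0 < rad t <= r).
{ intros t Ht. destruct (Req_dec t 0) as [->|Hne]; [unfold rad; lra|]. destruct (Hout t ltac:(lra)) as [H1 _]. unfold rad. lra. }
assert (Honto : forall rho, 0 < rho <= r -> exists t, t <= 0 /\ rad t = rho).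
{ intros rho Hrho. destruct (Hlim rho (proj1 Hrho)) as [M HM].
  set (T := Rmin M 0 - 1). assert (HT : T < M /\ T < 0) by (assert (H1 := Rmin_l M 0); assert (H2 := Rmin_r M 0); unfold T; lra).
  destruct (ivt_zero (fun t => rad t - rho) T 0) as (t & Ht & He).
  - lra.
  - intros t Ht. apply (continuous_minus (V := R_NormedModule)); [apply Hradc; lra|apply continuous_const].
  - specialize (HM T ltac:(lra)). unfold rad. lra.
  - unfold rad. lra.
  - exists t. split; lra. }
(* The value 0 from radius [r] on continues the graph by the constant angle [phi0]. *)
set (tt := fun rho => if Rlt_dec rho r then epsilon (inhabits 0) (fun t => t <= 0 /\ rad t = rho) else 0).
assert (Htt1 : forall rho, 0 < rho < r -> tt rho <= 0 /\ rad (tt rho) = rho).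
{ intros rho Hrho. unfold tt. destruct (Rlt_dec rho r) as [_|]; [|lra]. apply epsilon_spec, Honto. lra. }
assert (Htt2 : forall rho, r <= rho -> tt rho = 0).
{ intros rho Hrho. unfold tt. destruct (Rlt_dec rho r); [lra|reflexivity]. }
assert (Httr : forall t, t <= 0 -> tt (rad t) = t).
{ intros t Ht. destruct (Req_dec t 0) as [->|Hne]; [apply Htt2; unfold rad; lra|].
  assert (H1 := Hmono t 0 ltac:(lra)). assert (H2 := Hradpos t Ht). assert (H5 : rad 0 = r) by (unfold rad; lra).
  destruct (Htt1 (rad t)) as [H3 H4]; [lra|].
  destruct (Rtotal_order (tt (rad t)) t) as [Hlt|[He|Hgt]]; [|exact He|].
  - specialize (Hmono (tt (rad t)) t ltac:(lra)). lra.
  - specialize (Hmono t (tt (rad t)) ltac:(lra)). lra. }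
assert (Httneg : forall rho, 0 < rho -> tt rho <= 0).
{ intros rho Hrho. destruct (Rlt_dec rho r); [apply Htt1; lra|rewrite Htt2; lra]. }
assert (Hrad0' : rad 0 = r) by (unfold rad; lra).
assert (Httc : forall rho, 0 < rho -> continuous tt rho).
{ intros rho Hrho. apply continuous_R. intros d Hd. set (t1 := tt rho). assert (Ht1 : t1 <= 0) by (apply Httneg, Hrho).
  assert (Hr1 : rad t1 <= rho). { unfold t1. destruct (Rlt_dec rho r); [right; apply Htt1; lra|rewrite Htt2; lra]. }
  assert (Hlow : rad (t1 - d) < rho) by (specialize (Hmono (t1 - d) t1 ltac:(lra)); lra).
  (* If [t1 + d] is positive, the upper bound is automatic because [tt] is never positive; this
     covers radii from [r] on. Otherwise [rho < r] and monotonicity of the radius gives it. *)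
  assert (Hup : exists e2, 0 < e2 /\ forall rho', 0 < rho' < rho + e2 -> tt rho' < t1 + d).
  { destruct (Rlt_dec 0 (t1 + d)) as [Hpos|Hnpos].
    - exists 1. split; [lra|]. intros rho' Hrho'. specialize (Httneg rho' ltac:(lra)). lra.
    - assert (Hlt : rho < r). { apply Rnot_le_lt. intros Hle. unfold t1 in Hnpos. rewrite Htt2 in Hnpos; lra. }
      destruct (Htt1 rho ltac:(lra)) as [_ H4]. fold t1 in H4.
      assert (H5 := Hmono t1 (t1 + d) ltac:(lra)). assert (H6 := Hradpos (t1 + d) ltac:(lra)).
      exists (rad (t1 + d) - rho). split; [lra|]. intros rho' Hrho'.
      destruct (Htt1 rho' ltac:(lra)) as [H7 H8]. apply Hmono'; lra. }
  destruct Hup as [e2 [He2 Hup]].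
  assert (Hrl := Hradpos (t1 - d) ltac:(lra)).
  exists (Rmin (rho - rad (t1 - d)) e2). split; [apply Rmin_pos; lra|]. intros s Hs.
  assert (H1 := Rlt_le_trans _ _ _ Hs (Rmin_l _ _)). assert (H2 := Rlt_le_trans _ _ _ Hs (Rmin_r _ _)).
  apply Rabs_def2 in H1, H2.
  assert (H3 : tt s < t1 + d) by (apply Hup; lra).
  assert (H4 : t1 - d < tt s).
  { destruct (Rlt_dec s r) as [Hsr|Hsr]; [|rewrite Htt2; lra].
    destruct (Htt1 s ltac:(lra)) as [H7 H8]. apply Hmono'; lra. }
  apply Rabs_def1; lra. }
exists (fun rho => phi (tt rho)). constructor.
- intros rho Hrho. apply (continuous_comp tt phi); [apply Httc, Hrho|]. apply Hphi, HI, Httneg, Hrho.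
- intros rho Hrho. rewrite Htt2 by exact Hrho. exact Hphi0.
- intros rho Hrho. destruct (Htt1 rho Hrho) as [H1 H2]. split; [apply Hzone, H1|].
  destruct (Hphi (tt rho) (HI _ H1)) as [_ H3]. fold (rad (tt rho)) in H3. rewrite H2 in H3.
  apply radial_angle_sign; [lra|]. rewrite <- H3.
  assert (Htn : tt rho < 0). { destruct H1 as [H1|H1]; [exact H1|]. rewrite H1 in H2. lra. }
  destruct (Hout (tt rho) ltac:(lra)) as (_ & H4 & _). fold N in H4. lra.
- intros t Ht. split; [apply HI, Ht|]. split; [apply Hradpos, Ht|]. fold (rad t). rewrite Httr by exact Ht. apply Hphi, HI, Ht.
- exact Hmono.
- exact Honto.
- split; [exact Hbwd|]. apply (filterlim_C (Rbar_locally m_infty) _ (dirvec x a)). intros e He.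
  destruct (Hdir e He) as [M HM]. exists (Rmin M 0). intros t Ht.
  assert (HtM := Rlt_le_trans _ _ _ Ht (Rmin_l _ _)). assert (Ht0 := Rlt_le_trans _ _ _ Ht (Rmin_r _ _)).
  destruct (Hphi t (HI t ltac:(lra))) as [_ Hxt]. assert (Hrt := Hradpos t ltac:(lra)). unfold rad in Hrt.
  assert (Hdv : dirvec x a t = unit_dir (phi t)).
  { unfold dirvec. rewrite Hxt at 2. rewrite Pol_sub, Cmult_assoc, <- RtoC_mult, Rinv_l by lra. ring. }
  rewrite Hdv. eapply Rle_lt_trans; [apply Cmod_unit_dir_lipschitz|].
  specialize (HM t HtM). unfold Y in HM.
  replace (phi t - - alpha / INR n) with ((INR n * phi t + alpha) / INR n) by (field; lra).
  unfold Rdiv. rewrite Rabs_mult, (Rabs_right (/ INR n)).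
  2: { apply Rle_ge. left. apply Rinv_0_lt_compat. lra. }
  assert (/ INR n <= 1). { rewrite <- Rinv_1. apply Rinv_le_contravar; lra. }
  assert (0 < / INR n) by (apply Rinv_0_lt_compat; lra).
  assert (Hab := Rabs_pos (INR n * phi t + alpha)). nra.
Qed.
End Angular.
Arguments tangency_exists {O F F' a n c0 r0}.
Arguments angle_near_cos {O F F' a n c0 r0}.
Arguments angle_lift {O F F' a n c0 r0}.
Arguments INR_n_ge_1 {O F F' a n c0 r0}.
Arguments radial_angle_sign {O F F' a n c0 r0 alpha}.
Arguments outgoing_branch {O F F' a n c0 r0 alpha}.
Arguments br_cont {F a n c0 alpha I x r phi0 f} _.
Arguments br_end {F a n c0 alpha I x r phi0 f} _.
Arguments br_zone {F a n c0 alpha I x r phi0 f} _.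
Arguments br_orbit {F a n c0 alpha I x r phi0 f} _.
Arguments br_mono {F a n c0 alpha I x r phi0 f} _.
Arguments br_onto {F a n c0 alpha I x r phi0 f} _.
Arguments br_dir {F a n c0 alpha I x r phi0 f} _.

(** * Characteristic orbits that do not return *)

Lemma continuous_bounded_max (f : R -> R) (a b : R) : a <= b -> (forall t, a <= t <= b -> continuous f t) ->
  exists m, a <= m <= b /\ forall t, a <= t <= b -> f t <= f m.
Proof.
intros Hab Hc. destruct (continuity_ab_maj f a b Hab) as (m & Hm1 & Hm2).
- intros t Ht. apply continuity_pt_filterlim, Hc, Ht.
- exists m. split; [exact Hm2|exact Hm1].
Qed.

Section Escape.
Context (O : C -> Prop) (F F' : C -> C) (a : C) (n : nat) (c0 : C) (r0 : R).
Context (LF : local_form O F F' a n c0 r0).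
Let N := radial F a n c0.

Lemma Cmod_pos_neq z : 0 < Cmod (z - a) -> z <> a.
Proof. intros H ->. rewrite Cmod_sub_diag in H. lra. Qed.

(** [N] stays negative for a short time. Seen from a slightly later point the past lies strictly
    closer to [a], and the starting point belongs to that past. *)
Lemma outward_leaves I x : max_solution O F I x -> 0 < Cmod (x 0 - a) < r0 -> N (x 0) < 0 ->
  exists e, 0 < e /\ forall t, 0 < t < e -> I t /\ Cmod (x 0 - a) < Cmod (x t - a) < r0.
Proof.
intros Hx H0 HN.
assert (HI0 := max_solution_0 O F I x Hx).
destruct (time_interval_segment I 0 (proj1 Hx) HI0) as (t1 & t2 & Ht12 & _ & HI).
assert (Hne := max_never_a LF I x Hx (Cmod_pos_neq _ (proj1 H0))).
assert (HNc : continuous (fun t => N (x t)) 0).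
{ apply (ex_derive_continuous (V := R_NormedModule)). eexists.
  apply (is_derive_radial LF); [apply (proj1 (proj2 Hx)), HI0|apply Hne, HI0]. }
destruct (continuous_nbhd_lt _ 0 0 HNc HN) as [d1 [Hd1 H1]].
destruct (continuous_nbhd_lt _ 0 r0 (continuous_Cmod_sub x a 0 (max_continuous O F I x 0 Hx HI0)) (proj2 H0)) as [d2 [Hd2 H2]].
exists (Rmin t2 (Rmin d1 d2)). split; [repeat apply Rmin_pos; lra|]. intros t Ht.
assert (H3 := Rmin_l t2 (Rmin d1 d2)). assert (H4 := Rmin_r t2 (Rmin d1 d2)).
assert (H5 := Rmin_l d1 d2). assert (H6 := Rmin_r d1 d2).
assert (HIt : I t) by (apply HI; lra). split; [exact HIt|].
assert (Hlt : Cmod (x t - a) < r0) by (apply H2; rewrite Rabs_right; lra). split; [|exact Hlt].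
assert (HNt : N (x t) < 0) by (apply H1; rewrite Rabs_right; lra).
destruct (outward_tends LF _ _ (max_shift O F I x t Hx HIt)) as [_ Hout]; cbv beta in *; rewrite ?Rplus_0_l in *.
- split; [apply Cmod_sub_pos, Hne, HIt|exact Hlt].
- left; exact HNt.
- destruct (Hout (- t) ltac:(lra)) as [H7 _]. rewrite Rplus_opp_l in H7. apply H7.
Qed.

Lemma tends_fwd_settles I x r : max_solution O F I x -> x 0 <> a -> 0 < r < r0 -> tends_fwd I x a ->
  exists T, 0 <= T /\ (forall t, T <= t -> 0 < Cmod (x t - a) < r) /\ 0 < N (x T).
Proof.
intros Hx H0 Hr Ht. apply tends_fwd_eps in Ht. destruct Ht as [HI Hl].
assert (Hne := max_never_a LF I x Hx H0).
destruct (Hl r (proj1 Hr)) as [M HM]. set (T0 := Rmax M 0 + 1).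
assert (HT0 : M < T0 /\ 0 < T0) by (assert (H1 := Rmax_l M 0); assert (H2 := Rmax_r M 0); unfold T0; lra).
(* A waiting time long enough for growth at rate 1/2 to raise [N] to at least 1, whatever its value
   at [T0]. *)
set (T := T0 + 2 * (1 + Rabs (N (x T0)))).
assert (Hab := Rabs_pos (N (x T0))). assert (Hle := Rle_abs (- N (x T0))). rewrite Rabs_Ropp in Hle.
exists T. split; [unfold T; lra|].
assert (Hin : forall t, T0 <= t -> 0 < Cmod (x t - a) < r).
{ intros t Htt. split; [apply Cmod_sub_pos, Hne, HI; lra|apply HM; lra]. }
split; [intros t Htt; apply Hin; unfold T in Htt; lra|].
assert (Hg := radial_growth LF x T0 T ltac:(unfold T; lra)). fold N in Hg.
enough (N (x T0) + (T - T0) / 2 <= N (x T)) by (unfold T in *; lra).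
apply Hg. intros t Htt. split; [apply (proj1 (proj2 Hx)), HI; lra|]. specialize (Hin t (proj1 Htt)). lra.
Qed.
End Escape.
Arguments outward_leaves {O F F' a n c0 r0}.
Arguments tends_fwd_settles {O F F' a n c0 r0}.

Lemma angle_fun_opp F a (n : nat) (c0 : C) (r0 : R) O F' alpha rho phi : local_form O F F' a n c0 r0 -> 0 < rho ->
  angle_fun (vopp F) a n (- c0) (alpha + PI) rho phi = - angle_fun F a n c0 alpha rho phi.
Proof.
intros LF Hr. unfold angle_fun.
assert (Hw : (Pol a rho phi - a)%C <> 0) by (apply Cmod_gt_0; rewrite Pol_radius; lra).
assert (Hc := lf_c0 LF). assert (Hwn := Cpow_nz _ (S n) Hw).
assert (HG : Gfac (vopp F) a n (- c0) (Pol a rho phi) = Gfac F a n c0 (Pol a rho phi)).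
{ unfold Gfac, vopp. field. auto. }
rewrite HG. replace (INR n * phi + (alpha + PI)) with (INR n * phi + alpha + PI) by ring.
unfold unit_dir at 1. rewrite neg_cos, neg_sin. simpl. ring.
Qed.

Lemma opp_polar (c0 : C) alpha : c0 = (RtoC (Cmod c0) * unit_dir alpha)%C -> (- c0)%C = (RtoC (Cmod (- c0)) * unit_dir (alpha + PI))%C.
Proof.
intros H. rewrite Cmod_opp. rewrite H at 1. unfold unit_dir at 2. rewrite neg_cos, neg_sin.
apply injective_projections; simpl; ring.
Qed.

Section NonHomoclinic.
Context (O : C -> Prop) (F F' : C -> C) (a : C) (n : nat) (c0 : C) (r0 alpha r : R).
Context (LF : local_form O F F' a n c0 r0).
Context (Hal : c0 = (RtoC (Cmod c0) * unit_dir alpha)%C).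
Context (Hr : 0 < r < r0).
Let HL : loc_lip O F := lf_lip LF.
Let N := radial F a n c0.
Let H := angle_fun F a n c0 alpha.
Let Y (phi : R) := INR n * phi + alpha.
Let p (phi : R) := Pol a r phi.
Let X (phi : R) := flow O F (p phi).
Let J (phi : R) := reachable O F (p phi).

Lemma circle_max phi : max_solution O F (J phi) (X phi) /\ X phi 0 = p phi.
Proof.
apply (flow_max O F HL). apply (lf_ball LF). unfold p. rewrite Pol_radius; lra.
Qed.

Lemma circle_radius phi : Cmod (X phi 0 - a) = r.
Proof. rewrite (proj2 (circle_max phi)). unfold p. apply Pol_radius; lra. Qed.

Lemma circle_neq_a phi : X phi 0 <> a.
Proof. apply Cmod_pos_neq. rewrite circle_radius. lra. Qed.

(** A relation, because the maximal distance is known to exist only when the orbit returns to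
    [a]. *)
Definition excursion (phi v : R) : Prop :=
  (exists t, 0 <= t /\ Cmod (X phi t - a) = v) /\ forall t, 0 <= t -> Cmod (X phi t - a) <= v.

Lemma excursion_exists phi : tends_fwd (J phi) (X phi) a -> exists v, r <= v /\ excursion phi v.
Proof.
intros Ht. destruct (circle_max phi) as [Hm H0].
destruct (tends_fwd_settles LF _ _ r Hm (circle_neq_a phi) Hr Ht) as (T & HT & Hin & _).
destruct (continuous_bounded_max (fun t => Cmod (X phi t - a)) 0 T HT) as (tm & Htm & Hmax).
{ intros t Htt. apply continuous_Cmod_sub, (max_continuous O F (J phi) (X phi) t Hm). apply Ht, Htt. }
assert (Hr' := circle_radius phi). assert (H1 := Hmax 0 ltac:(lra)).
exists (Cmod (X phi tm - a)). split; [lra|]. split; [exists tm; split; [lra|reflexivity]|].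
intros t Htt. destruct (Rle_dec t T) as [Hle|Hle]; [apply Hmax; lra|]. specialize (Hin t ltac:(lra)). lra.
Qed.

Lemma circle_dependence phi T eta : 0 <= T -> J phi T -> 0 < eta -> exists d, 0 < d /\
  forall phi', Rabs (phi' - phi) < d -> forall t, 0 <= t <= T -> J phi' t /\ Cmod (X phi' t - X phi t) < eta.
Proof.
intros HT HJ Heta. destruct (circle_max phi) as [Hm H0].
destruct (continuous_dependence O F HL _ _ T Hm HT HJ eta Heta) as [d [Hd Hdep]].
exists (d / r). split; [apply Rdiv_lt_0_compat; lra|]. intros phi' Hphi'.
destruct (circle_max phi') as [Hm' H0']. apply (Hdep _ _ Hm').
rewrite H0, H0'. unfold p, Pol. replace (a + r * unit_dir phi' - (a + r * unit_dir phi))%C with (RtoC r * (unit_dir phi' - unit_dir phi))%C by ring.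
rewrite Cmod_mult, Cmod_R, Rabs_right by lra. assert (H1 := Cmod_unit_dir_lipschitz phi' phi).
apply Rmult_lt_compat_r with (r := r) in Hphi'; [|lra]. replace (d / r * r) with d in Hphi' by (field; lra). nra.
Qed.

(** Continuous dependence covers only bounded times. The tail of a neighbouring orbit is controlled
    because at time [T2] it is in the disc of radius [r] and moving inwards, so later distances
    remain below [r] and do not count. *)
Lemma excursion_continuous phi v eta : tends_fwd (J phi) (X phi) a -> excursion phi v -> r <= v -> 0 < eta -> exists d, 0 < d /\
  forall phi' v', Rabs (phi' - phi) < d -> excursion phi' v' -> r <= v' -> Rabs (v' - v) < eta.
Proof.
intros Ht [[tv [Htv Hv]] Hvmax] Hrv Heta. destruct (circle_max phi) as [Hm H0].
destruct (tends_fwd_settles LF _ _ r Hm (circle_neq_a phi) Hr Ht) as (T & HT & Hin & HN).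
assert (HJ : forall t, 0 <= t -> J phi t) by apply Ht.
destruct (inward_tends LF _ _ (max_shift O F _ _ T Hm (HJ T HT))) as [_ Hdec]; cbv beta in *; rewrite ?Rplus_0_l in *.
{ specialize (Hin T (Rle_refl _)). lra. } { left; exact HN. }
destruct (Hdec 1 ltac:(lra)) as [[_ Hdec1] _]. clear Hdec.
(* The drop of the radius between [T] and [T2]. Errors below [g / 2] preserve a drop for the
   neighbouring orbit. *)
set (g := Cmod (X phi T - a) - Cmod (X phi (1 + T) - a)).
set (T2 := 1 + T). fold T2 in Hdec1, g.
assert (HinT2 := Hin T2 ltac:(unfold T2; lra)).
set (e := Rmin (eta / 2) (Rmin (g / 2) (r - Cmod (X phi T2 - a)))).
assert (He : 0 < e) by (unfold e, g; repeat apply Rmin_pos; lra).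
assert (He1 : e <= eta / 2) by apply Rmin_l.
assert (He2 : e <= g / 2) by (eapply Rle_trans; [apply Rmin_r|apply Rmin_l]).
assert (He3 : e <= r - Cmod (X phi T2 - a)) by (eapply Rle_trans; [apply Rmin_r|apply Rmin_r]).
destruct (circle_dependence phi T2 e ltac:(unfold T2; lra) (HJ T2 ltac:(unfold T2; lra)) He) as [d [Hd Hdep]].
exists d. split; [exact Hd|]. intros phi' v' Hphi' [[tv' [Htv' Hv']] Hvmax'] Hrv'.
specialize (Hdep phi' Hphi'). destruct (circle_max phi') as [Hm' H0'].
assert (Hclose : forall t, 0 <= t <= T2 -> Cmod (X phi t - a) - e < Cmod (X phi' t - a) < Cmod (X phi t - a) + e).
{ intros t Htt. destruct (Hdep t Htt) as [_ Hd'].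
  assert (H1 := Cmod_minus_triangle (X phi' t) (X phi t) a). assert (H2 := Cmod_minus_triangle (X phi t) (X phi' t) a).
  rewrite (Cmod_minus_sym (X phi t) (X phi' t)) in H2. lra. }
assert (HT2pos : 0 < T2) by (unfold T2; lra).
assert (HJ2 : J phi' T2) by (apply Hdep; lra).
assert (Hpos' : 0 < Cmod (X phi' T2 - a)).
{ apply Cmod_sub_pos, (max_never_a LF _ _ Hm' (circle_neq_a phi')), HJ2. }
assert (Hc2 := Hclose T2 ltac:(lra)). assert (HcT := Hclose T ltac:(unfold T2; lra)).
assert (Htail : forall t, T2 <= t -> Cmod (X phi' t - a) < r).
{ intros t Htt.
  (* An orbit with [N] negative at [T2] would have had a smaller radius at [T], contrary to the
     preserved drop. *)
  assert (HN' : 0 <= N (X phi' T2)).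
  { apply Rnot_lt_le. intros HN'.
    destruct (outward_tends LF _ _ (max_shift O F _ _ T2 Hm' HJ2)) as [_ Hout]; cbv beta in *; rewrite ?Rplus_0_l in *.
    - lra.
    - left; exact HN'.
    - destruct (Hout (-1) ltac:(lra)) as [H1 _]. replace (-1 + T2) with T in H1 by (unfold T2; ring). unfold g in He2. lra. }
  destruct (inward_tends LF _ _ (max_shift O F _ _ T2 Hm' HJ2)) as [_ Hdec']; cbv beta in *; rewrite ?Rplus_0_l in *; [lra|exact HN'|].
  destruct Htt as [Htt|<-]; [|lra]. destruct (Hdec' (t - T2) ltac:(lra)) as [H1 _]. replace (t - T2 + T2) with t in H1 by ring. lra. }
assert (H1 : v' < v + eta).
{ rewrite <- Hv'. destruct (Rle_dec tv' T2) as [Hle|Hle].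
  - assert (H1 := Hclose tv' ltac:(lra)). assert (H2 := Hvmax tv' Htv'). lra.
  - assert (H1 := Htail tv' ltac:(lra)). lra. }
assert (H2 : v < v' + eta).
{ rewrite <- Hv. destruct (Rle_dec tv T2) as [Hle|Hle].
  - assert (H2 := Hclose tv ltac:(lra)). assert (H3 := Hvmax' tv Htv). lra.
  - assert (H2 := Hin tv ltac:(unfold T2 in *; lra)). lra. }
apply Rabs_def1; lra.
Qed.

(* A point beyond the farthest excursion flows back to the circle next to the orbit realising that excursion. *)
Lemma excursion_can_be_exceeded phi v d0 : excursion phi v -> r < v -> 0 < H r phi -> 0 < d0 ->
  (forall t, 0 <= t -> J phi t) ->
  exists phi' t, Rabs (phi' - phi) < d0 /\ 0 <= t /\ v < Cmod (X phi' t - a).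
Proof.
intros [[ts [Hts Hv]] Hvmax] Hrv HH Hd0 HJ. destruct (circle_max phi) as [Hm H0].
assert (Hp : p phi = Pol a r phi) by reflexivity.
assert (HN0 : N (X phi 0) < 0) by (rewrite H0, Hp; apply (radial_angle_sign LF Hal); [lra|exact HH]).
assert (Hrad0 := circle_radius phi).
assert (Hts0 : 0 < ts). { destruct Hts as [Hts|<-]; [exact Hts|]. lra. }
destruct (Pol_near a r phi d0 ltac:(lra) Hd0) as [dn [Hdn Hnear]].
assert (HI0 := max_solution_0 O F _ _ Hm).
destruct (proj1 (continuous_C _ _) (max_continuous O F _ _ 0 Hm HI0) (dn / 2)) as [dc [Hdc Hcont]]; [lra|].
destruct (outward_leaves LF _ _ Hm ltac:(lra) HN0) as (el & Hel & Hleave).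
destruct (outward_tends LF _ _ Hm ltac:(lra) (Rlt_le _ _ HN0)) as [[HJneg _] Hback].
(* At times [- tau] and [tau] the reference orbit is strictly inside and outside the circle, so an
   orbit close to it crosses in between. The bound by [dc / 2] keeps this crossing near [p phi]. *)
set (tau := Rmin (ts / 2) (Rmin (dc / 2) (el / 2))).
assert (Htau : 0 < tau) by (unfold tau; repeat apply Rmin_pos; lra).
assert (Ht1 : tau <= ts / 2) by apply Rmin_l.
assert (Ht2 : tau <= dc / 2) by (eapply Rle_trans; [apply Rmin_r|apply Rmin_l]).
assert (Ht3 : tau <= el / 2) by (eapply Rle_trans; [apply Rmin_r|apply Rmin_r]).
destruct (Hleave tau ltac:(lra)) as [_ [Hup _]]. destruct (Hback (- tau) ltac:(lra)) as [[_ Hdown] _].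
rewrite Hrad0 in Hup, Hdown.
assert (Hrev := max_reflect O F _ _ (max_shift O F _ _ ts Hm (HJ ts Hts))). cbv beta in Hrev.
set (eta := Rmin (dn / 2) (Rmin (Cmod (X phi tau - a) - r) (r - Cmod (X phi (- tau) - a)))).
assert (Heta : 0 < eta) by (unfold eta; repeat apply Rmin_pos; lra).
assert (Hn1 : eta <= dn / 2) by apply Rmin_l.
assert (Hn2 : eta <= Cmod (X phi tau - a) - r) by (eapply Rle_trans; [apply Rmin_r|apply Rmin_l]).
assert (Hn3 : eta <= r - Cmod (X phi (- tau) - a)) by (eapply Rle_trans; [apply Rmin_r|apply Rmin_r]).
destruct (continuous_dependence O (vopp F) (loc_lip_opp _ _ HL) _ _ (ts + tau) Hrev) with (eta := eta) as [de [Hde Hdep]].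
{ lra. } { replace (- (ts + tau) + ts) with (- tau) by ring. apply HJneg; lra. } { exact Heta. }
cbv beta in Hdep. rewrite Ropp_0, Rplus_0_l in Hdep.
set (zs := X phi ts) in *.
assert (HOz : O zs) by (apply (proj1 (proj2 Hm)), HJ, Hts).
destruct (HL zs HOz) as (rho & Ll & Hrho & _ & Hball).
(* The farthest point is pushed radially outwards by half of [Rmin rho de]: it stays in [O] and
   within reach of continuous dependence for the reversed flow. *)
set (s := Rmin rho de / (2 * v)).
assert (Hmin := Rmin_pos rho de Hrho Hde). assert (Hm1 := Rmin_l rho de). assert (Hm2 := Rmin_r rho de).
assert (Hs : 0 < s) by (apply Rdiv_lt_0_compat; lra).
set (z := (zs + RtoC s * (zs - a))%C).
assert (Hzd : Cmod (z - zs) = Rmin rho de / 2).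
{ unfold z. replace (zs + s * (zs - a) - zs)%C with (RtoC s * (zs - a))%C by ring.
  rewrite Cmod_mult, Cmod_R, Rabs_right, Hv by lra. unfold s. field. lra. }
assert (Hza : v < Cmod (z - a)).
{ unfold z. replace (zs + s * (zs - a) - a)%C with (RtoC (1 + s) * (zs - a))%C by (rewrite RtoC_plus; ring).
  rewrite Cmod_mult, Cmod_R, Rabs_right, Hv by lra. nra. }
assert (HOz' : O z) by (apply (Hball z z); lra).
destruct (max_exists O F HL z HOz') as (K & y & Hy & Hy0).
specialize (Hdep _ _ (max_reflect O F K y Hy)). cbv beta in Hdep. rewrite Ropp_0, Hy0 in Hdep.
specialize (Hdep ltac:(lra)).
assert (HK : forall u, - (ts + tau) <= u <= 0 -> K u /\ Cmod (y u - X phi (u + ts)) < eta).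
{ intros u Hu. destruct (Hdep (- u) ltac:(lra)) as [H1 H2]. rewrite Ropp_involutive in H1, H2. auto. }
destruct (ivt_zero (fun u => Cmod (y u - a) - r) (- (ts + tau)) (- (ts - tau))) as (u & Hu & Hur).
- lra.
- intros u Hu. apply (continuous_minus (V := R_NormedModule)); [|apply continuous_const].
  apply continuous_Cmod_sub, (max_continuous O F K y u Hy), HK. lra.
- destruct (HK (- (ts + tau)) ltac:(lra)) as [_ H1]. replace (- (ts + tau) + ts) with (- tau) in H1 by ring.
  assert (H2 := Cmod_minus_triangle (y (- (ts + tau))) (X phi (- tau)) a). lra.
- destruct (HK (- (ts - tau)) ltac:(lra)) as [_ H1]. replace (- (ts - tau) + ts) with tau in H1 by ring.
  assert (H2 := Cmod_minus_triangle (X phi tau) (y (- (ts - tau))) a). rewrite (Cmod_minus_sym (X phi tau) (y (- (ts - tau)))) in H2. lra.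
- destruct (HK u ltac:(lra)) as [HKu H1].
  assert (H2 := Hcont (u + ts) ltac:(apply Rabs_def1; lra)).
  assert (H3 := Cmod_minus_triangle (y u) (X phi (u + ts)) (X phi 0)).
  destruct (Hnear (y u)) as (phi' & Hphi' & Hyu). { rewrite <- Hp, <- H0. lra. }
  replace (Cmod (y u - a)) with r in Hyu by lra.
  exists phi', (- u). split; [exact Hphi'|]. split; [lra|].
  destruct (circle_max phi') as [Hm' H0'].
  assert (Hsh := max_shift O F K y u Hy HKu).
  destruct (max_unique O F HL _ _ _ _ Hsh Hm') with (t := - u) as [_ He].
  + rewrite Rplus_0_l, H0'. exact Hyu.
  + rewrite Rplus_opp_l in He. rewrite <- He, Hy0; [exact Hza|]. exact (max_solution_0 O F K y Hy).
Qed.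

(* If every orbit leaving the disc between two consecutive tangencies returned to [a], one of them would go farthest out, and it could be exceeded. *)
Theorem nonhomoclinic_exists : exists phi, Rabs (Y phi) < 3 * PI / 4 /\ 0 < H r phi /\
  exists I x, max_solution O F I x /\ x 0 = Pol a r phi /\ ~ tends_fwd I x a.
Proof.
apply NNPP. intros Hno.
assert (Hn1 := INR_n_ge_1 LF). assert (Hp := PI_RGT_0).
assert (Hall : forall phi, Rabs (Y phi) < 3 * PI / 4 -> 0 < H r phi -> tends_fwd (J phi) (X phi) a).
{ intros phi H1 H2. apply NNPP. intros H3. apply Hno. exists phi. split; [exact H1|]. split; [exact H2|].
  exists (J phi), (X phi). destruct (circle_max phi). auto. }
destruct (tangency_exists alpha LF r ltac:(lra)) as (phi2 & HY2 & HH2 & Hlt2 & _). fold H in HH2, Hlt2.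
(* The tangency of the reversed field supplies the left end of the outgoing arc, with [Y] between -3
   pi/4 and -pi/4. *)
destruct (tangency_exists (alpha + PI) (local_form_opp LF) r ltac:(lra)) as (phi1 & HY1 & HH1 & _ & Hgt1).
rewrite (angle_fun_opp _ _ _ _ _ _ _ _ _ _ LF) in HH1 by lra. fold H in HH1.
assert (Hgt1' : forall phi, phi1 < phi -> Y phi <= PI / 4 -> 0 < H r phi).
{ intros phi H1 H2. specialize (Hgt1 phi H1). rewrite (angle_fun_opp _ _ _ _ _ _ _ _ _ _ LF) in Hgt1 by lra. fold H in Hgt1.
  unfold Y in H2. specialize (Hgt1 ltac:(lra)). lra. }
fold (Y phi2) in HY2. assert (HY1' : - (3 * PI / 4) < Y phi1 < - (PI / 4)) by (unfold Y; lra).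
assert (H12 : phi1 < phi2) by (unfold Y in *; nra).
assert (Hmid : forall phi, phi1 < phi < phi2 -> Rabs (Y phi) < 3 * PI / 4 /\ 0 < H r phi).
{ intros phi Hphi. assert (Y phi1 < Y phi < Y phi2) by (unfold Y; nra). split; [apply Rabs_def1; lra|].
  destruct (Rle_dec (Y phi) (PI / 4)) as [Hle|Hle]; [apply Hgt1'; lra|]. apply Hlt2; [unfold Y in *; lra|lra]. }
assert (Hends : forall phi, phi = phi1 \/ phi = phi2 -> tends_fwd (J phi) (X phi) a /\ forall t, 0 <= t -> Cmod (X phi t - a) <= r).
{ intros phi Hphi. assert (HH : H r phi = 0) by (destruct Hphi; subst; lra).
  destruct (circle_max phi) as [Hm H0]. assert (Hrad := circle_radius phi).
  destruct (inward_tends LF _ _ Hm) as [H1 H2]; [lra| |].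
  - rewrite H0. right. symmetry. apply (radial_angle_sign LF Hal); [lra|exact HH].
  - split; [exact H1|]. intros t [Ht|<-]; [|lra]. destruct (H2 t Ht) as [H3 _]. lra. }
assert (Htends : forall phi, phi1 <= phi <= phi2 -> tends_fwd (J phi) (X phi) a).
{ intros phi Hphi. destruct (Req_dec phi phi1); [apply Hends; auto|]. destruct (Req_dec phi phi2); [apply Hends; auto|].
  destruct (Hmid phi ltac:(lra)). apply Hall; assumption. }
set (m := fun phi => epsilon (inhabits 0) (fun v => r <= v /\ excursion phi v)).
assert (Hm : forall phi, phi1 <= phi <= phi2 -> r <= m phi /\ excursion phi (m phi)).
{ intros phi Hphi. unfold m. apply epsilon_spec. apply excursion_exists, Htends, Hphi. }
(* Clamping to the arc gives two-sided continuity at its ends, as the maximum principle on a segment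
   demands. *)
set (cl := fun phi => Rmax phi1 (Rmin phi phi2)).
assert (Hcl : forall phi, phi1 <= cl phi <= phi2).
{ intros phi. unfold cl. split; [apply Rmax_l|]. apply Rmax_lub; [lra|apply Rmin_r]. }
assert (Hcl1 : forall phi, phi1 <= phi <= phi2 -> cl phi = phi).
{ intros phi Hphi. unfold cl. rewrite Rmin_left, Rmax_right; lra. }
assert (Hclip : forall s t, Rabs (cl s - cl t) <= Rabs (s - t)).
{ intros s t. unfold cl, Rmax, Rmin. repeat destruct Rle_dec; unfold Rabs; repeat destruct Rcase_abs; lra. }
destruct (continuous_bounded_max (fun phi => m (cl phi)) phi1 phi2 (Rlt_le _ _ H12)) as (ps & Hps & Hmax).
{ intros phi _. apply continuous_R. intros e He. destruct (Hm (cl phi) (Hcl phi)) as [H1 H2].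
  destruct (excursion_continuous (cl phi) (m (cl phi)) e (Htends _ (Hcl phi)) H2 H1 He) as [d [Hd Hcont]].
  exists d. split; [exact Hd|]. intros s Hs. destruct (Hm (cl s) (Hcl s)) as [H3 H4].
  apply (Hcont (cl s)); auto. eapply Rle_lt_trans; [apply Hclip|exact Hs]. }
rewrite (Hcl1 ps Hps) in Hmax.
destruct (Hm ps Hps) as [Hmr Hmex].
(* The orbit leaving at [Y = 0] goes outside the circle, whereas those through the tangencies never
   do. The maximum is thus attained strictly between the tangencies. *)
assert (Hbig : r < m ps).
{ set (pc := - alpha / INR n). assert (HYc : Y pc = 0) by (unfold Y, pc; field; lra).
  assert (Hpc : phi1 < pc < phi2) by (unfold Y in *; split; nra).
  destruct (Hmid pc Hpc) as [_ HHc]. destruct (circle_max pc) as [Hmc H0c]. assert (Hradc := circle_radius pc).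
  destruct (outward_leaves LF _ _ Hmc) as (e & He & Hl); [lra| |].
  - rewrite H0c. apply (radial_angle_sign LF Hal); [lra|exact HHc].
  - destruct (Hl (e / 2) ltac:(lra)) as [_ [H1 _]]. rewrite Hradc in H1.
    destruct (Hm pc ltac:(lra)) as [_ [_ H2]]. specialize (H2 (e / 2) ltac:(lra)).
    specialize (Hmax pc ltac:(lra)). rewrite Hcl1 in Hmax by lra. lra. }
assert (Hint : phi1 < ps < phi2).
{ destruct (Req_dec ps phi1) as [He|He1]; [|destruct (Req_dec ps phi2) as [He|He2]; [|lra]]; exfalso;
  destruct Hmex as [[t [Ht Hv]] _]; destruct (Hends ps ltac:(auto)) as [_ H1]; specialize (H1 t Ht); lra. }
destruct (Hmid ps Hint) as [_ HHs].
destruct (excursion_can_be_exceeded ps (m ps) (Rmin (ps - phi1) (phi2 - ps)) Hmex Hbig HHs) as (phi' & t & Hphi' & Ht & Hlt).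
- apply Rmin_pos; lra.
- apply (Htends ps Hps).
- assert (H1 := Rlt_le_trans _ _ _ Hphi' (Rmin_l _ _)). assert (H2 := Rlt_le_trans _ _ _ Hphi' (Rmin_r _ _)).
  apply Rabs_def2 in H1, H2.
  destruct (Hm phi' ltac:(lra)) as [_ [_ H3]]. specialize (H3 t Ht).
  specialize (Hmax phi' ltac:(lra)). rewrite Hcl1 in Hmax by lra. lra.
Qed.
End NonHomoclinic.
Arguments nonhomoclinic_exists {O F F' a n c0 r0 alpha r}.

(** * Lines bounding the sectors *)

Lemma angle_fun_shift F a n c0 alpha rho phi : angle_fun F a n c0 (alpha - 2 * PI) rho phi = angle_fun F a n c0 alpha rho phi.
Proof.
unfold angle_fun. replace (INR n * phi + (alpha - 2 * PI)) with (INR n * phi + alpha + 2 * PI * IZR (-1)) by (simpl; ring).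
rewrite unit_dir_period. reflexivity.
Qed.

(** Subtracting [PI] at each reversal gives [alpha - k * PI] after [k] of them, so that the ray Y =
    k pi becomes the ray 0. *)
Lemma angle_fun_opp_minus F a (n : nat) (c0 : C) (r0 : R) O F' alpha rho phi : local_form O F F' a n c0 r0 -> 0 < rho ->
  angle_fun (vopp F) a n (- c0) (alpha - PI) rho phi = - angle_fun F a n c0 alpha rho phi.
Proof.
intros LF Hr. rewrite <- (angle_fun_opp F a n c0 r0 O F' alpha rho phi LF Hr).
rewrite <- (angle_fun_shift _ _ _ _ (alpha + PI)). f_equal. ring.
Qed.

Record setup (O : C -> Prop) (F F' : C -> C) (a : C) (n : nat) (c0 : C) (r0 alpha r : R) : Prop := {
  st_lf : local_form O F F' a n c0 r0;
  st_pol : c0 = (RtoC (Cmod c0) * unit_dir alpha)%C;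
  st_r : 0 < r < r0 }.
Arguments st_lf {O F F' a n c0 r0 alpha r} _.
Arguments st_pol {O F F' a n c0 r0 alpha r} _.
Arguments st_r {O F F' a n c0 r0 alpha r} _.

Lemma setup_opp O F F' a n c0 r0 alpha r : setup O F F' a n c0 r0 alpha r ->
  setup O (vopp F) (vopp F') a n (- c0) r0 (alpha - PI) r.
Proof.
intros [H1 H2 H3]. constructor; [apply local_form_opp, H1| |exact H3].
rewrite (opp_polar c0 alpha H2) at 1. f_equal.
replace (alpha + PI) with (alpha - PI + 2 * PI * IZR 1) by ring. apply unit_dir_period.
Qed.
Arguments setup_opp {O F F' a n c0 r0 alpha r}.

(** The strict sign [ol_pos] makes the crossing transversal, and [ol_non] is what prevents a second
    meeting with the circle. *)
Record out_line (O : C -> Prop) (F : C -> C) (a : C) (n : nat) (c0 : C) (alpha r : R)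
  (I : R -> Prop) (x : R -> C) (phi : R) (f : R -> R) : Prop := {
  ol_max : max_solution O F I x;
  ol_x0 : x 0 = Pol a r phi;
  ol_zone : Rabs (INR n * phi + alpha) < 3 * PI / 4;
  ol_pos : 0 < angle_fun F a n c0 alpha r phi;
  ol_branch : branch F a n c0 alpha I x r phi f;
  ol_non : ~ tends_fwd I x a }.
Arguments ol_max {O F a n c0 alpha r I x phi f} _.
Arguments ol_x0 {O F a n c0 alpha r I x phi f} _.
Arguments ol_zone {O F a n c0 alpha r I x phi f} _.
Arguments ol_pos {O F a n c0 alpha r I x phi f} _.
Arguments ol_branch {O F a n c0 alpha r I x phi f} _.
Arguments ol_non {O F a n c0 alpha r I x phi f} _.

Section Outgoing.
Context (O : C -> Prop) (F F' : C -> C) (a : C) (n : nat) (c0 : C) (r0 alpha r : R).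
Context (St : setup O F F' a n c0 r0 alpha r).
Let LF := st_lf St.
Let Hal := st_pol St.
Let Hr := st_r St.
Let HL : loc_lip O F := lf_lip LF.
Let N := radial F a n c0.
Let H := angle_fun F a n c0 alpha.
Let Y (phi : R) := INR n * phi + alpha.

Lemma out_line_exists : exists I x phi f, out_line O F a n c0 alpha r I x phi f.
Proof.
destruct (nonhomoclinic_exists LF Hal Hr) as (phi & H1 & H2 & I & x & H3 & H4 & H5).
destruct (outgoing_branch LF Hal I x r phi H3 Hr H4 H1 (Rlt_le _ _ H2)) as [f Hf].
exists I, x, phi, f. constructor; assumption.
Qed.

Definition tangency (rho eta : R) : Prop := PI / 4 < Y eta < 3 * PI / 4 /\ H rho eta = 0 /\
  (forall phi, - (PI / 4) <= Y phi -> phi < eta -> 0 < H rho phi) /\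
  (forall phi, eta < phi -> Y phi <= 5 * PI / 4 -> H rho phi < 0).

Lemma tangency_ex rho : 0 < rho <= r0 -> exists eta, tangency rho eta.
Proof. exact (tangency_exists alpha LF rho). Qed.

Lemma n_ge_1 : 1 <= INR n.
Proof. exact (INR_n_ge_1 LF). Qed.

Lemma zone_below_tangency rho eta phi : tangency rho eta -> Rabs (Y phi) < 3 * PI / 4 -> 0 < H rho phi -> phi < eta.
Proof.
intros (H1 & H2 & H3 & H4) HY HH. assert (Hp := PI_RGT_0). apply Rabs_def2 in HY.
destruct (Rtotal_order phi eta) as [Hl|[He|Hg]]; [exact Hl|subst; lra|]. specialize (H4 phi Hg ltac:(lra)). lra.
Qed.

Lemma zone_above_tangency rho eta phi : tangency rho eta -> Rabs (Y phi - PI) < 3 * PI / 4 -> H rho phi < 0 -> eta < phi.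
Proof.
intros (H1 & H2 & H3 & H4) HY HH. assert (Hp := PI_RGT_0). apply Rabs_def2 in HY.
destruct (Rtotal_order phi eta) as [Hl|[He|Hg]]; [|subst; lra|exact Hg]. specialize (H3 phi ltac:(lra) Hl). lra.
Qed.

(** Above -pi/4 the tangency itself decides the sign. Below, the previous tangency [e'], obtained
    from the reversed field, lies before [phi1] because [H] is positive at [phi1], and hence before
    [phi]. *)
Lemma zone_up_to_tangency rho eta phi1 phi : 0 < rho <= r0 -> tangency rho eta ->
  Rabs (Y phi1) < 3 * PI / 4 -> 0 < H rho phi1 -> phi1 <= phi < eta -> 0 < H rho phi /\ Rabs (Y phi) < 3 * PI / 4.
Proof.
intros Hrho (H1 & H2 & H3 & H4) HY HH Hphi. assert (Hp := PI_RGT_0). assert (Hn := n_ge_1). apply Rabs_def2 in HY.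
assert (HYl : Y phi1 <= Y phi < Y eta) by (unfold Y; nra).
split; [|apply Rabs_def1; lra].
destruct (tangency_exists (alpha + PI) (local_form_opp LF) rho Hrho) as (e' & E1 & E2 & E3 & E4).
assert (Hopp : forall p, angle_fun (vopp F) a n (- c0) (alpha + PI) rho p = - H rho p) by (intros p; apply (angle_fun_opp _ _ _ _ _ _ _ _ _ _ LF); lra).
rewrite Hopp in E2.
destruct (Rle_dec (- (PI / 4)) (Y phi)) as [Hl|Hl]; [apply H3; lra|].
assert (e' < phi1).
{ destruct (Rtotal_order e' phi1) as [El|[Ee|Eg]]; [exact El|subst; lra|].
  specialize (E3 phi1). rewrite Hopp in E3. unfold Y in *. specialize (E3 ltac:(lra) Eg). lra. }
specialize (E4 phi ltac:(lra)). rewrite Hopp in E4. unfold Y in *. specialize (E4 ltac:(lra)). lra.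
Qed.

(** If the graphs met at some radius, the orbits would agree up to a time shift. A nonzero shift
    puts one of them at radius [r] before time 0, against strict monotonicity; a zero shift gives
    equal end points. *)
Lemma branches_disjoint I x phi f J y psi g : max_solution O F I x -> max_solution O F J y ->
  x 0 = Pol a r phi -> y 0 = Pol a r psi ->
  Rabs (Y phi) < 3 * PI / 4 -> Rabs (Y psi) < 3 * PI / 4 ->
  branch F a n c0 alpha I x r phi f -> branch F a n c0 alpha J y r psi g ->
  phi < psi -> forall rho, 0 < rho <= r -> f rho < g rho.
Proof.
intros Hx Hy Hx0 Hy0 HY1 HY2 Bf Bg Hlt rho Hrho. apply Rnot_le_lt. intros Hge.
assert (Hfr := br_end Bf r (Rle_refl _)). assert (Hgr := br_end Bg r (Rle_refl _)).
destruct (ivt_zero (fun s => g s - f s) rho r) as (q & Hq & He); try lra.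
{ intros s Hs. apply (continuous_minus (V := R_NormedModule)); [apply (br_cont Bg)|apply (br_cont Bf)]; lra. }
destruct (br_onto Bf q ltac:(lra)) as (t & Ht & Hxt).
destruct (br_onto Bg q ltac:(lra)) as (s & Hs & Hys).
destruct (br_orbit Bf t Ht) as (HIt & _ & Hpx). destruct (br_orbit Bg s Hs) as (HJs & _ & Hpy).
rewrite Hxt in Hpx. rewrite Hys in Hpy.
assert (Hxy : x t = y s) by (rewrite Hpx, Hpy; f_equal; lra).
assert (Hsx := max_shift O F I x t Hx HIt). assert (Hsy := max_shift O F J y s Hy HJs).
assert (Hu := fun u => max_unique O F HL _ _ _ _ Hsx Hsy ltac:(cbv beta; rewrite !Rplus_0_l; exact Hxy) u). cbv beta in Hu.
assert (Hradx : Cmod (x 0 - a) = r) by (rewrite Hx0, Pol_radius; lra).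
assert (Hrady : Cmod (y 0 - a) = r) by (rewrite Hy0, Pol_radius; lra).
assert (HI0 := max_solution_0 O F I x Hx). assert (HJ0 := max_solution_0 O F J y Hy).
destruct (Rtotal_order s t) as [Hst|[Hst|Hst]].
- destruct (Hu (- t)) as [_ H1]. rewrite Rplus_opp_l in H1. specialize (H1 HI0).
  assert (H2 := br_mono Bg (- t + s) 0 ltac:(lra)). rewrite <- H1 in H2. lra.
- subst s. destruct (Hu (- t)) as [_ H1]. rewrite Rplus_opp_l in H1. specialize (H1 HI0).
  rewrite Hx0, Hy0 in H1. assert (phi = psi); [|lra]. apply (Pol_angle_eq a r); [lra|exact H1|].
  assert (Hp := PI_RGT_0). assert (Hn := n_ge_1). apply Rabs_def2 in HY1, HY2. unfold Y in *. split; nra.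
- destruct (Hu (- s)) as [H0 H1]. rewrite Rplus_opp_l in H0, H1. specialize (H1 (proj2 H0 HJ0)).
  assert (H2 := br_mono Bf (- s + t) 0 ltac:(lra)). rewrite H1 in H2. lra.
Qed.

(** A later point in the closed disc is impossible: if it moves outwards, its past, including the
    crossing point, is strictly inside; if it moves inwards, the orbit tends to [a], against
    [ol_non]. *)
Lemma out_line_outside I x phi f : out_line O F a n c0 alpha r I x phi f ->
  forall t, I t -> 0 < t -> r < Cmod (x t - a).
Proof.
intros L t HIt Ht. assert (Hx := ol_max L).
assert (Hx0 := ol_x0 L).
assert (Hrad : Cmod (x 0 - a) = r) by (rewrite Hx0, Pol_radius; lra).
assert (Hpos : 0 < Cmod (x t - a)).
{ apply Cmod_sub_pos, (max_never_a LF I x Hx); [|exact HIt]. apply Cmod_pos_neq; lra. }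
apply Rnot_le_lt. intros Hle.
assert (Hs := max_shift O F I x t Hx HIt).
destruct (Rle_dec (N (x t)) 0) as [HN|HN].
- destruct (outward_tends LF _ _ Hs) as [_ Hout]; cbv beta in *; rewrite ?Rplus_0_l in *; [lra|exact HN|].
  destruct (Hout (- t) ltac:(lra)) as [H1 _]. rewrite Rplus_opp_l in H1. lra.
- destruct (inward_tends LF _ _ Hs) as [Hin _]; cbv beta in *; rewrite ?Rplus_0_l in *; [lra|apply Rlt_le, Rnot_le_lt, HN|].
  apply (ol_non L). apply (tends_fwd_shift I x a t (proj1 Hx) HIt), Hin.
Qed.

Lemma out_line_disc I x phi f : out_line O F a n c0 alpha r I x phi f ->
  forall z, (orbit I x z /\ Cmod (z - a) <= r) <-> exists rho, 0 < rho <= r /\ z = Pol a rho (f rho).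
Proof.
intros L z. assert (B := ol_branch L). split.
- intros [[t [HIt <-]] Hz]. destruct (Rle_dec t 0) as [Ht|Ht].
  + destruct (br_orbit B t Ht) as (_ & H1 & H2). exists (Cmod (x t - a)). split; [lra|exact H2].
  + assert (H1 := out_line_outside I x phi f L t HIt ltac:(lra)). lra.
- intros (rho & Hrho & ->). split; [|rewrite Pol_radius; lra].
  destruct (br_onto B rho Hrho) as (t & Ht & Hrt).
  destruct (br_orbit B t Ht) as (HIt & _ & H2). exists t. split; [exact HIt|].
  rewrite Hrt in H2. exact H2.
Qed.

(** The branch ending at the exit point contains the starting point, and branches keep the order of
    their ends. Inside a homoclinic loop this forces an exit beyond the tangency, where the circle
    is not crossed outwards. *)
Lemma exit_beyond_branch I x eta f J y rho phi : max_solution O F I x -> x 0 = Pol a r eta ->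
  Rabs (Y eta) < 3 * PI / 4 -> H r eta = 0 -> branch F a n c0 alpha I x r eta f ->
  max_solution O F J y -> 0 < rho < r -> y 0 = Pol a rho phi -> Rabs (Y phi) < 3 * PI / 4 -> ~ tends_fwd J y a ->
  exists psi, Rabs (Y psi) < 3 * PI / 4 /\ 0 < H r psi /\ (f rho < phi -> eta < psi) /\ (phi < f rho -> psi < eta).
Proof.
intros Hx Hx0 HYe HHe Bf Hy Hrho Hy0 HYphi Hnt.
assert (Hrad : Cmod (y 0 - a) = rho) by (rewrite Hy0, Pol_radius; lra).
destruct (exit_or_tends LF J y r Hy) as [Ht|(t1 & Ht1 & HJt1 & Hrt1 & HNt1)]; [lra|lra|contradiction|].
fold N in HNt1.
destruct (angle_lift alpha LF J y rho phi Hy (proj1 Hrho) Hy0) as (lift & Hl0 & Hlift).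
assert (Hs := max_shift O F J y t1 Hy HJt1).
assert (HJ0 := max_solution_0 O F J y Hy).
destruct (outward_tends LF _ _ Hs) as [_ Hout]; cbv beta in *; rewrite ?Rplus_0_l in *; [lra|left; exact HNt1|].
assert (HJ : forall t, 0 <= t <= t1 -> J t) by (intros t Ht; apply (time_interval_pos J t1 t (proj1 Hy) HJt1 Ht)).
assert (Hseg : forall t, 0 <= t <= t1 -> 0 < Cmod (y t - a) <= r /\ N (y t) < 0).
{ intros t Ht. destruct (Req_dec t t1) as [->|Hne]; [lra|].
  destruct (Hout (t - t1) ltac:(lra)) as (H1 & H2 & _). replace (t - t1 + t1) with t in * by ring. fold N in H2. lra. }
set (psi := lift t1).
assert (Hypsi : y t1 = Pol a r psi) by (rewrite <- Hrt1; apply Hlift, HJt1).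
assert (Hzone : forall t, 0 <= t <= t1 -> Rabs (Y (lift t)) < 3 * PI / 4).
{ intros t Ht. apply Rnot_le_lt. intros Hge.
  destruct (ivt_zero (fun s => Rabs (Y (lift s)) - 3 * PI / 4) 0 t) as (s & Hst & He).
  - lra.
  - intros s Hst. apply (continuous_minus (V := R_NormedModule)); [|apply continuous_const].
    apply (continuous_comp (fun s => Y (lift s)) Rabs); [|apply continuous_Rabs].
    apply (continuous_plus (V := R_NormedModule)); [|apply continuous_const].
    apply (continuous_mult (K := R_AbsRing)); [apply continuous_const|apply Hlift, HJ; lra].
  - rewrite Hl0. lra.
  - lra.
  - destruct (Hseg s ltac:(lra)) as [Hrs HNs]. destruct (Hlift s (HJ s ltac:(lra))) as [_ Hys].
    rewrite Hys in HNs. apply (radial_angle_sign LF Hal) in HNs; [|lra].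
    assert (H1 := angle_near_cos alpha LF (Cmod (y s - a)) (lift s) ltac:(lra)). apply Rabs_le_between in H1.
    assert (Hp := PI_RGT_0). assert (H2 := cos_three_quarters (Y (lift s)) ltac:(lra)). unfold Y in H2. lra. }
assert (HYpsi : Rabs (Y psi) < 3 * PI / 4) by (apply Hzone; lra).
assert (HHpsi : 0 < H r psi).
{ apply (radial_angle_sign LF Hal); [lra|]. rewrite <- Hypsi. exact HNt1. }
exists psi. split; [exact HYpsi|]. split; [exact HHpsi|].
destruct (outgoing_branch LF Hal _ _ r psi Hs Hr) as [g Bg].
{ cbv beta. rewrite Rplus_0_l. exact Hypsi. } { exact HYpsi. } { left; exact HHpsi. }
assert (Hgphi : g rho = phi).
{ destruct (br_orbit Bg (- t1) ltac:(lra)) as (_ & _ & H1). cbv beta in H1. rewrite Rplus_opp_l, Hrad, Hy0 in H1.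
  symmetry. apply (Pol_angle_eq a rho); [lra|exact H1|].
  destruct (br_zone Bg rho Hrho) as [H2 _].
  assert (Hp := PI_RGT_0). assert (Hn := n_ge_1). apply Rabs_def2 in H2, HYphi. unfold Y in *. split; nra. }
assert (Hne : psi <> eta) by (intros He; rewrite He in HHpsi; lra).
assert (Hs0 : (fun t => y (t + t1)) 0 = Pol a r psi) by (cbv beta; rewrite Rplus_0_l; exact Hypsi).
split; intros Hlt.
- destruct (Rtotal_order psi eta) as [Hl|[He|Hg]]; [|contradiction|exact Hg]. exfalso.
  assert (H1 := branches_disjoint _ _ _ _ _ _ _ _ Hs Hx Hs0 Hx0 HYpsi HYe Bg Bf Hl rho ltac:(lra)). lra.
- destruct (Rtotal_order psi eta) as [Hl|[He|Hg]]; [exact Hl|contradiction|]. exfalso.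
  assert (H1 := branches_disjoint _ _ _ _ _ _ _ _ Hx Hs Hx0 Hs0 HYe HYpsi Bf Bg Hg rho ltac:(lra)). lra.
Qed.

Lemma outward_crossing I x phi : max_solution O F I x -> x 0 = Pol a r phi -> 0 < H r phi ->
  tends_bwd I x a /\ (forall t, t < 0 -> Cmod (x t - a) < r) /\ exists e, 0 < e /\ forall t, 0 < t < e -> r < Cmod (x t - a).
Proof.
intros Hx Hx0 HH. assert (Hrad : Cmod (x 0 - a) = r) by (rewrite Hx0, Pol_radius; lra).
assert (HN : N (x 0) < 0) by (rewrite Hx0; apply (radial_angle_sign LF Hal); [lra|exact HH]).
destruct (outward_tends LF I x Hx ltac:(lra) (Rlt_le _ _ HN)) as [H1 H2].
split; [exact H1|]. split; [intros t Ht; destruct (H2 t Ht); lra|].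
destruct (outward_leaves LF I x Hx ltac:(lra) HN) as (e & He & Hl).
exists e. split; [exact He|]. intros t Ht. destruct (Hl t Ht). lra.
Qed.

Lemma tangent_branch eta : Rabs (Y eta) < 3 * PI / 4 -> H r eta = 0 -> forall I x, max_solution O F I x -> x 0 = Pol a r eta ->
  tends_bwd I x a /\ exists f, branch F a n c0 alpha I x r eta f.
Proof.
intros HY HH I x Hx Hx0. assert (Hrad : Cmod (x 0 - a) = r) by (rewrite Hx0, Pol_radius; lra). split.
- apply (outward_tends LF I x Hx ltac:(lra)). rewrite Hx0. right.
  apply (radial_angle_sign LF Hal); [lra|exact HH].
- apply (outgoing_branch LF Hal I x r eta Hx Hr Hx0 HY). fold H. lra.
Qed.
End Outgoing.
Arguments n_ge_1 {O F F' a n c0 r0 alpha r}.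
Arguments out_line_disc {O F F' a n c0 r0 alpha r}.
Arguments tangency_ex {O F F' a n c0 r0 alpha r}.
Arguments outward_crossing {O F F' a n c0 r0 alpha r}.
Arguments tangent_branch {O F F' a n c0 r0 alpha r}.
Arguments zone_up_to_tangency {O F F' a n c0 r0 alpha r}.
Arguments exit_beyond_branch {O F F' a n c0 r0 alpha r}.
Arguments out_line_exists {O F F' a n c0 r0 alpha r}.
Arguments branches_disjoint {O F F' a n c0 r0 alpha r}.

(** * Elliptic sectors *)

Definition circ (a : C) (r s : R) : C := Pol a r (2 * PI * s).

Lemma circ_div a r phi : circ a r (phi / (2 * PI)) = Pol a r phi.
Proof. unfold circ. f_equal. assert (Hp := PI_RGT_0). field. lra. Qed.

Lemma curve_circ a r z : 0 < r -> (curve (circ a r) z <-> Cmod (z - a) = r).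
Proof.
intros Hr. assert (Hp := PI_RGT_0). split.
- intros (s & _ & <-). unfold circ. apply Pol_radius. lra.
- intros Hz. destruct (Pol_exists a z 0) as (phi & Hphi & Hzp). exists (phi / (2 * PI)).
  split; [|rewrite circ_div; rewrite Hz in Hzp; auto].
  split; [apply Rdiv_le_0_compat; lra|apply Rle_div_l; lra].
Qed.

Lemma arc_circ a r u v z : arc (circ a r) u v z <-> exists phi, 2 * PI * u <= phi <= 2 * PI * v /\ z = Pol a r phi.
Proof.
assert (Hp := PI_RGT_0). split.
- intros (s & Hs & <-). exists (2 * PI * s). split; [nra|reflexivity].
- intros (phi & Hphi & ->). exists (phi / (2 * PI)). split; [|apply circ_div].
  split; [apply Rle_div_r; lra|apply Rle_div_l; lra].
Qed.

Lemma Int_set_circ a r z : 0 < r -> (Int_set (curve (circ a r)) z <-> Cmod (z - a) < r).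
Proof. intros Hr. apply Int_set_circle; [exact Hr|]. intros w. apply curve_circ, Hr. Qed.

Lemma is_derive_circ a r s : is_derive (circ a r) s (RtoC (2 * PI * r) * (Ci * unit_dir (2 * PI * s)))%C.
Proof.
unfold circ, Pol. eapply is_derive_eqC.
- apply is_derive_addC; [apply is_derive_constC|]. apply is_derive_mulC; [apply is_derive_constC|].
  apply (is_derive_unit_dir (fun s => 2 * PI * s) s (2 * PI)). auto_derive; [trivial|ring].
- cbv beta. rewrite (RtoC_mult (2 * PI) r). ring.
Qed.

Lemma smooth_circ a r s : smooth_at (circ a r) s.
Proof.
destruct (proj1 (is_derive_C_pair _ _ _) (is_derive_circ a r s)) as [H1 H2].
split; eexists; [exact H1|exact H2].
Qed.

Lemma dg_circ a r s : dg (circ a r) s = (RtoC (2 * PI * r) * (Ci * unit_dir (2 * PI * s)))%C.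
Proof.
destruct (proj1 (is_derive_C_pair _ _ _) (is_derive_circ a r s)) as [H1 H2].
apply injective_projections; unfold dg, gx, gy.
- exact (is_derive_unique _ _ _ H1).
- exact (is_derive_unique _ _ _ H2).
Qed.

Definition rev {T : Type} (x : R -> T) (t : R) : T := x (- t).

Lemma orbit_rev I x z : orbit (rev I) (rev x) z <-> orbit I x z.
Proof.
unfold rev. split; intros (t & H1 & H2).
- exists (- t). auto.
- exists (- t). rewrite Ropp_involutive. auto.
Qed.

Lemma max_rev O F I x : max_solution O F I x -> max_solution O (vopp F) (rev I) (rev x).
Proof. apply max_reflect. Qed.
Arguments max_rev {O F I x}.

Lemma tends_bwd_rev I x a : tends_bwd (rev I) (rev x) a <-> tends_fwd I x a.
Proof.
rewrite <- tends_fwd_reflect. unfold rev. rewrite !tends_fwd_eps. split; intros [H1 H2]; split; intros.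
- rewrite <- (Ropp_involutive t). apply H1. exact H.
- destruct (H2 e H) as [M HM]. exists M. intros t Ht. rewrite <- (Ropp_involutive t). apply HM, Ht.
- rewrite Ropp_involutive. apply H1. exact H.
- destruct (H2 e H) as [M HM]. exists M. intros t Ht. rewrite Ropp_involutive. apply HM, Ht.
Qed.

Lemma tends_fwd_rev I x a : tends_fwd (rev I) (rev x) a <-> tends_bwd I x a.
Proof. apply tends_fwd_reflect. Qed.

Section Sector.
Context (O : C -> Prop) (F F' : C -> C) (a : C) (n : nat) (c0 : C) (r0 alpha r : R).
Context (St : setup O F F' a n c0 r0 alpha r).
Let LF := st_lf St.
Let Hal := st_pol St.
Let Hr := st_r St.
Let HL : loc_lip O F := lf_lip LF.
Let St' := setup_opp St.
Let H := angle_fun F a n c0 alpha.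
Let Y (phi : R) := INR n * phi + alpha.

Lemma angle_opp rho phi : 0 < rho -> angle_fun (vopp F) a n (- c0) (alpha - PI) rho phi = - H rho phi.
Proof. apply (angle_fun_opp_minus _ _ _ _ _ _ _ _ _ _ LF). Qed.

(** The polar form of [F] is the radial unit vector times a positive factor and [q], whose real part
    is [H]. Transversality to the circle thus means that [H] does not vanish. *)
Lemma dot_radial rho phi : 0 < rho ->
  dotC (unit_dir phi) (F (Pol a rho phi)) = Cmod c0 * rho ^ S n * H rho phi.
Proof.
intros Hrho. set (q := (unit_dir (Y phi) * Gfac F a n c0 (Pol a rho phi))%C).
assert (Hw : (Pol a rho phi - a)%C <> 0) by (apply Cmod_gt_0; rewrite Pol_radius; lra).
assert (Hc := lf_c0 LF). assert (Hwn := Cpow_nz _ (S n) Hw).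
assert (HF : F (Pol a rho phi) = (RtoC (Cmod c0 * rho ^ S n) * (unit_dir phi * q))%C).
{ replace (F (Pol a rho phi)) with (c0 * (Pol a rho phi - a) ^ S n * Gfac F a n c0 (Pol a rho phi))%C by (unfold Gfac; field; auto).
  unfold q. rewrite Hal at 1. rewrite Pol_sub, Cpow_mult_l, unit_dir_pow. unfold Y. rewrite unit_dir_plus, S_INR, Rmult_plus_distr_r, unit_dir_plus, Rmult_1_l.
  rewrite RtoC_mult, RtoC_pow. ring. }
rewrite HF. unfold H, angle_fun. fold (Y phi). fold q.
assert (H1 := sin2_cos2 phi). unfold Rsqr in H1.
generalize (Cmod c0 * rho ^ S n). clearbody q. intros k.
transitivity (k * fst q * (sin phi * sin phi + cos phi * cos phi)); [unfold dotC, unit_dir; simpl; ring|].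
rewrite H1. ring.
Qed.

Lemma transversal_circ s : H r (2 * PI * s) <> 0 -> cross (dg (circ a r) s) (F (circ a r s)) <> 0.
Proof.
intros HH. rewrite dg_circ.
replace (cross (RtoC (2 * PI * r) * (Ci * unit_dir (2 * PI * s)))%C (F (circ a r s))) with
  (- (2 * PI * r) * dotC (unit_dir (2 * PI * s)) (F (circ a r s))) by (unfold cross, dotC; simpl; ring).
unfold circ. rewrite dot_radial by lra.
assert (Hc : 0 < Cmod c0) by (apply Cmod_gt_0, (lf_c0 LF)). assert (Hp := PI_RGT_0).
assert (Hrn : 0 < r ^ S n) by (apply pow_lt; lra).
apply Rmult_integral_contrapositive_currified; [nra|].
apply Rmult_integral_contrapositive_currified; [nra|exact HH].
Qed.

Lemma crosses_circle J y s : max_solution O F J y -> y 0 = circ a r s -> H r (2 * PI * s) <> 0 ->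
  enters_or_leaves (circ a r) y /\ (tends_fwd J y a \/ tends_bwd J y a).
Proof.
intros Hy Hy0 HH. unfold circ in Hy0.
assert (Hout : forall t, r < Cmod (y t - a) -> ~ Int_set (curve (circ a r)) (y t) /\ ~ curve (circ a r) (y t)).
{ intros t Ht. rewrite Int_set_circ, curve_circ by lra. lra. }
assert (Hin : forall t, Cmod (y t - a) < r -> Int_set (curve (circ a r)) (y t)).
{ intros t Ht. rewrite Int_set_circ by lra. exact Ht. }
destruct (Rlt_dec 0 (H r (2 * PI * s))) as [Hpos|Hneg].
- destruct (outward_crossing St J y _ Hy Hy0 Hpos) as (H1 & H2 & e & He & H3).
  split; [|right; exact H1]. exists e. split; [exact He|]. right. split; intros t Ht; [apply Hin, H2; lra|apply Hout, H3, Ht].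
- destruct (outward_crossing St' (rev J) (rev y) (2 * PI * s) (max_rev Hy)) as (H1 & H2 & e & He & H3).
  + unfold rev. rewrite Ropp_0. exact Hy0.
  + rewrite angle_opp by lra. lra.
  + split; [|left; apply tends_bwd_rev, H1]. unfold rev in *. exists e. split; [exact He|]. left. split; intros t Ht.
    * apply Hin. specialize (H2 (- t) ltac:(lra)). rewrite Ropp_involutive in H2. exact H2.
    * apply Hout. specialize (H3 (- t) ltac:(lra)). rewrite Ropp_involutive in H3. exact H3.
Qed.

Lemma out_line_transversal I x phi f : out_line O F a n c0 alpha r I x phi f ->
  meets_once_transversally F (circ a r) I x (phi / (2 * PI)).
Proof.
intros L. assert (Hp := PI_RGT_0). split; [|split].
- intros z. rewrite circ_div, curve_circ by lra.
  assert (Hd := out_line_disc St I x phi f L z).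
  assert (Hf := br_end (ol_branch L) r (Rle_refl r)).
  split.
  + intros [H1 H2]. destruct (proj1 Hd) as (rho & Hrho & Hz); [split; [exact H1|lra]|].
    rewrite Hz in H2. rewrite Pol_radius in H2 by lra. subst rho. rewrite Hf in Hz. exact Hz.
  + intros ->. split; [|apply Pol_radius; lra]. apply Hd. exists r. split; [lra|]. rewrite Hf. reflexivity.
- apply smooth_circ.
- apply transversal_circ. replace (2 * PI * (phi / (2 * PI))) with phi by (field; lra).
  assert (HH := ol_pos L). fold H in HH. lra.
Qed.

Context (I1 : R -> Prop) (x1 : R -> C) (phi1 : R) (f1 : R -> R).
Context (I2 : R -> Prop) (x2 : R -> C) (phi2 : R) (f2 : R -> R).
Context (L1 : out_line O F a n c0 alpha r I1 x1 phi1 f1).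
Context (M2 : max_solution O F I2 x2).
Context (L2 : out_line O (vopp F) a n (- c0) (alpha - PI) r (rev I2) (rev x2) phi2 f2).
Let B1 := ol_branch L1.
Let B2 := ol_branch L2.

Lemma line1_zone rho : 0 < rho <= r -> Rabs (Y (f1 rho)) < 3 * PI / 4 /\ 0 < H rho (f1 rho).
Proof.
intros Hrho. destruct (Req_dec rho r) as [->|Hne].
- rewrite (br_end B1) by lra. split; [apply (ol_zone L1)|apply (ol_pos L1)].
- apply (br_zone B1). lra.
Qed.

Lemma line2_zone rho : 0 < rho <= r -> Rabs (Y (f2 rho) - PI) < 3 * PI / 4 /\ H rho (f2 rho) < 0.
Proof.
intros Hrho.
assert (Hz : Rabs (INR n * f2 rho + (alpha - PI)) < 3 * PI / 4 /\ 0 < angle_fun (vopp F) a n (- c0) (alpha - PI) rho (f2 rho)).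
{ destruct (Req_dec rho r) as [->|Hne].
  - rewrite (br_end B2) by lra. split; [apply (ol_zone L2)|apply (ol_pos L2)].
  - apply (br_zone B2). lra. }
rewrite angle_opp in Hz by lra. replace (Y (f2 rho) - PI) with (INR n * f2 rho + (alpha - PI)) by (unfold Y; ring). lra.
Qed.

(** At every radius the tangency separates the outgoing line from the incoming one. *)
Lemma lines_ordered rho : 0 < rho <= r -> f1 rho < f2 rho.
Proof.
intros Hrho. destruct (tangency_ex St rho ltac:(lra)) as [eta He].
destruct (line1_zone rho Hrho) as [H1 H2]. destruct (line2_zone rho Hrho) as [H3 H4].
assert (H5 := zone_below_tangency _ _ _ _ _ _ _ _ He H1 H2).
assert (H6 := zone_above_tangency _ _ _ _ _ _ _ _ He H3 H4). lra.
Qed.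

(** For [n = 1] the zones of the two lines are too wide to exclude an overlap after a full turn. The
    bound comes later from the cyclic order of all lines. *)
Context (Hturn : forall rho, 0 < rho <= r -> f2 rho < f1 rho + 2 * PI).

Lemma f1_end rho : r <= rho -> f1 rho = phi1.
Proof. apply (br_end B1). Qed.
Lemma f2_end rho : r <= rho -> f2 rho = phi2.
Proof. apply (br_end B2). Qed.

Lemma lines_lt rho : 0 < rho < r -> f1 rho < f2 rho < f1 rho + 2 * PI.
Proof. intros Hrho. split; [apply lines_ordered|apply Hturn]; lra. Qed.

Lemma lines_le rho : r <= rho -> f1 rho <= f2 rho < f1 rho + 2 * PI.
Proof.
intros Hrho. rewrite f1_end, f2_end by exact Hrho. rewrite <- (f1_end r), <- (f2_end r) by lra.
assert (H1 := lines_ordered r ltac:(lra)). assert (H2 := Hturn r ltac:(lra)). lra.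
Qed.

Lemma phi1_lt_phi2 : phi1 < phi2 < phi1 + 2 * PI.
Proof.
rewrite <- (f1_end r), <- (f2_end r) by lra. split; [apply lines_ordered|apply Hturn]; lra.
Qed.

Let s1 := phi1 / (2 * PI).
Let s2 := phi2 / (2 * PI).

Lemma sector_boundary_polar z : sector_boundary (circ a r) a I1 x1 I2 x2 s1 s2 z <-> polar_boundary a r f1 f2 z.
Proof.
assert (Hp := PI_RGT_0).
assert (HD1 := out_line_disc St I1 x1 phi1 f1 L1 z).
assert (HD2 := out_line_disc St' _ _ phi2 f2 L2 z). rewrite orbit_rev in HD2.
unfold sector_boundary, polar_boundary. rewrite Int_set_circ, arc_circ by lra.
replace (2 * PI * s1) with (f1 r) by (rewrite f1_end by lra; unfold s1; field; lra).
replace (2 * PI * s2) with (f2 r) by (rewrite f2_end by lra; unfold s2; field; lra).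
split.
- intros [Hz|[[Ho Hz]|[[Ho Hz]|Hz]]]; [left; exact Hz| | |right; right; exact Hz].
  + right; left. destruct (proj1 HD1) as (rho & Hrho & He); [split; [exact Ho|lra]|].
    exists rho. split; [|left; exact He]. rewrite He, Pol_radius in Hz; lra.
  + right; left. destruct (proj1 HD2) as (rho & Hrho & He); [split; [exact Ho|lra]|].
    exists rho. split; [|right; exact He]. rewrite He, Pol_radius in Hz; lra.
- intros [Hz|[(rho & Hrho & [Hz|Hz])|Hz]]; [left; exact Hz| | |right; right; right; exact Hz].
  + right; left. destruct (proj2 HD1) as [Ho _]; [exists rho; split; [lra|exact Hz]|].
    split; [exact Ho|]. rewrite Hz, Pol_radius; lra.
  + right; right; left. destruct (proj2 HD2) as [Ho _]; [exists rho; split; [lra|exact Hz]|].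
    split; [exact Ho|]. rewrite Hz, Pol_radius; lra.
Qed.

Lemma sector_set_polar z : sector_set (circ a r) a I1 x1 I2 x2 s1 s2 z ->
  z = a \/ exists rho phi, 0 < rho <= r /\ f1 rho <= phi <= f2 rho /\ z = Pol a rho phi.
Proof.
intros Hz. apply (polar_closed_repr a r f1 f2 (proj1 Hr) lines_lt).
destruct Hz as [Hz|Hz]; [left; apply sector_boundary_polar, Hz|right].
apply (polar_Int_region a r f1 f2 (proj1 Hr) (br_cont B1) (br_cont B2) lines_lt lines_le).
revert Hz. apply Int_set_ext. exact sector_boundary_polar.
Qed.

Lemma polar_sector_set rho phi : 0 < rho < r -> f1 rho < phi < f2 rho ->
  sector_set (circ a r) a I1 x1 I2 x2 s1 s2 (Pol a rho phi).
Proof.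
intros Hrho Hphi. right.
apply (Int_set_ext (polar_boundary a r f1 f2)); [intros w; symmetry; apply sector_boundary_polar|].
apply (polar_region_Int a r f1 f2 (proj1 Hr) (br_cont B1) (br_cont B2) lines_lt).
exists rho, phi. auto.
Qed.

(** The orbit through the tangency provides the loop: its past is a branch [fm] of the field, its
    future a branch [fp] of the reversed field. Between the two lines the order f1 < fm < fp < f2
    places it in the sector. *)
Theorem sector_elliptic : elliptic_sector O F a (circ a r) I1 x1 I2 x2 s1 s2.
Proof.
assert (Hp := PI_RGT_0). assert (Hphi := phi1_lt_phi2). assert (Hn := n_ge_1 St).
assert (Hs1 : 2 * PI * s1 = phi1) by (unfold s1; field; lra).
assert (Hs2 : 2 * PI * s2 = phi2) by (unfold s2; field; lra).
assert (M1 := ol_max L1).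
destruct (tangency_ex St r ltac:(lra)) as [eta He].
assert (He' := He). destruct He' as (HYe & HHe & Hbelow & Habove). fold H in HHe, Hbelow, Habove. fold (Y eta) in HYe.
assert (HYe1 : Rabs (Y eta) < 3 * PI / 4) by (apply Rabs_def1; lra).
assert (HYe2 : Rabs (INR n * eta + (alpha - PI)) < 3 * PI / 4) by (unfold Y in HYe; apply Rabs_def1; lra).
destruct (line1_zone r ltac:(lra)) as [HZ1 HH1]. destruct (line2_zone r ltac:(lra)) as [HZ2 HH2].
rewrite f1_end in HZ1, HH1 by lra. rewrite f2_end in HZ2, HH2 by lra.
assert (H1e : phi1 < eta) by exact (zone_below_tangency _ _ _ _ _ _ _ _ He HZ1 HH1).
assert (He2 : eta < phi2) by exact (zone_above_tangency _ _ _ _ _ _ _ _ He HZ2 HH2).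
set (u := eta / (2 * PI)). assert (Hu : 2 * PI * u = eta) by (unfold u; field; lra).
assert (HOe : O (Pol a r eta)) by (apply (lf_ball LF); rewrite Pol_radius; lra).
destruct (max_exists O F HL _ HOe) as (Ih & xh & Mh & Hxh0).
assert (Hxh0' : rev xh 0 = Pol a r eta) by (unfold rev; rewrite Ropp_0; exact Hxh0).
destruct (tangent_branch St eta HYe1 HHe Ih xh Mh Hxh0) as [Hbwd [fm Bm]].
assert (HHe' : angle_fun (vopp F) a n (- c0) (alpha - PI) r eta = 0) by (rewrite angle_opp by lra; lra).
destruct (tangent_branch St' eta HYe2 HHe' _ _ (max_rev Mh) Hxh0') as [Hfwd [fp Bp]].
apply tends_bwd_rev in Hfwd.
assert (Horder : forall rho, 0 < rho < r -> f1 rho < fm rho /\ fm rho < fp rho /\ fp rho < f2 rho).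
{ intros rho Hrho. split; [|split].
  - apply (branches_disjoint St _ _ _ _ _ _ _ _ M1 Mh (ol_x0 L1) Hxh0 HZ1 HYe1 B1 Bm H1e). lra.
  - destruct (tangency_ex St rho ltac:(lra)) as [er Her].
    destruct (br_zone Bm rho Hrho) as [Z1 P1]. destruct (br_zone Bp rho Hrho) as [Z2 P2].
    rewrite angle_opp in P2 by lra.
    assert (Hlo := zone_below_tangency _ _ _ _ _ _ _ _ Her Z1 P1).
    assert (Hhi := zone_above_tangency _ _ _ _ _ _ _ (fp rho) Her).
    cbv beta in Hhi. replace (INR n * fp rho + alpha - PI) with (INR n * fp rho + (alpha - PI)) in Hhi by ring.
    specialize (Hhi Z2). fold H in Hhi. specialize (Hhi ltac:(lra)). lra.
  - apply (branches_disjoint St' _ _ _ _ _ _ _ _ (max_rev Mh) (max_rev M2) Hxh0' (ol_x0 L2) HYe2 (ol_zone L2) Bp B2 He2). lra. }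
assert (Hneg : forall t, t < 0 -> exists rho, 0 < rho < r /\ xh t = Pol a rho (fm rho)).
{ intros t Ht. destruct (br_orbit Bm t (Rlt_le _ _ Ht)) as (_ & Hr1 & Hx).
  exists (Cmod (xh t - a)). split; [|exact Hx].
  assert (Hmono := br_mono Bm t 0 ltac:(lra)). rewrite Hxh0, Pol_radius in Hmono by lra. lra. }
assert (Hpos : forall t, 0 < t -> exists rho, 0 < rho < r /\ xh t = Pol a rho (fp rho)).
{ intros t Ht. destruct (br_orbit Bp (- t) ltac:(lra)) as (_ & Hr1 & Hx).
  assert (Hmono := br_mono Bp (- t) 0 ltac:(lra)). rewrite Hxh0', Pol_radius in Hmono by lra.
  unfold rev in *. rewrite Ropp_involutive in *. exists (Cmod (xh t - a)). split; [lra|exact Hx]. }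
assert (Hme : fm r = eta) by (apply (br_end Bm); lra).
assert (Hpe : fp r = eta) by (apply (br_end Bp); lra).
assert (Hloop : forall z, (z = a \/ orbit Ih xh z) <-> polar_boundary a r fm fp z).
{ intros z. unfold polar_boundary. rewrite Hme, Hpe. split.
  - intros [Hz|(t & _ & <-)]; [left; exact Hz|]. destruct (Rtotal_order t 0) as [Ht|[->|Ht]].
    + destruct (Hneg t Ht) as (rho & Hrho & Hx). right; left. exists rho. auto.
    + right; right. exists eta. split; [lra|exact Hxh0].
    + destruct (Hpos t Ht) as (rho & Hrho & Hx). right; left. exists rho. auto.
  - intros [Hz|[(rho & Hrho & [Hz|Hz])|(phi & Hphie & Hz)]]; [left; exact Hz| | |]; right.
    + destruct (br_onto Bm rho ltac:(lra)) as (t & Ht & Hrt).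
      destruct (br_orbit Bm t Ht) as (HIt & _ & Hx). exists t. split; [exact HIt|].
      rewrite Hrt in Hx. congruence.
    + apply orbit_rev. destruct (br_onto Bp rho ltac:(lra)) as (t & Ht & Hrt).
      destruct (br_orbit Bp t Ht) as (HIt & _ & Hx). exists t. split; [exact HIt|].
      rewrite Hrt in Hx. congruence.
    + exists 0. split; [exact (max_solution_0 O F Ih xh Mh)|]. rewrite Hxh0, Hz. f_equal. lra. }
(* [Hupper] and [Hlower] give the sign of [H] on the two parts of the boundary arc. [Hlower] is also
   needed at smaller radii; beyond 5 pi/4 it relies on the next tangency, found from the reversed
   field. *)
assert (Hupper : forall phi, phi1 <= phi < eta -> 0 < H r phi).
{ intros phi Hph. apply (zone_up_to_tangency St r eta phi1 phi); try assumption; lra. }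
assert (Hlower : forall rho er phi psi, 0 < rho <= r -> tangency F a n c0 alpha rho er ->
   Rabs (Y psi - PI) < 3 * PI / 4 -> H rho psi < 0 -> er < phi <= psi -> H rho phi < 0 /\ Rabs (Y phi - PI) < 3 * PI / 4).
{ intros rho er phi psi Hrho Her HYpsi HHpsi Hph. apply Rabs_def2 in HYpsi.
  destruct Her as (E1 & E2 & E3 & E4). fold H in E2, E3, E4.
  assert (HYl : Y er < Y phi <= Y psi) by (unfold Y; nra). fold (Y er) in E1.
  split; [|apply Rabs_def1; lra].
  destruct (Rle_dec (Y phi) (5 * PI / 4)) as [Hl|Hl]; [apply E4; [lra|exact Hl]|].
  destruct (tangency_ex St' rho ltac:(lra)) as [e' Hte'].
  assert (Hpe' := zone_below_tangency _ _ _ _ _ _ _ psi Hte').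
  assert (HYpsi' : Rabs (INR n * psi + (alpha - PI)) < 3 * PI / 4) by (unfold Y in HYpsi; apply Rabs_def1; lra).
  specialize (Hpe' HYpsi'). rewrite angle_opp in Hpe' by lra. specialize (Hpe' ltac:(lra)).
  destruct Hte' as (_ & _ & E3' & _). specialize (E3' phi). rewrite angle_opp in E3' by lra.
  unfold Y in Hl. specialize (E3' ltac:(lra) ltac:(lra)). lra. }
split; [split; [apply Rmult_lt_compat_r; [apply Rinv_0_lt_compat; lra|lra]|]|].
{ unfold s1, s2. apply Rlt_div_l; [lra|]. replace ((phi1 / (2 * PI) + 1) * (2 * PI)) with (phi1 + 2 * PI) by (field; lra). lra. }
split; [exact M1|]. split; [exact M2|].
split; [exists (- alpha / INR n); right; exact (br_dir B1)|].
split.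
{ exists (- (alpha - PI) / INR n); left.
  assert (Hd := br_dir B2). destruct Hd as [Hd1 Hd2]. split; [apply tends_bwd_rev, Hd1|].
  apply (filterlim_C (Rbar_locally p_infty) _ (dirvec x2 a)). intros e Hepos.
  destruct (proj1 (filterlim_C (Rbar_locally m_infty) _ (dirvec (rev x2) a) _) Hd2 e Hepos) as [M HM].
  exists (- M). intros t Ht. specialize (HM (- t) ltac:(lra)). unfold dirvec, rev in *. rewrite Ropp_involutive in HM. exact HM. }
split.
(* The second line tends to [a] forwards, so equality of the orbits would make the first line do so
   too. *)
{ intros Heq. apply (ol_non L1).
  assert (Hin : orbit I1 x1 (x2 0)) by (apply Heq; exists 0; split; [exact (max_solution_0 O F I2 x2 M2)|reflexivity]).
  destruct Hin as (t & Ht & Hxt).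
  assert (HU := fun q => max_unique O F HL _ _ _ _ (max_shift O F I1 x1 t M1 Ht) M2 ltac:(cbv beta; rewrite Rplus_0_l; exact Hxt) q).
  apply (tends_fwd_shift I1 x1 a t (proj1 M1) Ht). apply tends_fwd_eps.
  assert (Hd := proj1 (br_dir B2)). apply tends_bwd_rev, tends_fwd_eps in Hd. destruct Hd as [Hd1 Hd2].
  split; [intros q Hq; apply HU, Hd1, Hq|]. intros e Hepos. destruct (Hd2 e Hepos) as [M HM].
  exists (Rmax M 0). intros q Hq. assert (Hq1 := Rle_lt_trans _ _ _ (Rmax_l M 0) Hq). assert (Hq2 := Rle_lt_trans _ _ _ (Rmax_r M 0) Hq).
  cbv beta. destruct (HU q) as [HU1 HU2]. rewrite HU2; [apply HM, Hq1|apply HU1, Hd1; lra]. }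
split; [apply out_line_transversal with f1; exact L1|].
split.
{ split; [|split; [apply smooth_circ|]].
  - intros z. fold s2. rewrite curve_circ by lra. unfold s2. rewrite circ_div.
    assert (Hd := out_line_disc St' _ _ phi2 f2 L2 z). rewrite orbit_rev in Hd. split.
    + intros [Ho Hz]. destruct (proj1 Hd) as (rho & Hrho & Hzz); [split; [exact Ho|lra]|].
      rewrite Hzz, Pol_radius in Hz by lra. subst rho. rewrite f2_end in Hzz by lra. exact Hzz.
    + intros ->. split; [|apply Pol_radius; lra]. apply Hd. exists r. split; [lra|]. rewrite f2_end by lra. reflexivity.
  - apply transversal_circ. rewrite Hs2. lra. }
(* Both ends of the contact arc are [u], because the loop touches the circle in a single point. *)
exists Ih, xh, u, u. split; [exact Mh|]. split; [split; assumption|]. split; [|split; [|split; [|split; [|split; [|split]]]]].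
- intros z (t & _ & <-). destruct (Rtotal_order t 0) as [Ht|[->|Ht]].
  + destruct (Hneg t Ht) as (rho & Hrho & ->). destruct (Horder rho Hrho) as (O1 & O2 & O3). apply polar_sector_set; [exact Hrho|lra].
  + left. right; right; right. apply arc_circ. exists eta. split; [lra|exact Hxh0].
  + destruct (Hpos t Ht) as (rho & Hrho & ->). destruct (Horder rho Hrho) as (O1 & O2 & O3). apply polar_sector_set; [exact Hrho|lra].
- unfold s1, u. apply Rmult_lt_compat_r; [apply Rinv_0_lt_compat; lra|exact H1e].
- lra.
- unfold s2, u. apply Rmult_lt_compat_r; [apply Rinv_0_lt_compat; lra|exact He2].
- intros z. rewrite curve_circ, arc_circ, Hu by lra. split.
  + intros [(t & _ & <-) Hz]. destruct (Rtotal_order t 0) as [Ht|[->|Ht]].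
    * destruct (Hneg t Ht) as (rho & Hrho & Hx). rewrite Hx, Pol_radius in Hz; lra.
    * exists eta. split; [lra|exact Hxh0].
    * destruct (Hpos t Ht) as (rho & Hrho & Hx). rewrite Hx, Pol_radius in Hz; lra.
  + intros (phi & Hphie & ->). replace phi with eta by lra. split; [|apply Pol_radius; lra].
    exists 0. split; [exact (max_solution_0 O F Ih xh Mh)|exact Hxh0].
- intros s Hs J y Hy Hy0. apply crosses_circle with s; [exact Hy|exact Hy0|].
  destruct Hs as [Hs|Hs].
  + assert (Hh := Hupper (2 * PI * s)). specialize (Hh ltac:(nra)). lra.
  + destruct (Hlower r eta (2 * PI * s) phi2 ltac:(lra) He HZ2 HH2) as [Hh _]; [nra|lra].
- intros z Hz J y Hy Hy0.
  assert (Hltmp : forall rho, 0 < rho < r -> fm rho < fp rho < fm rho + 2 * PI).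
  { intros rho Hrho. destruct (Horder rho Hrho) as (O1 & O2 & O3). assert (Ht := Hturn rho ltac:(lra)). lra. }
  assert (Hlemp : forall rho, r <= rho -> fm rho <= fp rho < fm rho + 2 * PI).
  { intros rho Hrho. rewrite (br_end Bm) by exact Hrho. rewrite (br_end Bp) by exact Hrho. lra. }
  destruct (polar_Int_region a r fm fp (proj1 Hr) (br_cont Bm) (br_cont Bp) Hltmp Hlemp z) as (rho & phi & Hrho & Hph & Hzp).
  { revert Hz. apply Int_set_ext. exact Hloop. }
  assert (Hyp : y 0 = Pol a rho phi) by congruence.
  assert (Hyp' : rev y 0 = Pol a rho phi) by (unfold rev; rewrite Ropp_0; exact Hyp).
  assert (Hrady : Cmod (y 0 - a) = rho) by (rewrite Hyp, Pol_radius; lra).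
  destruct (radial_angle_sign LF Hal rho phi (proj1 Hrho)) as (Sg1 & Sg2 & Sg3). rewrite <- Hyp in Sg1, Sg2, Sg3. fold H in Sg1, Sg2, Sg3.
  destruct (tangency_ex St rho ltac:(lra)) as [er Her].
  destruct (br_zone Bm rho Hrho) as [Zm Pm]. destruct (br_zone Bp rho Hrho) as [Zp Pp].
  rewrite angle_opp in Pp by lra. fold H in Pm.
  assert (Zp' : Rabs (Y (fp rho) - PI) < 3 * PI / 4) by (replace (Y (fp rho) - PI) with (INR n * fp rho + (alpha - PI)) by (unfold Y; ring); exact Zp).
  (* On the outgoing side of the tangency the past tends to [a] by convexity, and an orbit whose
     future did not would exit beyond [eta]. On the incoming side the roles of past and future are
     exchanged; at the tangency convexity gives both. *)
  destruct (Rtotal_order phi er) as [Hlt|[Heq|Hgt]].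
  + destruct (zone_up_to_tangency St rho er (fm rho) phi ltac:(lra) Her Zm Pm ltac:(lra)) as [Hpp Hzz].
    split.
    * apply NNPP. intros Hnt.
      destruct (exit_beyond_branch St Ih xh eta fm J y rho phi Mh Hxh0 HYe1 HHe Bm Hy Hrho Hyp Hzz Hnt) as (psi & HYpsi & HHpsi & Hbey & _).
      assert (Hc := zone_below_tangency _ _ _ _ _ _ _ _ He HYpsi HHpsi). specialize (Hbey ltac:(lra)). lra.
    * apply (outward_tends LF J y Hy ltac:(lra)). apply Sg2. left; exact Hpp.
  + assert (HH0 : H rho phi = 0) by (subst phi; apply Her). apply Sg3 in HH0. split.
    * apply (inward_tends LF J y Hy ltac:(lra)). lra.
    * apply (outward_tends LF J y Hy ltac:(lra)). lra.
  + destruct (Hlower rho er phi (fp rho) ltac:(lra) Her Zp' ltac:(lra) ltac:(lra)) as [Hpp Hzz].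
    assert (Hzz' : Rabs (INR n * phi + (alpha - PI)) < 3 * PI / 4) by (replace (INR n * phi + (alpha - PI)) with (Y phi - PI) by (unfold Y; ring); exact Hzz).
    split.
    * apply (inward_tends LF J y Hy ltac:(lra)). apply Rnot_lt_le. intros Hneg'. apply Sg1 in Hneg'. lra.
    * apply NNPP. intros Hnt.
      destruct (exit_beyond_branch St' _ _ eta fp _ _ rho phi (max_rev Mh) Hxh0' HYe2 HHe' Bp (max_rev Hy) Hrho Hyp' Hzz') as (psi & HYpsi & HHpsi & _ & Hbey).
      { intros Hf. apply Hnt, tends_fwd_rev, Hf. }
      rewrite angle_opp in HHpsi by lra. specialize (Hbey ltac:(lra)).
      assert (Hc := zone_above_tangency _ _ _ _ _ _ _ psi He).
      cbv beta in Hc. replace (INR n * psi + alpha - PI) with (INR n * psi + (alpha - PI)) in Hc by ring. specialize (Hc HYpsi). fold H in Hc. specialize (Hc ltac:(lra)). lra.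
Qed.
End Sector.
Arguments lines_ordered {O F F' a n c0 r0 alpha r}.
Arguments sector_elliptic {O F F' a n c0 r0 alpha r}.
Arguments sector_set_polar {O F F' a n c0 r0 alpha r}.

(** * Assembling the sectors *)

Lemma vopp_vopp F : vopp (vopp F) = F.
Proof. apply functional_extensionality. intros z. unfold vopp. ring. Qed.

Lemma rev_rev {T : Type} (x : R -> T) : rev (rev x) = x.
Proof. apply functional_extensionality. intros t. unfold rev. rewrite Ropp_involutive. reflexivity. Qed.

Lemma max_rev_inv O F I x : max_solution O (vopp F) I x -> max_solution O F (rev I) (rev x).
Proof. intros H. apply max_rev in H. rewrite vopp_vopp in H. exact H. Qed.

Lemma tends_bwd_dir_rev I x a th : tends_bwd_dir (rev I) (rev x) a th -> tends_fwd_dir I x a th.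
Proof.
intros [H1 H2]. split; [apply tends_bwd_rev, H1|].
apply (filterlim_C (Rbar_locally p_infty) _ (dirvec x a)). intros e He.
destruct (proj1 (filterlim_C (Rbar_locally m_infty) _ (dirvec (rev x) a) _) H2 e He) as [M HM].
exists (- M). intros t Ht. specialize (HM (- t) ltac:(lra)). unfold dirvec, rev in *. rewrite Ropp_involutive in HM. exact HM.
Qed.

Lemma tends_fwd_dir_rev I x a th : tends_fwd_dir (rev I) (rev x) a th -> tends_bwd_dir I x a th.
Proof.
intros [H1 H2]. split; [apply tends_fwd_rev, H1|].
apply (filterlim_C (Rbar_locally m_infty) _ (dirvec x a)). intros e He.
destruct (proj1 (filterlim_C (Rbar_locally p_infty) _ (dirvec (rev x) a) _) H2 e He) as [M HM].
exists (- M). intros t Ht. specialize (HM (- t) ltac:(lra)). unfold dirvec, rev in *. rewrite Ropp_involutive in HM. exact HM.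
Qed.

Lemma characteristic_rev I x a : characteristic (rev I) (rev x) a -> characteristic I x a.
Proof.
intros (th & [H|H]); exists th; [right; apply tends_fwd_dir_rev, H|left; apply tends_bwd_dir_rev, H].
Qed.

Lemma sector_boundary_rev g a I1 x1 I2 x2 s1 s2 z :
  sector_boundary g a (rev I1) (rev x1) (rev I2) (rev x2) s1 s2 z <-> sector_boundary g a I1 x1 I2 x2 s1 s2 z.
Proof. unfold sector_boundary. rewrite !orbit_rev. reflexivity. Qed.

Lemma meets_once_rev F g I x s : meets_once_transversally (vopp F) g (rev I) (rev x) s -> meets_once_transversally F g I x s.
Proof.
intros (H1 & H2 & H3). split; [|split; [exact H2|]].
- intros z. rewrite <- H1, orbit_rev. reflexivity.
- intros H. apply H3. replace (cross (dg g s) (vopp F (g s))) with (- cross (dg g s) (F (g s))) by (unfold cross, vopp; simpl; ring).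
  rewrite H. ring.
Qed.

Lemma enters_or_leaves_rev g x : enters_or_leaves g (rev x) -> enters_or_leaves g x.
Proof.
unfold rev. intros (e & He & [[H1 H2]|[H1 H2]]); exists e; (split; [exact He|]); [right|left]; split; intros t Ht.
- specialize (H1 (- t) ltac:(lra)). rewrite Ropp_involutive in H1. exact H1.
- specialize (H2 (- t) ltac:(lra)). rewrite Ropp_involutive in H2. exact H2.
- specialize (H1 (- t) ltac:(lra)). rewrite Ropp_involutive in H1. exact H1.
- specialize (H2 (- t) ltac:(lra)). rewrite Ropp_involutive in H2. exact H2.
Qed.

Lemma homoclinic_rev I x a : homoclinic (rev I) (rev x) a <-> homoclinic I x a.
Proof. unfold homoclinic. rewrite tends_bwd_rev, tends_fwd_rev. tauto. Qed.

(** Every clause is symmetric under time reversal: forward and backward limits, and entering and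
    leaving, are exchanged, while orbits and interiors are unchanged as sets. *)
Lemma elliptic_sector_rev O F a g I1 x1 I2 x2 s1 s2 : max_solution O F I1 x1 -> max_solution O F I2 x2 ->
  elliptic_sector O (vopp F) a g (rev I1) (rev x1) (rev I2) (rev x2) s1 s2 -> elliptic_sector O F a g I1 x1 I2 x2 s1 s2.
Proof.
intros M1 M2 (H1 & _ & _ & H2 & H3 & H4 & H5 & H6 & Ih & xh & u & v & K1 & K2 & K3 & K4 & K5 & K6 & K7 & K8 & K9).
split; [exact H1|]. split; [exact M1|]. split; [exact M2|]. split; [apply characteristic_rev, H2|]. split; [apply characteristic_rev, H3|].
split. { intros Heq. apply H4. intros z. rewrite !orbit_rev. apply Heq. }
split; [apply meets_once_rev, H5|]. split; [apply meets_once_rev, H6|].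
assert (Hss : forall z, sector_set g a (rev I1) (rev x1) (rev I2) (rev x2) s1 s2 z -> sector_set g a I1 x1 I2 x2 s1 s2 z).
{ intros z [Hz|Hz]; [left; apply sector_boundary_rev, Hz|right].
  revert Hz. apply Int_set_ext. intros w. apply sector_boundary_rev. }
exists (rev Ih), (rev xh), u, v. split; [apply max_rev_inv, K1|]. split; [apply homoclinic_rev, K2|].
split; [intros z Hz; apply Hss, K3, orbit_rev, Hz|].
split; [exact K4|]. split; [exact K5|]. split; [exact K6|]. split; [intros z; rewrite orbit_rev; apply K7|]. split.
- intros s Hs J y Hy Hy0. destruct (K8 s Hs (rev J) (rev y)) as [E1 E2].
  + apply max_rev, Hy.
  + unfold rev. rewrite Ropp_0. exact Hy0.
  + split; [apply enters_or_leaves_rev, E1|]. rewrite tends_fwd_rev, tends_bwd_rev in E2. tauto.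
- intros z Hz J y Hy Hy0. apply homoclinic_rev. apply (K9 z).
  + revert Hz. apply Int_set_ext. intros w. rewrite orbit_rev. reflexivity.
  + apply max_rev, Hy.
  + unfold rev. rewrite Ropp_0. exact Hy0.
Qed.

(** * Iterated time reversal *)

Definition vflip (k : nat) (F : C -> C) : C -> C := Nat.iter k vopp F.
Definition cflip (k : nat) (c : C) : C := Nat.iter k Copp c.
Definition tflip {T : Type} (k : nat) (x : R -> T) : R -> T := Nat.iter k rev x.

Lemma vflip_even n F : vflip (2 * n) F = F.
Proof.
induction n as [|n IH]; [reflexivity|]. replace (2 * S n)%nat with (S (S (2 * n))) by lia.
change (vopp (vopp (vflip (2 * n) F)) = F). rewrite IH. apply vopp_vopp.
Qed.

Lemma cflip_even n c : cflip (2 * n) c = c.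
Proof.
induction n as [|n IH]; [reflexivity|]. replace (2 * S n)%nat with (S (S (2 * n))) by lia.
change ((- - cflip (2 * n) c)%C = c). rewrite IH. ring.
Qed.

Lemma tflip_even {T : Type} n (x : R -> T) : tflip (2 * n) x = x.
Proof.
induction n as [|n IH]; [reflexivity|]. replace (2 * S n)%nat with (S (S (2 * n))) by lia.
change (rev (rev (tflip (2 * n) x)) = x). rewrite IH. apply rev_rev.
Qed.

Lemma vflip_twice k F : vflip k (vflip k F) = F.
Proof. unfold vflip. rewrite <- Nat.iter_add. replace (k + k)%nat with (2 * k)%nat by lia. apply vflip_even. Qed.

Lemma tflip_twice {T : Type} k (x : R -> T) : tflip k (tflip k x) = x.
Proof. unfold tflip. rewrite <- Nat.iter_add. replace (k + k)%nat with (2 * k)%nat by lia. apply tflip_even. Qed.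

Lemma max_flip k O F I x : max_solution O F I x -> max_solution O (vflip k F) (tflip k I) (tflip k x).
Proof. intros H. induction k as [|k IH]; [exact H|]. exact (max_rev IH). Qed.

Lemma orbit_flip k I x z : orbit (tflip k I) (tflip k x) z <-> orbit I x z.
Proof.
induction k as [|k IH]; [reflexivity|]. rewrite <- IH.
exact (orbit_rev (tflip k I) (tflip k x) z).
Qed.

Lemma directions_flip k I x a th :
  tends_bwd_dir (tflip k I) (tflip k x) a th \/ tends_fwd_dir (tflip k I) (tflip k x) a th ->
  tends_fwd_dir I x a th \/ tends_bwd_dir I x a th.
Proof.
induction k as [|k IH]; [simpl; tauto|]. intros [H|H]; apply IH.
- right. apply tends_bwd_dir_rev, H.
- left. apply tends_fwd_dir_rev, H.
Qed.

Lemma sector_boundary_flip k g a I1 x1 I2 x2 s1 s2 z :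
  sector_boundary g a (tflip k I1) (tflip k x1) (tflip k I2) (tflip k x2) s1 s2 z <-> sector_boundary g a I1 x1 I2 x2 s1 s2 z.
Proof. unfold sector_boundary. rewrite !orbit_flip. reflexivity. Qed.

Lemma sector_set_flip k g a I1 x1 I2 x2 s1 s2 z : sector_set g a I1 x1 I2 x2 s1 s2 z ->
  sector_set g a (tflip k I1) (tflip k x1) (tflip k I2) (tflip k x2) s1 s2 z.
Proof.
intros [H|H]; [left; apply sector_boundary_flip, H|right].
revert H. apply Int_set_ext. intros w. symmetry. apply sector_boundary_flip.
Qed.

Lemma elliptic_sector_flip k O F a g I1 x1 I2 x2 s1 s2 : max_solution O F I1 x1 -> max_solution O F I2 x2 ->
  elliptic_sector O (vflip k F) a g (tflip k I1) (tflip k x1) (tflip k I2) (tflip k x2) s1 s2 -> elliptic_sector O F a g I1 x1 I2 x2 s1 s2.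
Proof.
intros M1 M2. induction k as [|k IH]; [exact (fun H => H)|]. intros H. apply IH.
apply elliptic_sector_rev; [apply max_flip, M1|apply max_flip, M2|exact H].
Qed.

Lemma setup_flip O F F' a n c0 r0 alpha r k : setup O F F' a n c0 r0 alpha r ->
  setup O (vflip k F) (vflip k F') a n (cflip k c0) r0 (alpha - INR k * PI) r.
Proof.
intros St. induction k as [|k IH].
- simpl. rewrite Rmult_0_l, Rminus_0_r. exact St.
- replace (alpha - INR (S k) * PI) with (alpha - INR k * PI - PI) by (rewrite S_INR; ring).
  exact (setup_opp IH).
Qed.
Arguments setup_flip {O F F' a n c0 r0 alpha r}.

(* Odd lines are incoming for [F]: they are outgoing lines of [- F] run backwards in time. *)
Definition line (O : C -> Prop) (F : C -> C) (a : C) (n : nat) (c0 : C) (alpha r : R) (k : nat) (I : R -> Prop) (x : R -> C) (phi : R) (f : R -> R) : Prop :=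
  max_solution O F I x /\
  out_line O (vflip k F) a n (cflip k c0) (alpha - INR k * PI) r (tflip k I) (tflip k x) phi f.

Lemma line_exists O F F' a n c0 r0 alpha r k : setup O F F' a n c0 r0 alpha r ->
  exists I x phi f, line O F a n c0 alpha r k I x phi f.
Proof.
intros St. destruct (out_line_exists (setup_flip k St)) as (I & x & phi & f & L).
exists (tflip k I), (tflip k x), phi, f. split.
- assert (M := max_flip k _ _ _ _ (ol_max L)). rewrite vflip_twice in M. exact M.
- rewrite !tflip_twice. exact L.
Qed.
Arguments line_exists {O F F' a n c0 r0 alpha r}.

(** Raising the angle by a full turn adds 2 n pi to n phi, which cancels the shift by 2n reversals.
    The initial line thus serves again as line number 2n. *)
Lemma line_turn O F F' a n c0 r0 alpha r I x phi f : setup O F F' a n c0 r0 alpha r -> line O F a n c0 alpha r 0 I x phi f ->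
  line O F a n c0 alpha r (2 * n) I x (phi + 2 * PI) (fun rho => f rho + 2 * PI).
Proof.
intros St [M L]. split; [exact M|]. rewrite vflip_even, cflip_even, !tflip_even. simpl in L.
rewrite Rmult_0_l, Rminus_0_r in L.
assert (Hn := n_ge_1 St). assert (Hp := PI_RGT_0).
assert (HY : forall p, INR n * (p + 2 * PI) + (alpha - INR (2 * n) * PI) = INR n * p + alpha).
{ intros p. rewrite mult_INR. simpl (INR 2). ring. }
assert (HPol : forall rho p, Pol a rho (p + 2 * PI) = Pol a rho p).
{ intros rho p. rewrite <- (Pol_period a rho p 1). f_equal. simpl. ring. }
assert (HA : forall rho p, angle_fun F a n c0 (alpha - INR (2 * n) * PI) rho (p + 2 * PI) = angle_fun F a n c0 alpha rho p).
{ intros rho p. unfold angle_fun. rewrite HY, HPol. reflexivity. }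
destruct L as [L1 L2 L3 L4 [B1 B2 B3 B4 B5 B6 B7] L6]. constructor.
- exact L1.
- rewrite HPol. exact L2.
- rewrite HY. exact L3.
- rewrite HA. exact L4.
- constructor.
  + intros rho Hrho. apply (continuous_plus (V := R_NormedModule)); [apply B1, Hrho|apply continuous_const].
  + intros rho Hrho. rewrite B2 by exact Hrho. reflexivity.
  + intros rho Hrho. rewrite HA, HY. apply B3, Hrho.
  + intros t Ht. rewrite HPol. apply B4, Ht.
  + exact B5.
  + exact B6.
  + destruct B7 as [B7 B8]. split; [exact B7|].
    replace (unit_dir (- (alpha - INR (2 * n) * PI) / INR n)) with (unit_dir (- alpha / INR n)); [exact B8|].
    rewrite <- (unit_dir_period (- alpha / INR n) 1). f_equal. rewrite mult_INR. simpl. field. lra.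
- exact L6.
Qed.

(** * The circle as admissible curve *)

Lemma circ_jordan a r : 0 < r -> jordan_pc1 (circ a r).
Proof.
intros Hr. assert (Hp := PI_RGT_0). split; [|split; [|split]].
- intros s. exact (is_derive_C_continuous _ _ _ (is_derive_circ a r s)).
- intros s. unfold circ. rewrite <- (Pol_period a r (2 * PI * s) 1). f_equal. simpl. ring.
- intros s t Hs Ht He. unfold circ in He. apply Pol_angle_eq in He; [|exact Hr|split; nra].
  apply Rmult_eq_reg_l with (2 * PI); [exact He|apply Rgt_not_eq; lra].
- exists nil. split; [|intros p []]. intros s _. split; [apply smooth_circ|].
  assert (Hd : forall s, Derive (gx (circ a r)) s = fst (dg (circ a r) s) /\ Derive (gy (circ a r)) s = snd (dg (circ a r) s)) by (intros; split; reflexivity).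
  assert (Hc : continuous (fun s => dg (circ a r) s) s).
  { apply (continuous_ext (fun s => Pol 0 (2 * PI * r) (2 * PI * s + PI / 2))).
    - intros t. rewrite dg_circ. unfold Pol, unit_dir. rewrite cos_plus, sin_plus, cos_PI2, sin_PI2.
      apply injective_projections; simpl; ring.
    - apply continuous_Pol; [apply continuous_const|].
      apply (continuous_plus (V := R_NormedModule)); [|apply continuous_const].
      apply (continuous_mult (K := R_AbsRing)); [apply continuous_const|apply continuous_id]. }
  split; [exact (continuous_C_fst _ _ Hc)|exact (continuous_C_snd _ _ Hc)].
Qed.

Lemma circ_ccw a r : 0 < r -> ccw (circ a r).
Proof.
(* Turning the tangent by a right angle points to the centre: the shifted point has radius r (1 - 2
   pi e), positive for [e] below this bound. *)
intros Hr s _ _. assert (Hp := PI_RGT_0). exists (/ (2 * PI)). split; [apply Rinv_0_lt_compat; lra|].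
intros e He. apply Int_set_circ; [exact Hr|].
assert (He' : e * (2 * PI) < 1). { apply Rmult_lt_reg_r with (/ (2 * PI)); [apply Rinv_0_lt_compat; lra|]. rewrite Rmult_assoc, Rinv_r by lra. lra. }
replace (circ a r s + e * (Ci * dg (circ a r) s))%C with (Pol a (r * (1 - e * (2 * PI))) (2 * PI * s)).
- assert (Hk : 0 < e * (2 * PI)) by (apply Rmult_lt_0_compat; lra).
  set (k := e * (2 * PI)) in *. rewrite Pol_radius; nra.
- rewrite dg_circ. unfold circ, Pol. apply injective_projections; simpl; ring.
Qed.

Lemma circ_admissible O F F' a n c0 r0 r : local_form O F F' a n c0 r0 -> 0 < r < r0 -> admissible_curve O F a (circ a r).
Proof.
intros LF Hr.
assert (Hin : forall z, Int_set (curve (circ a r)) z \/ curve (circ a r) z -> Cmod (z - a) <= r).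
{ intros z. rewrite Int_set_circ, curve_circ by lra. lra. }
split; [apply circ_jordan; lra|]. split; [apply circ_ccw; lra|]. split; [|split].
- intros z Hz. apply (lf_ball LF). specialize (Hin z Hz). lra.
- apply Int_set_circ; [lra|]. rewrite Cmod_sub_diag. lra.
- intros z Hz HF. apply NNPP. intros Hne. specialize (Hin z Hz).
  assert (Hw : (z - a)%C <> 0) by exact (fun H0 => Hne (Csub_eq_0 _ _ H0)).
  assert (Hq : 0 < Cmod (c0 * (z - a) ^ S n)) by (apply Cmod_gt_0, Cmult_neq_0; [apply (lf_c0 LF)|apply Cpow_nz, Hw]).
  assert (Hb := lf_F LF z ltac:(lra)). rewrite HF in Hb.
  replace (0 - c0 * (z - a) ^ S n)%C with (- (c0 * (z - a) ^ S n))%C in Hb by ring. rewrite Cmod_opp in Hb. lra.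
Qed.

(** Each line contains points arbitrarily close to [a], so what holds for all orbits near [a] holds
    for a time shift of the line. *)
Lemma near_punctured_line O F F' a n c0 r0 alpha r (P : (R -> Prop) -> (R -> C) -> Prop) k I x phi f :
  setup O F F' a n c0 r0 alpha r -> line O F a n c0 alpha r k I x phi f -> near_punctured O F a P ->
  exists t, I t /\ P (fun s => I (s + t)) (fun s => x (s + t)).
Proof.
intros St [M L] (rho & Hrho & HP).
assert (Hr := st_r St).
set (q := Rmin (rho / 2) r). assert (Hq : 0 < q) by (apply Rmin_pos; lra).
assert (Hq1 : q <= rho / 2) by apply Rmin_l. assert (Hq2 : q <= r) by apply Rmin_r.
destruct (out_line_disc (setup_flip k St) _ _ phi f L (Pol a q (f q))) as [_ H].
destruct H as [Ho Hrad]; [exists q; split; [lra|reflexivity]|]. apply orbit_flip in Ho. destruct Ho as (t & Ht & Hxt).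
exists t. split; [exact Ht|]. apply (HP (x t)).
- rewrite Hxt, Pol_radius; lra.
- apply (max_shift O F I x t M Ht).
- rewrite Rplus_0_l. reflexivity.
Qed.
Arguments near_punctured_line {O F F' a n c0 r0 alpha r}.

Lemma line0_not_tends_fwd O F a n c0 alpha r I x phi f : line O F a n c0 alpha r 0 I x phi f -> ~ tends_fwd I x a.
Proof. intros [_ L]. exact (ol_non L). Qed.

Lemma line1_not_tends_bwd O F a n c0 alpha r I x phi f : line O F a n c0 alpha r 1 I x phi f -> ~ tends_bwd I x a.
Proof. intros [_ L] H. apply (ol_non L). apply (tends_fwd_rev I x a), H. Qed.

Lemma not_center_node_focus O F F' a n c0 r0 alpha r : setup O F F' a n c0 r0 alpha r ->
  ~ is_center O F a /\ ~ is_node O F a /\ ~ is_focus O F a.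
Proof.
intros St.
destruct (line_exists 0 St) as (I0 & x0 & p0 & f0 & L0).
destruct (line_exists 1 St) as (I1 & x1 & p1 & f1 & L1).
assert (HT0 := proj1 (proj1 L0)). assert (HT1 := proj1 (proj1 L1)).
assert (Hf : forall P, near_punctured O F a P -> (forall I x, P I x -> tends_fwd I x a) -> False).
{ intros P HP Himp. destruct (near_punctured_line P _ _ _ _ _ St L0 HP) as (t & Ht & HPt).
  apply (line0_not_tends_fwd _ _ _ _ _ _ _ _ _ _ _ L0). apply (tends_fwd_shift I0 x0 a t HT0 Ht), Himp, HPt. }
assert (Hb : forall P, near_punctured O F a P -> (forall I x, P I x -> tends_bwd I x a) -> False).
{ intros P HP Himp. destruct (near_punctured_line P _ _ _ _ _ St L1 HP) as (t & Ht & HPt).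
  apply (line1_not_tends_bwd _ _ _ _ _ _ _ _ _ _ _ L1). apply (tends_bwd_shift I1 x1 a t HT1 Ht), Himp, HPt. }
split; [|split].
- intros Hc. destruct (near_punctured_line _ _ _ _ _ _ St L0 Hc) as (t & Ht & _ & (T & HT & Hper) & _).
  destruct L0 as [M0 L0]. assert (Hbw := proj1 (br_dir (ol_branch L0))).
  apply (tends_bwd_shift I0 x0 a t HT0 Ht), tends_bwd_eps in Hbw. destruct Hbw as [_ Hlim].
  assert (Hne : 0 < Cmod (x0 (0 + t) - a)).
  { rewrite Rplus_0_l. apply Cmod_sub_pos, (max_never_a (st_lf St) I0 x0 M0); [|exact Ht].
    apply Cmod_pos_neq. assert (Hx0 := ol_x0 L0). simpl in Hx0. rewrite Hx0.
    assert (Hr := st_r St). rewrite Pol_radius; lra. }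
  destruct (Hlim _ Hne) as [M HM].
  assert (Hj : forall j : nat, x0 (- (INR j * T) + t) = x0 (0 + t)).
  { induction j as [|j IH]; [f_equal; simpl; ring|]. rewrite <- IH, S_INR.
    specialize (Hper (- ((INR j + 1) * T))). cbv beta in Hper. rewrite <- Hper. f_equal. ring. }
  destruct (INR_unbounded (- M / T)) as [j Hjb].
  specialize (HM (- (INR j * T))). rewrite Hj in HM.
  assert (- M < INR j * T). { apply Rmult_lt_compat_r with (r := T) in Hjb; [|exact HT]. replace (- M / T * T) with (- M) in Hjb by (field; lra). lra. }
  specialize (HM ltac:(lra)). lra.
- intros [Hn|Hn].
  + apply (Hf _ Hn). intros I x (th & H & _). exact H.
  + apply (Hb _ Hn). intros I x (th & H & _). exact H.
- intros [Hn|Hn].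
  + apply (Hf _ Hn). intros I x (H & _). exact H.
  + apply (Hb _ Hn). intros I x (H & _). exact H.
Qed.
Arguments not_center_node_focus {O F F' a n c0 r0 alpha r}.

(** * Cyclic arrangement of the sectors *)

Section Assembly.
Context (O : C -> Prop) (F F' : C -> C) (a : C) (n : nat) (c0 : C) (r0 alpha r : R).
Context (St : setup O F F' a n c0 r0 alpha r).
Context (I : nat -> R -> Prop) (x : nat -> R -> C) (phi : nat -> R) (f : nat -> R -> R).
Context (L : forall k, line O F a n c0 alpha r k (I k) (x k) (phi k) (f k)).
Let d := (2 * n)%nat.
Let Hr : 0 < r < r0 := st_r St.

Definition cphi (k : nat) : R := if Nat.eqb k d then phi 0%nat + 2 * PI else phi k.
Definition cf (k : nat) (rho : R) : R := if Nat.eqb k d then f 0%nat rho + 2 * PI else f k rho.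

Lemma d_ge_2 : (2 <= d)%nat.
Proof. assert (H := lf_n (st_lf St)). unfold d. lia. Qed.

Lemma cyclic_line k : (k <= d)%nat -> line O F a n c0 alpha r k (I (k mod d)) (x (k mod d)) (cphi k) (cf k).
Proof.
intros Hk. assert (Hd := d_ge_2). unfold cphi.
destruct (Nat.eqb_spec k d) as [->|Hne].
- rewrite Nat.Div0.mod_same. 
  replace (cf d) with (fun rho => f 0%nat rho + 2 * PI) by (apply functional_extensionality; intros rho; unfold cf; rewrite Nat.eqb_refl; reflexivity).
  apply (line_turn _ _ _ _ _ _ _ _ _ _ _ _ _ St), L.
- rewrite Nat.mod_small by lia.
  replace (cf k) with (f k) by (apply functional_extensionality; intros rho; unfold cf; destruct (Nat.eqb_spec k d); [contradiction|reflexivity]).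
  apply L.
Qed.

Section OneSector.
Context (i : nat) (Hi : (i < d)%nat).
Let j := ((S i) mod d)%nat.

Lemma sector_line1 : out_line O (vflip i F) a n (cflip i c0) (alpha - INR i * PI) r (tflip i (I i)) (tflip i (x i)) (cphi i) (cf i).
Proof. assert (H := proj2 (cyclic_line i ltac:(lia))). rewrite Nat.mod_small in H by exact Hi. exact H. Qed.

Lemma sector_line2 : out_line O (vopp (vflip i F)) a n (- cflip i c0) (alpha - INR i * PI - PI) r
  (rev (tflip i (I j))) (rev (tflip i (x j))) (cphi (S i)) (cf (S i)).
Proof.
assert (H := proj2 (cyclic_line (S i) Hi)). 
replace (alpha - INR (S i) * PI) with (alpha - INR i * PI - PI) in H by (rewrite S_INR; ring). exact H.
Qed.

Lemma cyclic_order rho : 0 < rho <= r -> cf i rho < cf (S i) rho.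
Proof.
exact (lines_ordered (setup_flip i St) _ _ _ _ _ _ _ _ sector_line1 sector_line2 rho).
Qed.
End OneSector.

Lemma cyclic_increasing i j rho : (i < j <= d)%nat -> 0 < rho <= r -> cf i rho < cf j rho.
Proof.
intros [Hij Hj] Hrho. induction Hij as [|j Hij IH]; [apply cyclic_order; [lia|exact Hrho]|].
eapply Rlt_trans; [apply IH; lia|]. apply cyclic_order; [lia|exact Hrho].
Qed.

Lemma cf_d rho : cf d rho = cf 0 rho + 2 * PI.
Proof. unfold cf. rewrite Nat.eqb_refl. assert (Hd := d_ge_2). destruct (Nat.eqb_spec 0 d); [lia|reflexivity]. Qed.

(** The [d + 1] angles increase strictly and span exactly one turn. A single step falls short of it
    because [d] is at least 2. *)
Lemma cyclic_turn i rho : (i < d)%nat -> 0 < rho <= r -> cf (S i) rho < cf i rho + 2 * PI.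
Proof.
intros Hi Hrho. assert (Hd := d_ge_2). assert (Hcd := cf_d rho).
destruct i as [|i].
- assert (H := cyclic_increasing 1 d rho ltac:(lia) Hrho). lra.
- assert (H1 := cyclic_increasing 0 (S i) rho ltac:(lia) Hrho).
  destruct (Nat.eq_dec (S (S i)) d) as [->|Hne]; [lra|].
  assert (H2 := cyclic_increasing (S (S i)) d rho ltac:(lia) Hrho). lra.
Qed.

Definition param (k : nat) : R := phi k / (2 * PI).

Lemma param_cphi i : (i < d)%nat -> param i = cphi i / (2 * PI).
Proof. intros Hi. unfold param, cphi. destruct (Nat.eqb_spec i d); [lia|reflexivity]. Qed.

Lemma next_param_cphi i : (i < d)%nat -> next_param d param i = cphi (S i) / (2 * PI).
Proof.
intros Hi. assert (Hp := PI_RGT_0). unfold next_param, param, cphi. destruct (Nat.eqb_spec (S i) d); [field; lra|reflexivity].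
Qed.

Lemma sector_i_elliptic i : (i < d)%nat ->
  elliptic_sector O F a (circ a r) (I i) (x i) (I ((S i) mod d)) (x ((S i) mod d)) (param i) (next_param d param i).
Proof.
intros Hi. rewrite param_cphi, next_param_cphi by exact Hi.
assert (M1 := proj1 (L i)). assert (M2 := proj1 (L ((S i) mod d)%nat)).
apply (elliptic_sector_flip i); [exact M1|exact M2|].
apply (sector_elliptic (setup_flip i St) _ _ _ _ _ _ _ _ (sector_line1 i Hi) (max_flip i _ _ _ _ M2) (sector_line2 i Hi)).
intros rho Hrho. apply cyclic_turn; assumption.
Qed.

Lemma sector_i_points i z : (i < d)%nat ->
  sector_set (circ a r) a (I i) (x i) (I ((S i) mod d)) (x ((S i) mod d)) (param i) (next_param d param i) z ->
  z = a \/ exists rho psi, 0 < rho <= r /\ cf i rho <= psi <= cf (S i) rho /\ z = Pol a rho psi.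
Proof.
intros Hi Hz. rewrite param_cphi, next_param_cphi in Hz by exact Hi. apply (sector_set_flip i) in Hz.
revert Hz.
apply (sector_set_polar (setup_flip i St) _ _ _ _ _ _ _ _ (sector_line1 i Hi) (sector_line2 i Hi)).
intros rho Hrho. apply cyclic_turn; assumption.
Qed.

Lemma line_point_on_orbit i rho : (i < d)%nat -> 0 < rho <= r -> orbit (I i) (x i) (Pol a rho (cf i rho)).
Proof.
intros Hi Hrho. apply (orbit_flip i).
apply (out_line_disc (setup_flip i St) _ _ _ _ (sector_line1 i Hi)).
exists rho. auto.
Qed.

(** At each radius the sectors occupy consecutive closed intervals of angles within one turn, so two
    of them share at most end points, which lie on lines. *)
Lemma sectors_meet_on_lines_lt i j z : (i < j < d)%nat ->
  sector_set (circ a r) a (I i) (x i) (I ((S i) mod d)) (x ((S i) mod d)) (param i) (next_param d param i) z ->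
  sector_set (circ a r) a (I j) (x j) (I ((S j) mod d)) (x ((S j) mod d)) (param j) (next_param d param j) z ->
  z = a \/ exists k, (k < d)%nat /\ orbit (I k) (x k) z.
Proof.
intros Hij Hz1 Hz2. assert (Hp := PI_RGT_0).
apply sector_i_points in Hz1; [|lia]. apply sector_i_points in Hz2; [|lia].
destruct Hz1 as [Hz1|(rho & psi & Hrho & Hpsi & Hz1)]; [left; exact Hz1|].
destruct Hz2 as [Hz2|(rho' & psi' & Hrho' & Hpsi' & Hz2)]; [left; exact Hz2|].
right. rewrite Hz1 in Hz2. destruct (Pol_inj a rho psi rho' psi' ltac:(lra) ltac:(lra) Hz2) as [-> [q Hq]].
assert (Hle : forall u v, (u <= v <= d)%nat -> cf u rho <= cf v rho).
{ intros u v Huv. destruct (Nat.eq_dec u v) as [->|Hne]; [lra|]. left. apply cyclic_increasing; [lia|exact Hrho]. }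
assert (H1 := Hle (S i) j ltac:(lia)). assert (H2 := Hle (S j) d ltac:(lia)). assert (H3 := Hle 0%nat i ltac:(lia)).
rewrite cf_d in H2.
assert (Hqb : -1 < IZR q < 2) by (split; nra). destruct Hqb as [Hqa Hqb]. apply lt_IZR in Hqa, Hqb.
(* [q = 0] is a common end point of consecutive intervals; [q = 1] is the wrap-around, where the
   last angle of one sector is the first angle of the other after a turn. *)
assert (q = 0 \/ q = 1)%Z as [-> | ->] by lia; simpl in Hq.
- exists j. split; [lia|]. rewrite Hz1. replace psi with (cf j rho) by lra. apply line_point_on_orbit; [lia|exact Hrho].
- exists i. split; [lia|]. rewrite Hz1. replace psi with (cf i rho) by lra. apply line_point_on_orbit; [lia|exact Hrho].
Qed.

Lemma sectors_meet_on_lines i j z : (i < d)%nat -> (j < d)%nat -> i <> j ->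
  sector_set (circ a r) a (I i) (x i) (I ((S i) mod d)) (x ((S i) mod d)) (param i) (next_param d param i) z ->
  sector_set (circ a r) a (I j) (x j) (I ((S j) mod d)) (x ((S j) mod d)) (param j) (next_param d param j) z ->
  z = a \/ exists k, (k < d)%nat /\ orbit (I k) (x k) z.
Proof.
intros Hi Hj Hij Hz1 Hz2. destruct (Nat.lt_total i j) as [H|[H|H]]; [|contradiction|].
- apply (sectors_meet_on_lines_lt i j); [lia|exact Hz1|exact Hz2].
- apply (sectors_meet_on_lines_lt j i); [lia|exact Hz2|exact Hz1].
Qed.

Lemma cyclic_FED : FED_data O F a d (circ a r) param I x.
Proof.
split; [apply (circ_admissible _ _ _ _ _ _ _ _ (st_lf St) Hr)|]. split.
- intros i Hi. apply (sector_i_elliptic i Hi).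
- exact sector_i_elliptic.
Qed.

Lemma line_direction k th (q : Z) : th = (INR k * PI - alpha) / INR n + 2 * PI * IZR q ->
  tends_fwd_dir (I k) (x k) a th \/ tends_bwd_dir (I k) (x k) a th.
Proof.
intros ->. apply (directions_flip k). left.
destruct (br_dir (ol_branch (proj2 (L k)))) as [H1 H2].
split; [exact H1|]. rewrite unit_dir_period.
replace ((INR k * PI - alpha) / INR n) with (- (alpha - INR k * PI) / INR n); [exact H2|].
unfold Rdiv. ring.
Qed.
End Assembly.
Arguments cyclic_FED {O F F' a n c0 r0 alpha r}.
Arguments sectors_meet_on_lines {O F F' a n c0 r0 alpha r}.

Theorem theorem4p4 :
  forall (O : C -> Prop) (F : C -> C) (a : C) (m : nat),
    is_domain O -> holomorphic_on O F ->
    (exists z, O z /\ F z <> RtoC 0) ->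
    O a -> F a = RtoC 0 -> zero_order O F a m -> m <> 1%nat ->
    let d := (2 * m - 2)%nat in
    ~ is_center O F a /\ ~ is_node O F a /\ ~ is_focus O F a /\
    FED O F a d /\
    exists g s I x,
      FED_data O F a d g s I x /\
      (* the characteristic orbits tend to a in adjacent definite directions of E(F,m) *)
      (exists th : nat -> R,
         forall i, (i < d)%nat ->
           (forall c, nth_cderiv O F m a c -> definite_dir c m (th i)) /\
           (tends_fwd_dir (I i) (x i) a (th i) \/ tends_bwd_dir (I i) (x i) a (th i)) /\
           exists k : Z,
             th ((S i) mod d)%nat = th i + PI / (INR m - 1) + 2 * IZR k * PI \/
             th ((S i) mod d)%nat = th i - PI / (INR m - 1) + 2 * IZR k * PI) /\
      (* the sectors intersect only in a and along the characteristic orbits *)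
      (forall i j, (i < d)%nat -> (j < d)%nat -> i <> j -> forall z,
         sector_set g a (I i) (x i) (I ((S i) mod d)%nat) (x ((S i) mod d)%nat) (s i) (next_param d s i) z ->
         sector_set g a (I j) (x j) (I ((S j) mod d)%nat) (x ((S j) mod d)%nat) (s j) (next_param d s j) z ->
         z = a \/ exists k, (k < d)%nat /\ orbit (I k) (x k) z).
Proof.
intros O F a m HO Hhol Hnz Ha HFa (D & HD & HDk & HDm) Hm1 d.
assert (HDo := proj1 HO). assert (HD0 := HD). destruct HD0 as [HD0 HDd].
assert (Hp := PI_RGT_0).
(* Order 0 contradicts [F a = 0]; otherwise [n] is the order minus one. *)
destruct m as [|n]; [exfalso; apply HDm; rewrite HD0 by exact Ha; exact HFa|].
assert (Hn : (1 <= n)%nat) by lia.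
assert (Hd : d = (2 * n)%nat) by (unfold d; lia).
destruct (local_form_exists O F a n D HDo Ha HFa Hn HD HDk HDm) as [r0 LF].
set (c0 := (D (S n) a / INR (fact (S n)))%C) in *.
assert (Hr0 := lf_r0 LF).
(* Polar coordinates about 0 provide the argument [alpha] of [c0]. *)
destruct (Pol_exists 0 c0 0) as (alpha & _ & Hal).
replace (c0 - 0)%C with c0 in Hal by ring.
assert (Hpol : c0 = (RtoC (Cmod c0) * unit_dir alpha)%C) by (rewrite Hal at 1; unfold Pol; ring).
set (r := r0 / 2).
assert (St : setup O F (D 1%nat) a n c0 r0 alpha r) by (constructor; [exact LF|exact Hpol|unfold r; lra]).
destruct (not_center_node_focus St) as (Hnc & Hnn & Hnf).
assert (HLex : forall k, exists l : (R -> Prop) * (R -> C) * (R * (R -> R)),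
  line O F a n c0 alpha r k (fst (fst l)) (snd (fst l)) (fst (snd l)) (snd (snd l))).
{ intros k. destruct (line_exists k St) as (I & x & phi & f & L). exists (I, x, (phi, f)). exact L. }
set (l := fun k => proj1_sig (constructive_indefinite_description _ (HLex k))).
assert (L : forall k, line O F a n c0 alpha r k (fst (fst (l k))) (snd (fst (l k))) (fst (snd (l k))) (snd (snd (l k))))
  by (intros k; exact (proj2_sig (constructive_indefinite_description _ (HLex k)))).
clearbody l.
set (I := fun k => fst (fst (l k))). set (x := fun k => snd (fst (l k))). set (phi := fun k => fst (snd (l k))).
set (f := fun k => snd (snd (l k))).
assert (HFED := cyclic_FED St I x phi f L). rewrite <- Hd in HFED.
split; [exact Hnc|]. split; [exact Hnn|]. split; [exact Hnf|]. split.
{ split; [unfold d; lia|]. split; [exact Hnc|]. split; [exact Hnn|]. split; [exact Hnf|].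
  exists (circ a r), (param phi), I, x. exact HFED. }
exists (circ a r), (param phi), I, x. split; [exact HFED|]. split.
- assert (Hn1 := n_ge_1 St).
  assert (HINR : INR (S n) - 1 = INR n) by (rewrite S_INR; ring).
  (* The number of turns that brings the [k]-th direction into [0, 2 pi). *)
  set (q := fun k => proj1_sig (constructive_indefinite_description _ (angle_mod 0 ((INR k * PI - alpha) / INR n)))).
  set (th := fun k => (INR k * PI - alpha) / INR n + 2 * PI * IZR (q k)).
  assert (Hth : forall k, 0 <= th k < 2 * PI).
  { intros k. unfold th, q. destruct (constructive_indefinite_description _ _) as [z Hz]. simpl. lra. }
  exists th. intros i Hi. split; [|split].
  + intros c (D' & HD' & <-). rewrite <- (cderivs_unique O F D D' HDo HD HD' (S n) a Ha).
    split; [apply Hth|]. exists (Z.of_nat i), (q i), alpha. split.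
    (* The factorial is a positive real factor, so the derivative of order [S n] at [a] has the same
       argument as [c0]. *)
    * assert (Hfm : RtoC (INR (fact (S n))) <> 0) by (intros H; apply RtoC_inj in H; apply (INR_fact_neq_0 _ H)).
      assert (HDc : D (S n) a = (RtoC (INR (fact (S n))) * c0)%C) by (unfold c0; field; exact Hfm).
      unfold is_arg. rewrite HDc, Cmod_mult, Cmod_R, Rabs_right by (apply Rle_ge, pos_INR).
      rewrite Hpol at 1. rewrite RtoC_mult. ring.
    * rewrite HINR, <- INR_IZR_INZ. unfold th. ring.
  + apply (line_direction _ _ _ _ _ _ _ I x phi f L i (th i) (q i)). reflexivity.
  + rewrite HINR. destruct (Nat.eq_dec (S i) d) as [He|Hne].
    * rewrite He, Nat.Div0.mod_same. exists (q 0%nat - q i - 1)%Z. left.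
      assert (Hid : INR i = 2 * INR n - 1).
      { assert (H : INR (S i) = INR (2 * n)) by (f_equal; lia). rewrite S_INR, mult_INR in H. simpl (INR 2) in H. lra. }
      unfold th. rewrite !minus_IZR, Hid. simpl. field. lra.
    * rewrite Nat.mod_small by lia. exists (q (S i) - q i)%Z. left.
      unfold th. rewrite minus_IZR, S_INR. field. lra.
- intros i j Hi Hj Hij z. rewrite Hd in *. intros Hz1 Hz2.
  exact (sectors_meet_on_lines St I x phi f L i j z Hi Hj Hij Hz1 Hz2).
Qed.
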